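(* For every $S_0\in \mathrm{Sym}(\mathbb R^4)$ the sets $C_j^{S_0}$, $j=1,2,3$, are not empty. Moreover, for generic $S_0\in\mathrm{Sym}(\mathbb R^4)$, the curve $C_2^{S_0}$ has odd linking number with $C_1^{S_0}$ and odd linking number with $C_3^{S_0}$ (in the 3-dimensional vector space $i\,\mathrm{su}(2)$).
   Context: $\mathrm{Sym}(\mathbb R^4)$ is the 10-dimensional space of real symmetric $4\times4$ matrices. For $S\in\mathrm{Sym}(\mathbb R^4)$ let $\lambda_1(S)\ge\lambda_2(S)\ge\lambda_3(S)\ge\lambda_4(S)$ be its eigenvalues. $i\,\mathrm{su}(2)$ is the 3-dimensional real vector space of Hermitian $2\times2$ matrices with zero trace. Identifying $\mathbb C^2=\mathbb R^4$, a Hermitian $2\times 2$ matrix is treated as a real symmetric $4\times4$ matrix commuting with multiplication by the imaginary unit, so that $i\,\mathrm{su}(2)\subset \mathrm{Sym}(\mathbb R^4)$. For $S_0\in \mathrm{Sym}(\mathbb R^4)$ put $$C_j^{S_0}=\{H\in i\,\mathrm{su}(2):\ \lambda_j(S_0+H)=\lambda_{j+1}(S_0+H)\},\quad j=1,2,3.$$ ''Generic $S_0$'' means for all $S_0$ outside a set of Lebesgue measure zero in $\mathrm{Sym}(\mathbb R^4)$. For generic $S_0$ the sets $C_j^{S_0}$ are pairwise disjoint smooth one-dimensional real algebraic curves, closed in $i\,\mathrm{su}(2)\cong\mathbb R^3$, and $C_2^{S_0}$ is compact; the linking number of $C_2^{S_0}$ with $C_j^{S_0}$ ($j=1,3$)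 is understood modulo 2: it is the intersection number mod 2 of $C_j^{S_0}$ with a compact 2-chain (in general position, $\mathbb Z_2$ coefficients) whose boundary is $C_2^{S_0}$. *)

(* Defs.v *)
(* MathComp / MathComp-Analysis *)
From HB Require Import structures.
From mathcomp Require Import all_boot all_order all_algebra.
From mathcomp Require Import complex.
From mathcomp Require Import finmap.
From mathcomp Require Import all_classical all_reals all_analysis.

Set Implicit Arguments.
Unset Strict Implicit.
Unset Printing Implicit Defensive.
Import Order.TTheory GRing.Theory Num.Theory.
Import numFieldNormedType.Exports.

Local Open Scope classical_set_scope.
Local Open Scope ring_scope.

Definition eigenvalue_list (R : realType) n (S : 'M[R]_n) (s : seq R) : Prop :=
  sorted (fun x y => y <= x) s /\ char_poly S = \prod_(a <- s) ('X - a%:P).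

(* A symmetric matrix has exactly one such list (symmetric_eigenvalue_list,
   eigenvalue_list_uniq); [::] is a junk value for the other matrices. *)
Definition eigvals (R : realType) n (S : 'M[R]_n) : seq R :=
  xget [::] [set s | eigenvalue_list S s].

(* 1-indexed: lambda 1 S >= lambda 2 S >= .... *)
Definition lambda (R : realType) n (j : nat) (S : 'M[R]_n) : R :=
  (eigvals S)`_(j.-1).

Lemma eigenvalue_list_uniq (R : realType) n (S : 'M[R]_n) (s t : seq R) :
  eigenvalue_list S s -> eigenvalue_list S t -> s = t.
Proof.
move=> [ss Ss] [st St]; apply: (@sorted_eq _ (fun x y : R => y <= x)) => //.
- by move=> y x z yx zy; exact: le_trans zy yx.
- by move=> x y /andP[xy yx]; apply/eqP; rewrite eq_le xy yx.
- by apply: prod_XsubC_eq; rewrite -Ss.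
Qed.

Lemma symmetric_eigenvalue_list (R : realType) n (S : 'M[R]_n) :
  S \is symmetricmx -> exists s, eigenvalue_list S s.
Proof.
pose A : 'M[R[i]]_n := map_mx (real_complex R) S.
move=> /is_hermitianmxP; rewrite expr0 scale1r map_mx_id // => symS.
have herA : A \is hermsymmx.
  apply/is_hermitianmxP; rewrite expr0 scale1r.
  apply/matrixP => i j; rewrite !mxE {1}symS mxE.
  by apply/esym/CrealP/complex_realP; exists (S j i).
have /orthomx_spectralP := hermitian_normalmx herA.
have /mxOverP realD := hermitian_spectral_diag_real herA.
have := spectral_unit A; move: (spectralmx A) realD => P.
move: (spectral_diag A) => D realD Pu eqA.
pose d i := complex.Re (D 0 i).
have charA : char_poly A = \prod_(i < n) ('X - (D 0 i)%:P).
  have eqPA : map_mx polyC P *m char_poly_mx A =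
      char_poly_mx (diag_mx D) *m map_mx polyC P.
    rewrite /char_poly_mx mulmxBr mulmxBl scalar_mxC -!map_mxM; congr (_ - _).
    by congr (map_mx _ _); rewrite eqA !mulmxA mulmxV // mul1mx.
  have := congr1 determinant eqPA; rewrite !det_mulmx mulrC /char_poly.
  move=> /mulIf ->.
    have := char_poly_trig (diag_mx_is_trig D); rewrite /char_poly => ->.
    by apply: eq_bigr => i _; rewrite mxE eqxx mulr1n.
  by rewrite det_map_mx polyC_eq0 -unitfE -unitmxE.
exists (sort (fun x y : R => y <= x) [seq d i | i <- enum 'I_n]); split.
  by apply: sort_sorted => x y; exact: le_total.
rewrite (perm_big _ (permEl (perm_sort _ _))) /=.
apply: (map_poly_inj (real_complex R)).
rewrite map_char_poly charA big_map big_enum /= rmorph_prod /=.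
apply: eq_bigr => i _; rewrite rmorphB /= map_polyX map_polyC /=.
by congr ('X - _%:P); rewrite /d RRe_real.
Qed.

Definition isu2 (R : realType) : set 'M[R[i]]_2 :=
  [set H | H \is hermsymmx /\ \tr H = 0].

(* C^n = R^(n + n) through z |-> (Re z, Im z), on column vectors. *)
Definition real_cV (R : realType) n (z : 'cV[R[i]]_n) : 'cV[R]_(n + n) :=
  col_mx (map_mx (@complex.Re R) z) (map_mx (@complex.Im R) z).

Definition real_mx (R : realType) n (H : 'M[R[i]]_n) : 'M[R]_(n + n) :=
  block_mx (map_mx (@complex.Re R) H) (- map_mx (@complex.Im R) H)
           (map_mx (@complex.Im R) H) (map_mx (@complex.Re R) H).

Lemma real_mxP (R : realType) n (H : 'M[R[i]]_n) (z : 'cV[R[i]]_n) :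
  real_cV (H *m z) = real_mx H *m real_cV z.
Proof.
have ReM (a b : R[i]) : complex.Re (a * b) =
    complex.Re a * complex.Re b - complex.Im a * complex.Im b by case: a b => ? ? [].
have ImM (a b : R[i]) : complex.Im (a * b) =
    complex.Re a * complex.Im b + complex.Im a * complex.Re b by case: a b => ? ? [].
rewrite /real_cV /real_mx mul_block_col mulNmx.
congr col_mx; apply/matrixP => i j; rewrite !mxE raddf_sum /=.
  by rewrite -sumrB; apply: eq_bigr => k _; rewrite !mxE ReM.
by rewrite -big_split /=; apply: eq_bigr => k _; rewrite !mxE ImM addrC.
Qed.

Lemma real_mx_symmetric (R : realType) n (H : 'M[R[i]]_n) :
  H \is hermsymmx -> real_mx H \is symmetricmx.
Proof.
move=> /is_hermitianmxP; rewrite expr0 scale1r => herH.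
apply/is_hermitianmxP; rewrite expr0 scale1r map_mx_id //.
have HE i j : H i j = conjc (H j i) by rewrite {1}herH !mxE.
rewrite /real_mx tr_block_mx; congr block_mx; apply/matrixP => i j;
  by rewrite !mxE HE; case: (H j i) => ? ? //=; rewrite ?opprK.
Qed.

Definition coincidence (R : realType) (S0 : 'M[R]_4) (j : nat) :
    set 'M[R[i]]_2 :=
  [set H | isu2 H /\
    lambda j (S0 + real_mx H) = lambda j.+1 (S0 + real_mx H)].

(* Linear coordinates on i su(2) given by the Pauli matrices. *)
Definition pauli (R : realType) (h : 'rV[R]_3) : 'M[R[i]]_2 :=
  \matrix_(i < 2, j < 2)
    if i == j then Complex (if i == 0 then h 0 ord_max else - h 0 ord_max) 0
    else Complex (h 0 0) (if i == 0 then - h 0 1 else h 0 1).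

Lemma pauli_bij (R : realType) : set_bij [set: 'rV[R]_3] (@isu2 R) (@pauli R).
Proof.
split.
- move=> h _; split.
    apply/is_hermitianmxP; rewrite expr0 scale1r; apply/matrixP => i j.
    rewrite !mxE; case: (i =P j) => [->|/eqP].
      by rewrite eqxx; apply/esym/CrealP/complex_realP; eexists.
    case: i j => [[|[|//]] hi] [[|[|//]] hj] // _;
      by rewrite /= /Num.conj /= ?opprK.
  rewrite /mxtrace big_ord_recl big_ord1 !mxE /=.
  by apply/eqP; rewrite eq_complex /= !addr0 subrr !eqxx.
- move=> h h' _ _ /matrixP e.
  have := e 0 0; have := e 1 0; rewrite !mxE /= => -[e0 e1] [e2].
  apply/rowP => -[[|[|[|//]]] hi].
  + by rewrite (_ : Ordinal hi = 0) //; apply/val_inj.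
  + by rewrite (_ : Ordinal hi = 1) //; apply/val_inj.
  + by rewrite (_ : Ordinal hi = ord_max) //; apply/val_inj.
- move=> H [/is_hermitianmxP]; rewrite expr0 scale1r => herH.
  have HE i j : H i j = conjc (H j i) by rewrite {1}herH !mxE.
  rewrite /mxtrace big_ord_recl big_ord1 => trH.
  pose h : 'rV[R]_3 := \row_k (if k == 0 then complex.Re (H 1 0)
    else if k == 1 then complex.Im (H 1 0) else complex.Re (H 0 0)).
  exists h => //.
  have lift01 : lift ord0 ord0 = 1 :> 'I_2 by apply/val_inj.
  have := HE 0 0; have := HE 0 1; move: trH; rewrite lift01.
  have im0 (x : R) : x = - x -> x = 0.
    by move=> xN; apply/eqP; rewrite -[_ == _]/(x == 0) -eqNr -xN.
  case e00 : (H 0 0) => [a b]; case e11 : (H 1 1) => [c d].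
  case e10 : (H 1 0) => [u v]; case e01 : (H 0 1) => [w z] /=.
  case=> ac bd [wu zv] [] /im0 b0.
  have ca : c = - a by apply/eqP; rewrite -addr_eq0 addrC ac.
  have d0 : d = 0 by move: bd; rewrite b0 add0r.
  have I2 (i : 'I_2) : i = 0 \/ i = 1.
    by case: i => [[|[|//]] hi]; [left | right]; exact/val_inj.
  apply/matrixP => i j; rewrite mxE.
  case: (I2 i) (I2 j) => -> [] ->; rewrite !mxE /= ?e00 ?e10 /=.
  + by rewrite b0.
  + by rewrite e01 wu zv.
  + by [].
  + by rewrite e11 ca d0.
Qed.

(* Lebesgue-null subsets of Sym(R^n), in the linear coordinates (S i j), i <= j:
   N can be covered by countably many boxes of arbitrarily small total
   volume. *)
Definition sym_null (R : realType) n (N : set 'M[R]_n) : Prop :=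
  forall e : R, 0 < e -> exists a b : nat -> 'M[R]_n,
    [/\ forall k i j, a k i j <= b k i j,
        N `<=` \bigcup_k [set S | forall i j : 'I_n, (i <= j)%N ->
                                  a k i j <= S i j <= b k i j]
      & (\sum_(0 <= k <oo)
           (\prod_(p : 'I_n * 'I_n | (p.1 <= p.2)%N)
              (b k p.1 p.2 - a k p.1 p.2))%:E <= e%:E)%E].

Definition generic_sym (R : realType) n (P : 'M[R]_n -> Prop) : Prop :=
  sym_null [set S | S \is symmetricmx /\ ~ P S].

Definition pt2 (R : realType) (s t : R) : 'rV[R]_2 :=
  \row_(i < 2) if i == 0 then s else t.

Definition triangle (R : realType) : set 'rV[R]_2 :=
  [set p | [/\ 0 <= p 0 0, 0 <= p 0 1 & p 0 0 + p 0 1 <= 1]].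
Arguments triangle R : clear implicits.

(* A compact 2-chain with Z/2 coefficients is a formal sum of n continuous
   singular triangles c i; only the values of c i on triangle matter. *)
Definition chain2 (R : realType) (n : nat) :=
  'I_n -> 'rV[R]_2 -> 'rV[R]_3.

(* The faces [v1, v2], [v0, v2], [v0, v1] of s, where v0 = (0, 0), v1 = (1, 0)
   and v2 = (0, 1). *)
Definition face (R : realType) (s : 'rV[R]_2 -> 'rV[R]_3) (k : 'I_3) (t : R) :
    'rV[R]_3 :=
  s (if k == 0 then pt2 (1 - t) t else if k == 1 then pt2 0 t else pt2 t 0).

(* The coefficient, before reduction mod 2, of the singular 1-simplex tau in
   the boundary of c. *)
Definition boundary_coef (R : realType) n (c : chain2 R n)
    (tau : R -> 'rV[R]_3) : nat :=
  (\sum_(i < n) \sum_(k < 3) `[< {in `[0, 1]%R, face (c i) k =1 tau} >])%N.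

(* K is subdivided into the arcs a 0, ..., a m.-1, which overlap only at
   endpoints; loops are allowed.  When K is a closed curve, the sum of the arcs
   represents the mod 2 fundamental class of K as soon as it is a cycle, and
   a boundary is always a cycle. *)
Definition arc_subdivision (R : realType) m (a : 'I_m -> R -> 'rV[R]_3)
    (K : set 'rV[R]_3) : Prop :=
  [/\ forall i, {within `[0, 1], continuous (a i)},
      forall i j s t, s \in `[0, 1]%R -> t \in `[0, 1]%R -> a i s = a j t ->
        (i = j /\ s = t) \/ ((s = 0 \/ s = 1) /\ (t = 0 \/ t = 1))
    & K = \bigcup_i (a i @` `[0, 1])].

(* The boundary of c, computed mod 2, is the curve K. *)
Definition has_boundary (R : realType) n (c : chain2 R n) (K : set 'rV[R]_3) :
    Prop :=
  exists m (a : 'I_m -> R -> 'rV[R]_3), arc_subdivision a K /\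
    forall tau, odd (boundary_coef c tau) <->
                exists i, {in `[0, 1]%R, a i =1 tau}.

Definition C1_near (R : realType) m n (F : 'rV[R]_m -> 'rV[R]_n)
    (x : 'rV[R]_m) : Prop :=
  \forall y \near x, differentiable F y /\ {for y, continuous (jacobian F)}.

(* p is interior to the triangle, L is near s p a regular C^1 curve F = 0, and
   s is transversal to L at p.  Invertibility of the differential of F \o s at
   p gives both the surjectivity of the differential of F at s p and the
   transversality. *)
Definition transversal_at (R : realType) (s : 'rV[R]_2 -> 'rV[R]_3)
    (L : set 'rV[R]_3) (p : 'rV[R]_2) : Prop :=
  [/\ (triangle R)° p, differentiable s p
    & exists F : 'rV[R]_3 -> 'rV[R]_2,
        [/\ C1_near F (s p), \forall y \near s p, L y <-> F y = 0
          & jacobian (F \o s) p \in unitmx]].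

Definition crossings (R : realType) (s : 'rV[R]_2 -> 'rV[R]_3)
    (L : set 'rV[R]_3) : set 'rV[R]_2 :=
  [set p | triangle R p /\ L (s p)].

Definition general_position (R : realType) n (c : chain2 R n)
    (L : set 'rV[R]_3) : Prop :=
  forall i, finite_set (crossings (c i) L) /\
            forall p, crossings (c i) L p -> transversal_at (c i) L p.

Definition spanning_chain (R : realType) n (c : chain2 R n)
    (K L : set 'rV[R]_3) : Prop :=
  [/\ forall i, {within triangle R, continuous (c i)},
      has_boundary c K & general_position c L].

Definition intersection_number (R : realType) n (c : chain2 R n)
    (L : set 'rV[R]_3) : nat :=
  (\sum_(i < n) #|` fset_set (crossings (c i) L)|)%N.

(* The mod 2 linking number of K and L does not depend on the spanning chain:
   such chains exist, and each of them has odd intersection number with L. *)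
Definition odd_linking (R : realType) (K L : set 'rV[R]_3) : Prop :=
  (exists n (c : chain2 R n), spanning_chain c K L) /\
  (forall n (c : chain2 R n), spanning_chain c K L ->
     odd (intersection_number c L)).

Definition odd_linking_isu2 (R : realType) (K L : set 'M[R[i]]_2) : Prop :=
  odd_linking (@pauli R @^-1` K) (@pauli R @^-1` L).

(* Main.v *)
Require Import Defs.
From HB Require Import structures.
From mathcomp Require Import all_boot all_order all_algebra.
From mathcomp Require Import complex finmap.
From mathcomp Require Import all_classical all_reals all_analysis.
From mathcomp Require Import ring lra.
Import Order.TTheory GRing.Theory Num.Theory.
Import numFieldNormedType.Exports.
Local Open Scope classical_set_scope.
Local Open Scope ring_scope.

(** Traceless symmetric 4 x 4 matrices correspond to 3 x 3 matrices, through
    the decomposition so(4) = so(3) + so(3).  Up to its mean trace, S0 + H is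
    the matrix with rows v, p, q ([quaternion_mx]), where H moves v freely and p
    and q depend on S0 only.  If a >= b >= |c| are the singular values of this
    matrix, the last one with the sign of the determinant, then the eigenvalues
    of S0 + H are the mean trace plus a + b + c, a - b - c, - a + b - c and
    - a - b + c.  Hence the three coincidences of consecutive eigenvalues are
    b = - c, a = b and b = c ([eigenvalues_singular]).  A rotation in the plane
    of p and q does not change a, b, c, so p and q may be taken orthogonal with
    |q| <= |p| ([rotate_orthogonal], [gram_rotate]).  A vector v orthogonal to
    both and of length |p| gives a = b; one of length |q|, with the appropriate
    orientation, gives b = c or b = - c ([coincidence_nonempty]).

    If 0 < |q| < |p|, the Gram matrix of the columns is a perturbation of rank
    one of the diagonal matrix with entries |p|^2, |q|^2, 0, and interlacing
    shows where two of its eigenvalues coincide: C_2 is an ellipse, and C_1 and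
    C_3 are the two branches of its focal hyperbola, which lies in an orthogonal
    plane and passes through the foci of the ellipse ([generic_conics]).  The
    matrices for which the original p and q are proportional or orthogonal belong
    to three polynomial images of R^9, which are null sets in dimension 10
    ([degenerate_null]).

    A branch L of the focal hyperbola is the zero set of a complex valued
    function g that is, on the ellipse K, the position relative to the focus, so
    that g maps K to a curve that meets each ray from the origin once
    ([focal_map_ray]).  Square roots of g detect the linking.  A continuous
    square root exists on a triangle without zeros of g ([triangle_sqrt]), and
    around a transversal zero it changes sign; therefore its continuation along
    the boundary of a singular triangle is multiplied by -1 to the number of
    crossings with L ([monodromy_zeros]).  In the product over the triangles of
    a chain with boundary K the other faces cancel modulo 2 ([boundary_prod]),
    and what remains is the sign of a square root continued along K, which is
    -1 ([arcs_transport]).  So every spanning chain has an odd intersection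
    number with L ([odd_intersection]).  A spanning chain in general position is
    given by the flat disc bounded by the ellipse, which meets L in the focus
    only ([disc_spanning_chain]). *)

Set Implicit Arguments.
Unset Strict Implicit.
Unset Printing Implicit Defensive.

(** * Limits and square roots of complex valued functions *)

Section ComplexLimits.
Context {R : realType} {T : Type}.
Implicit Types (F : set_system T) (f g : T -> R[i]).
Local Notation Re := complex.Re.
Local Notation Im := complex.Im.

Lemma complex_ReM (a b : R[i]) : Re (a * b) = Re a * Re b - Im a * Im b.
Proof. by case: a b => ? ? []. Qed.

Lemma complex_ImM (a b : R[i]) : Im (a * b) = Re a * Im b + Im a * Re b.
Proof. by case: a b => ? ? []. Qed.

Lemma complex_ReV (a : R[i]) : Re a^-1 = Re a / (Re a ^+ 2 + Im a ^+ 2).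
Proof. by case: a. Qed.

Lemma complex_ImV (a : R[i]) : Im a^-1 = - Im a / (Re a ^+ 2 + Im a ^+ 2).
Proof. by case: a => x y; rewrite mulNr. Qed.

Lemma complex_sqr_norm_gt0 (a : R[i]) : a != 0 -> 0 < Re a ^+ 2 + Im a ^+ 2.
Proof.
case: a => x y; rewrite eq_complex /= negb_and => /orP[] h.
  by rewrite ltr_pwDl ?exprn_even_gt0 ?sqr_ge0.
by rewrite ltr_wpDl ?exprn_even_gt0 ?sqr_ge0.
Qed.

(** Convergence of the real and imaginary parts, which needs no topology on
    R[i]. *)
Definition ccvg F f (l : R[i]) : Prop :=
  (Re (f x) @[x --> F] --> Re l) /\ (Im (f x) @[x --> F] --> Im l).

Lemma ccvg_cst F (l : R[i]) : Filter F -> ccvg F (fun=> l) l.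
Proof. by move=> FF; split; exact: cvg_cst. Qed.

Lemma ccvgM F f g a b : Filter F ->
  ccvg F f a -> ccvg F g b -> ccvg F (fun x => f x * g x) (a * b).
Proof.
move=> FF [fr fi] [gr gi]; split.
  under eq_fun do rewrite complex_ReM.
  by rewrite complex_ReM; apply: cvgB; apply: cvgM.
under eq_fun do rewrite complex_ImM.
by rewrite complex_ImM; apply: cvgD; apply: cvgM.
Qed.

Lemma ccvgV F f (a : R[i]) : Filter F -> a != 0 -> ccvg F f a ->
  ccvg F (fun x => (f x)^-1) a^-1.
Proof.
move=> FF a0 [fr fi].
have n0 : Re a ^+ 2 + Im a ^+ 2 != 0 by rewrite gt_eqF ?complex_sqr_norm_gt0.
have nF : (Re (f x) ^+ 2 + Im (f x) ^+ 2)^-1 @[x --> F] -->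
          (Re a ^+ 2 + Im a ^+ 2)^-1.
  apply: (@cvgV _ _ F _ (fun x => Re (f x) ^+ 2 + Im (f x) ^+ 2)) => //.
  by rewrite !expr2; under eq_fun do rewrite !expr2; apply: cvgD; apply: cvgM.
split.
  by under eq_fun do rewrite complex_ReV; rewrite complex_ReV; apply: cvgM.
under eq_fun do rewrite complex_ImV; rewrite complex_ImV.
by apply: cvgM => //; apply: cvgN.
Qed.

Lemma ccvg_near_eq F f g a : Filter F ->
  (\forall x \near F, f x = g x) -> ccvg F f a -> ccvg F g a.
Proof.
move=> FF fg [fr fi]; split.
  apply: cvg_trans fr; apply: near_eq_cvg.
  by apply: filterS fg => x ->.
apply: cvg_trans fi; apply: near_eq_cvg.
by apply: filterS fg => x ->.
Qed.

(** The square root with positive real part of a number in the right half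
    plane, written so that its continuity is visible. *)
Definition psqrt (z : R[i]) : R[i] :=
  let n := Num.sqrt (Re z ^+ 2 + Im z ^+ 2) in
  let r := Num.sqrt ((n + Re z) / 2) in Complex r (Im z / (2 * r)).

Lemma psqrtK (z : R[i]) : 0 < Re z -> psqrt z ^+ 2 = z.
Proof.
case: z => x y /= x0; rewrite /psqrt /=.
set n := Num.sqrt (x ^+ 2 + y ^+ 2); set r := Num.sqrt ((n + x) / 2).
have n0 : 0 <= n by exact: sqrtr_ge0.
have nn : n ^+ 2 = x ^+ 2 + y ^+ 2 by rewrite sqr_sqrtr // addr_ge0 ?sqr_ge0.
have r2 : r ^+ 2 = (n + x) / 2 by rewrite sqr_sqrtr; lra.
have r0 : r != 0 by apply/eqP => r0; move: r2; rewrite r0 expr2; lra.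
rewrite expr2; apply/eqP; rewrite eq_complex /=; apply/andP; split; apply/eqP;
  last by field.
have -> : r * r - y / (2 * r) * (y / (2 * r)) =
   r ^+ 2 - y ^+ 2 / (4 * r ^+ 2) by field.
have -> : y ^+ 2 = n ^+ 2 - x ^+ 2 by lra.
by rewrite r2; field; lra.
Qed.

Lemma ccvg_psqrt F f (a : R[i]) : Filter F -> 0 < Re a -> ccvg F f a ->
  ccvg F (fun x => psqrt (f x)) (psqrt a).
Proof.
move=> FF a0 [fr fi].
have sq (g : T -> R) l : g x @[x --> F] --> l ->
    Num.sqrt (g x) @[x --> F] --> Num.sqrt l.
  by move=> gl; apply: continuous_cvg => //; exact: sqrt_continuous.
have rF : complex.Re (psqrt (f x)) @[x --> F] --> complex.Re (psqrt a).
  rewrite /psqrt /=; apply: (sq); apply: cvgM; last exact: cvg_cst.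
  apply: cvgD => //; apply: sq; rewrite !expr2; under eq_fun do rewrite !expr2.
  by apply: cvgD; apply: cvgM.
split=> //; rewrite /psqrt /=; apply: cvgM => //.
apply: cvgV.
  rewrite mulf_neq0 // gt_eqF // sqrtr_gt0 divr_gt0 // ltr_wpDl //.
by apply: cvgM; [exact: cvg_cst|exact: rF].
Qed.

End ComplexLimits.

Section WithinContinuity.
Context {R : realType}.

Definition ccont {T : topologicalType} (A : set T) (f : T -> R[i]) : Prop :=
  forall x, A x -> ccvg (within A (nbhs x)) f (f x).

Context {T : topologicalType}.
Implicit Types (A : set T) (f g : T -> R[i]).

Lemma ccontP A f : ccont A f <->
  {within A, continuous (fun x => complex.Re (f x))} /\
  {within A, continuous (fun x => complex.Im (f x))}.
Proof.
split=> [fc|[/subspace_continuousP fr /subspace_continuousP fi] x Ax].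
  by split; apply/subspace_continuousP => x Ax; have [] := fc x Ax.
by split; [exact: fr|exact: fi].
Qed.

Lemma ccont_cst A (l : R[i]) : ccont A (fun=> l).
Proof. by move=> x _; exact: ccvg_cst. Qed.

Lemma ccontM A f g : ccont A f -> ccont A g -> ccont A (fun x => f x * g x).
Proof. by move=> fc gc x Ax; apply: ccvgM; [exact: fc|exact: gc]. Qed.

Lemma ccontV A f : (forall x, A x -> f x != 0) -> ccont A f ->
  ccont A (fun x => (f x)^-1).
Proof. by move=> f0 fc x Ax; apply: ccvgV; [exact: f0|exact: fc]. Qed.

Lemma ccont_psqrt A f : (forall x, A x -> 0 < complex.Re (f x)) -> ccont A f ->
  ccont A (fun x => psqrt (f x)).
Proof. by move=> f0 fc x Ax; apply: ccvg_psqrt; [exact: f0|exact: fc]. Qed.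

Lemma ccont_prod A (I : Type) (r : seq I) (F : I -> T -> R[i]) :
  (forall i, ccont A (F i)) -> ccont A (fun x => \prod_(i <- r) F i x).
Proof.
move=> Fc; elim: r => [|i r IH].
  by under eq_fun do rewrite big_nil; exact: ccont_cst.
by under eq_fun do rewrite big_cons; apply: ccontM.
Qed.

Lemma ccont_comp {U : topologicalType} (B : set U) (p : U -> T) A f :
  {within B, continuous p} -> (forall y, B y -> A (p y)) -> ccont A f ->
  ccont B (f \o p).
Proof.
move=> /subspace_continuousP pc pBA fc y By.
have pF : p @ within B (nbhs y) --> within A (nbhs (p y)).
  move=> P AP; have : nbhs y (fun z => B z -> A (p z) -> P (p z)).
    exact: (pc y By _ AP).
  by apply: filterS => z h Bz; apply: h => //; exact: pBA.
have [fr fi] := fc _ (pBA y By).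
by split=> Q lQ; [exact: (pF _ (fr _ lQ))|exact: (pF _ (fi _ lQ))].
Qed.

Lemma ccont_eq A f g : (forall x, A x -> f x = g x) -> ccont A f -> ccont A g.
Proof.
move=> fg fc x Ax; rewrite -fg //; apply: ccvg_near_eq (fc x Ax).
by rewrite near_withinE; apply: nearW => y; exact: fg.
Qed.

Lemma ccont_cvg A f x : ccvg (nbhs x) f (f x) -> ccvg (within A (nbhs x)) f (f x).
Proof.
by case=> fr fi; split; [move: fr|move: fi]; apply: cvg_trans; apply: cvg_app; exact: cvg_within.
Qed.

End WithinContinuity.

(** * Continuous square roots on the triangle *)

Section Triangle.
Context {R : realType}.
Local Notation Re := complex.Re.
Local Notation Im := complex.Im.
Local Notation T := (triangle R).

Lemma pt2E0 (s t : R) : pt2 s t 0 0 = s. Proof. by rewrite mxE. Qed.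
Lemma pt2E1 (s t : R) : pt2 s t 0 1 = t. Proof. by rewrite mxE. Qed.
Definition pt2E := (pt2E0, pt2E1).

Lemma pt2_eta (x : 'rV[R]_2) : pt2 (x 0 0) (x 0 1) = x.
Proof.
apply/rowP => i; rewrite mxE; case: i => [[|[|//]] hi] /=;
  by congr (x _ _); apply/val_inj.
Qed.

Lemma norm_rV2_le (x : 'rV[R]_2) (e : R) :
  `|x| <= e <-> `|x 0 0| <= e /\ `|x 0 1| <= e.
Proof.
split=> [xe|[x0 x1]].
  have h i : `|x 0 i| <= e.
    apply: le_trans xe; rewrite /Num.norm /= mx_normrE.
    exact: (le_bigmax _ (fun ij => `|x ij.1 ij.2|) (0, i)).
  by split.
rewrite /Num.norm /= mx_normrE; apply/bigmax_leP; split=> [|[i j] _ /=].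
  exact: le_trans x0.
rewrite ord1; case: j => [[|[|//]] hj].
  by rewrite (_ : Ordinal hj = 0) //; apply/val_inj.
by rewrite (_ : Ordinal hj = 1) //; apply/val_inj.
Qed.

Lemma triangle_compact : compact T.
Proof.
apply: bounded_closed_compact.
  exists 1; split=> // M M1 x [x0 x1 x01].
  by apply: (le_trans _ (ltW M1)); apply/norm_rV2_le; rewrite !ger0_norm //; lra.
have cl i : closed [set x : 'rV[R]_2 | 0 <= x 0 i].
  rewrite (_ : [set _ | _] = (fun x : 'rV[R]_2 => x 0 i : R) @^-1` [set r | 0 <= r]) //.
  by apply: (continuous_closedP _).1; [exact: coord_continuous|exact: closed_ge].
have cs : closed [set x : 'rV[R]_2 | x 0 0 + x 0 1 <= 1].
  rewrite (_ : [set _ | _] =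
    (fun x : 'rV[R]_2 => x 0 0 + x 0 1 : R) @^-1` [set r | r <= 1]) //.
  apply: (continuous_closedP _).1; last exact: closed_le.
  move=> x; apply: (@continuousD _ _ _ (fun x : 'rV[R]_2 => x 0 0 : R) (fun x : 'rV[R]_2 => x 0 1 : R)); exact: coord_continuous.
rewrite (_ : T = [set x : 'rV[R]_2 | 0 <= x 0 0] `&`
    ([set x : 'rV[R]_2 | 0 <= x 0 1] `&` [set x : 'rV[R]_2 | x 0 0 + x 0 1 <= 1])).
  by apply: closedI; first exact: cl; apply: closedI; first exact: cl.
by apply/seteqP; split=> x /=; [case|case=> ? []].
Qed.

Lemma triangle_scale (x : 'rV[R]_2) (r : R) :
  T x -> 0 <= r <= 1 -> T (r *: x).
Proof.
move=> [x0 x1 x01] /andP[r0 r1]; split; rewrite !mxE ?mulr_ge0 // -mulrDr.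
by rewrite mulr_ile1 // addr_ge0.
Qed.

(** By compactness f is uniformly continuous in the multiplicative sense. *)
Lemma ratio_right_half_plane (f : 'rV[R]_2 -> R[i]) :
  ccont T f -> (forall x, T x -> f x != 0) ->
  exists n : nat, forall x y, T x -> T y -> `|x - y| <= n.+1%:R^-1 ->
    0 < Re (f y / f x).
Proof.
move=> fc f0.
pose P (n : nat) (x : 'rV[R]_2) := T x -> forall y, T y ->
  `|x - y| <= n.+1%:R^-1 -> 0 < Re (f y / f x).
suff : \forall n \near \oo, T `<=` P n.
  by move=> [n _ /(_ n (leqnn n))] h; exists n => x y Tx Ty; exact: h.
apply: ((compact_near_coveringP T).1 triangle_compact) => x0 Tx0.
pose g y := f y / f x0.
have [gr gi] : ccvg (within T (nbhs x0)) g 1.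
  rewrite -(divff (f0 _ Tx0)); apply: ccvgM; first exact: fc.
  exact: ccvg_cst.
have q0 : 0 < (1 / 4 : R) by lra.
have [e /= e0 he] : exists2 e : R, 0 < e & forall y, ball x0 e y -> T y ->
    `|1 - Re (g y)| < 1 / 4 /\ `|0 - Im (g y)| < 1 / 4.
  have /nbhs_ballP[e e0 he] : nbhs x0 (fun y => T y ->
      `|1 - Re (g y)| < 1 / 4 /\ `|0 - Im (g y)| < 1 / 4).
    have h1 : nbhs x0 (fun y => T y -> `|1 - Re (g y)| < 1 / 4).
      by move/cvgrPdist_lt : gr => /(_ _ q0).
    have h2 : nbhs x0 (fun y => T y -> `|0 - Im (g y)| < 1 / 4).
      by move/cvgrPdist_lt : gi => /(_ _ q0).
    by apply: filterS2 h1 h2 => y a b Ty; split; [exact: a|exact: b].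
  by exists e.
have e20 : 0 < e / 2 by rewrite divr_gt0.
exists (ball x0 (e / 2), [set n : nat | n.+1%:R^-1 < e / 2]); first split => /=.
- exact: nbhsx_ballx.
- exact: (near_infty_natSinv_lt (PosNum e20)).
move=> [x n] /= [bx ne] Tx y Ty xy.
have gx : ball x0 e x by apply: le_ball bx; lra.
have gy : ball x0 e y.
  rewrite (splitr e); apply: ball_triangle bx _.
  by rewrite -ball_normE /ball_ /=; apply: le_lt_trans xy ne.
have [] := he _ gx Tx; have [] := he _ gy Ty; rewrite !ltr_norml.
move=> /andP[a1 a2] /andP[a3 a4] /andP[b1 b2] /andP[b3 b4].
have -> : f y / f x = g y / g x.
  by rewrite /g; have := f0 _ Tx; have := f0 _ Tx0 => ? ?; field; apply/andP.
have gx0 : g x != 0 by rewrite /g mulf_neq0 ?invr_eq0 ?f0.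
rewrite complex_ReM complex_ReV complex_ImV !mulNr mulrN opprK !mulrA -mulrDl.
apply: divr_gt0; last exact: complex_sqr_norm_gt0.
nra.
Qed.

(** Simply connectedness of the triangle: along each segment from the corner
    the function is a telescoping product of quotients that stay in the right
    half plane, where the principal square root is continuous. *)
Lemma triangle_sqrt (f : 'rV[R]_2 -> R[i]) :
  ccont T f -> (forall x, T x -> f x != 0) ->
  exists u, ccont T u /\ forall x, T x -> u x ^+ 2 = f x.
Proof.
move=> fc f0; have [n hn] := ratio_right_half_plane fc f0.
pose s (k : nat) (x : 'rV[R]_2) := f ((k%:R / n.+1%:R) *: x).
have n0 : 0 < n.+1%:R :> R by rewrite ltr0n.
have sT k x : (k <= n.+1)%N -> T x -> T ((k%:R / n.+1%:R : R) *: x).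
  move=> kn Tx; apply: triangle_scale => //.
  by rewrite divr_ge0 ?ler0n //= ler_pdivrMr // mul1r ler_nat.
have s0 k x : (k <= n.+1)%N -> T x -> s k x != 0.
  by move=> kn Tx; apply: f0; exact: sT.
have sc k : (k <= n.+1)%N -> ccont T (s k).
  move=> kn; apply: (@ccont_comp _ _ _ T (fun x : 'rV[R]_2 => (k%:R / n.+1%:R) *: x) _ _ _ _ fc).
    by apply: continuous_subspaceT; exact: scaler_continuous.
  by move=> y Ty; exact: sT.
have spos (k : 'I_n.+1) x : T x -> 0 < Re (s k.+1 x / s k x).
  move=> Tx; apply: hn; try (by apply: sT => //; rewrite ltnW).
  rewrite -scalerBl -mulrBl -[X in `|(_ - X) / _ *: _|]natr1 opprD addNKr.
  rewrite normrZ mulN1r normrN ger0_norm ?invr_ge0 ?(ltW n0) //.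
  rewrite ler_piMr ?invr_ge0 ?(ltW n0) //.
  by case: Tx => x0 x1 x01; apply/norm_rV2_le; rewrite !ger0_norm //; lra.
pose u x := sqrtc (f 0) * \prod_(k < n.+1) psqrt (s k.+1 x / s k x).
exists u; split=> [|x Tx].
  apply: ccontM; first exact: ccont_cst.
  apply: ccont_prod => k; apply: ccont_psqrt; first exact: spos.
  apply: ccontM; first exact: sc.
  apply: ccontV; first by move=> x Tx; apply: s0 => //; rewrite ltnW.
  by apply: sc; rewrite ltnW.
rewrite exprMn sqr_sqrtc -prodrXl.
under eq_bigr do rewrite psqrtK ?spos //.
rewrite -(big_mkord predT (fun k => s k.+1 x / s k x)) telescope_prodf //.
  rewrite /s mul0r scale0r divff ?gt_eqF // scale1r mulrC divfK //.
  by apply: f0; rewrite -(scale0r x); apply: triangle_scale => //; rewrite lexx ler01.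
by move=> k /andP[_ kn]; apply: s0 => //; rewrite ltnW.
Qed.

End Triangle.

(** * Square roots along paths *)

Section Transport.
Context {R : realType}.
Local Notation Re := complex.Re.
Local Notation Im := complex.Im.
Local Notation I01 := (`[0 : R, 1]%classic : set R).
Implicit Types (tau u v : R -> R[i]).

Lemma nonvanishing_pos (a b : R) (v : R -> R) : a <= b ->
  {within `[a, b], continuous v} -> {in `[a, b]%R, forall t, v t != 0} ->
  0 < v a -> 0 < v b.
Proof.
move=> ab vc v0 va; rewrite ltNge; apply/negP => vb.
have [c cab vc0] : exists2 c, c \in `[a, b]%R & v c = 0.
  by apply: IVT => //; rewrite ge_min le_max vb (ltW va) orbT.
by move: (v0 c cab); rewrite vc0 eqxx.
Qed.

Definition sqrt_path tau u : Prop :=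
  ccont I01 u /\ {in `[0, 1]%R, forall t, u t ^+ 2 = tau t}.

Lemma sqrt_path_neq0 tau u : {in `[0, 1]%R, forall t, tau t != 0} ->
  sqrt_path tau u -> {in `[0, 1]%R, forall t, u t != 0}.
Proof.
by move=> t0 [_ uE] t t01; have := t0 t t01; rewrite -uE // expf_eq0.
Qed.

Lemma in01_0 : 0 \in `[0 : R, 1]%R. Proof. by rewrite in_itv /= lexx ler01. Qed.
Lemma in01_1 : 1 \in `[0 : R, 1]%R. Proof. by rewrite in_itv /= lexx ler01. Qed.
Hint Resolve in01_0 in01_1 : core.

(** Two continuous square roots differ by a constant sign, by the
    intermediate value theorem. *)
Lemma sqrt_path_ratio tau u v : {in `[0, 1]%R, forall t, tau t != 0} ->
  sqrt_path tau u -> sqrt_path tau v -> u 1 / u 0 = v 1 / v 0.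
Proof.
move=> t0 su sv.
have u0 := sqrt_path_neq0 t0 su; have v0 := sqrt_path_neq0 t0 sv.
case: su sv => uc uE [vc vE].
have r2 t : t \in `[0, 1]%R -> u t = v t \/ u t = - v t.
  move=> t01; have : u t ^+ 2 == v t ^+ 2 by rewrite uE ?vE.
  by rewrite eqf_sqr => /orP[]/eqP; [left|right].
pose r t := Re (u t / v t).
have rc : {within `[0, 1], continuous r}.
  suff /ccontP[] : ccont I01 (fun t => u t / v t) by [].
  by apply: ccontM => //; apply: ccontV => //; exact: v0.
have r0 : {in `[0, 1]%R, forall t, r t != 0}.
  move=> t t01; rewrite /r; case: (r2 t t01) => ->.
    by rewrite divff ?v0 // oner_eq0.
  by rewrite mulNr divff ?v0 // oppr_eq0 oner_eq0.
have rN0 : {in `[0, 1]%R, forall t, - r t != 0}.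
  by move=> t t01; rewrite oppr_eq0 r0.
have rNc : {within `[0, 1], continuous (fun t => - r t)}.
  by move=> t; apply: cvgN; exact: rc.
have p0 : 0 < r 0 -> 0 < r 1 by exact: nonvanishing_pos.
have n0 : 0 < - r 0 -> 0 < - r 1 by apply: (@nonvanishing_pos _ _ (fun t => - r t)).
have rr t : t \in `[0, 1]%R -> u t = v t \/ u t = - v t -> r t = 1 /\ u t = v t \/ r t = -1 /\ u t = - v t.
  move=> t01 [] uv; [left|right]; split=> //; rewrite /r uv ?mulNr divff ?v0 //.
have [[a ->]|[a ->]] := rr _ in01_0 (r2 _ in01_0); have [[b ->]|[b ->]] := rr _ in01_1 (r2 _ in01_1) => //.
- by exfalso; move: p0; rewrite a b; lra.
- by exfalso; move: n0; rewrite a b; lra.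
- by rewrite invrN mulrNN.
Qed.

(** The quotient of the end values of a continuous square root of the path,
    the same for both square roots; 1 is a junk value. *)
Definition transport tau : R[i] :=
  xget 1 [set z | exists u, sqrt_path tau u /\ z = u 1 / u 0].

Lemma transportE tau u : {in `[0, 1]%R, forall t, tau t != 0} ->
  sqrt_path tau u -> transport tau = u 1 / u 0.
Proof.
move=> t0 su; rewrite /transport; case: xgetP => [z _ [v [sv ->]]|].
  exact: (sqrt_path_ratio t0).
by move=> /(_ (u 1 / u 0)) []; exists u.
Qed.

(** The path extends to the triangle as a function of the first coordinate. *)
Lemma sqrt_path_exists tau : {in `[0, 1]%R, forall t, tau t != 0} ->
  ccont I01 tau -> exists u, sqrt_path tau u.
Proof.
move=> t0 tc; pose f (x : 'rV[R]_2) := tau (x 0 0).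
have T01 x : triangle R x -> `[0, 1]%classic (x 0 0).
  by case=> x0 x1 x01; rewrite /= in_itv /= x0 /=; lra.
have [|x Tx|u [uc uE]] := @triangle_sqrt R f.
- apply: (ccont_comp (p := fun x : 'rV[R]_2 => x 0 0) _ T01 tc).
  by apply: continuous_subspaceT; exact: coord_continuous.
- by apply: t0; exact: T01.
have p01 t : t \in `[0, 1]%R -> triangle R (pt2 t 0).
  by rewrite in_itv /= => /andP[? ?]; split; rewrite !pt2E //; lra.
exists (fun t => u (pt2 t 0)); split=> [|t t01]; last first.
  by rewrite uE ?/f ?pt2E //; exact: p01.
apply: (ccont_comp (p := fun t : R => pt2 t 0) _ p01 uc).
apply: continuous_subspaceT => t.
have -> : (fun t : R => pt2 t 0) = (fun t => t *: pt2 1 0).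
  by apply/funext => s; apply/rowP => i; rewrite !mxE; case: ifP; rewrite ?mulr1 ?mulr0.
by apply: cvgZr_tmp; exact: cvg_id.
Qed.

Lemma transport_ext tau1 tau2 : {in `[0, 1]%R, tau1 =1 tau2} ->
  transport tau1 = transport tau2.
Proof.
move=> e; congr (xget _ _); apply/seteqP; split=> z /= [u [[uc uE] ->]];
  by exists u; split=> //; split=> // t t01; rewrite uE ?e.
Qed.

Lemma transportM tau1 tau2 :
  {in `[0, 1]%R, forall t, tau1 t != 0} -> ccont I01 tau1 ->
  {in `[0, 1]%R, forall t, tau2 t != 0} -> ccont I01 tau2 ->
  transport (fun t => tau1 t * tau2 t) = transport tau1 * transport tau2.
Proof.
move=> n1 c1 n2 c2.
have [u su] := sqrt_path_exists n1 c1; have [v sv] := sqrt_path_exists n2 c2.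
rewrite (transportE n1 su) (transportE n2 sv).
rewrite (@transportE _ (fun t => u t * v t)).
- by rewrite invfM mulrACA.
- by move=> t t01; rewrite mulf_neq0 ?n1 ?n2.
- case: su sv => uc uE [vc vE]; split; first exact: ccontM.
  by move=> t t01; rewrite exprMn uE ?vE.
Qed.

Lemma transport_sqr tau : {in `[0, 1]%R, forall t, tau t != 0} ->
  ccont I01 tau -> transport tau ^+ 2 = tau 1 / tau 0.
Proof.
move=> n c; have [u su] := sqrt_path_exists n c.
rewrite (transportE n su); case: su => _ uE.
by rewrite exprMn exprVn !uE.
Qed.

(** A straight path that misses the negative ray of its starting direction
    has the principal transport: the real part of the normalized square root
    never vanishes along it. *)
Lemma transport_segment (a b : R[i]) : a != 0 -> Im (b / a) != 0 ->
  let r := transport (fun t => a + t%:C%C * (b - a)) in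
  r ^+ 2 = b / a /\ 0 < Re r.
Proof.
move=> a0 ba /=; set tau := fun t => _.
have tauE t : tau t = a * (1 + t%:C%C * (b / a - 1)) by rewrite /tau; field.
have ImE t : Im (1 + t%:C%C * (b / a - 1)) = t * Im (b / a).
  by case: (b / a) => x y; simpc => /=; ring.
have n : {in `[0, 1]%R, forall t, tau t != 0}.
  move=> t _; rewrite tauE mulf_neq0 //; apply/eqP => e.
  have /esym/eqP := ImE t; rewrite e /= mulf_eq0 (negPf ba) orbF => /eqP t0.
  by move/eqP: e; rewrite t0 mul0r addr0 oner_eq0.
have c : ccont I01 tau.
  apply: (@ccont_eq R R I01
    (fun t : R => a * Complex (1 + t * Re (b / a - 1)) (t * Im (b / a - 1))) tau).
    move=> t _; rewrite tauE; congr (_ * _).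
    by case: (b / a) => x y; apply/eqP; rewrite eq_complex /=; apply/andP; split; apply/eqP; ring.
  apply: ccontM; first exact: ccont_cst.
  apply/ccontP; split=> /=; apply: continuous_subspaceT => t.
    by apply: cvgD; [exact: cvg_cst|apply: cvgMl; exact: cvg_id].
  by apply: cvgMl; exact: cvg_id.
have [u su] := sqrt_path_exists n c.
have u0 := sqrt_path_neq0 n su.
split.
  by rewrite transport_sqr // /tau mul1r mul0r addr0 addrC subrK.
rewrite (transportE n su); case: su => uc uE.
apply: (@nonvanishing_pos 0 1 (fun t => Re (u t / u 0))) => //.
- suff /ccontP[] : ccont I01 (fun t => u t / u 0) by [].
  by apply: ccontM => //; exact: ccont_cst.
- move=> t t01; apply/eqP => r0.
  have : (u t / u 0) ^+ 2 = 1 + t%:C%C * (b / a - 1).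
    rewrite exprMn exprVn !uE // !tauE mul0r addr0 mulr1 mulrC mulKf //.
  case: (u t / u 0) r0 => x y /= -> e.
  have := congr1 (@complex.Im R) e; rewrite ImE expr2 /= mul0r mulr0 addr0 => /esym/eqP.
  rewrite mulf_eq0 (negPf ba) orbF => /eqP t0.
  have := congr1 (@complex.Re R) e; rewrite t0 expr2; simpc => /=; nra.
- by rewrite divff ?u0.
Qed.

End Transport.

(** * Monodromy around the triangle *)

Section Monodromy.
Context {R : realType}.
Local Notation Re := complex.Re.
Local Notation Im := complex.Im.
Local Notation T := (triangle R).
Local Notation I01 := (`[0 : R, 1]%classic : set R).
Hint Resolve in01_0 in01_1 : core.

Definition edge (k : 'I_3) (t : R) : 'rV[R]_2 :=
  if k == 0 then pt2 (1 - t) t else if k == 1 then pt2 0 t else pt2 t 0.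

Lemma ord3P (k : 'I_3) : [\/ k = 0, k = 1 | k = ord_max].
Proof.
by case: k => [[|[|[|//]]] hk]; [constructor 1|constructor 2|constructor 3]; exact/val_inj.
Qed.

Lemma edge0 t : edge 0 t = pt2 (1 - t) t. Proof. by []. Qed.
Lemma edge1 t : edge 1 t = pt2 0 t. Proof. by []. Qed.
Lemma edge2 t : edge ord_max t = pt2 t 0. Proof. by []. Qed.
Definition edgeE := (edge0, edge1, edge2).

Lemma edge_triangle k t : t \in `[0, 1]%R -> T (edge k t).
Proof.
rewrite in_itv /= => /andP[t0 t1].
by case: (ord3P k) => ->; rewrite edgeE; split; rewrite !pt2E; lra.
Qed.

Lemma edge_affine k t : edge k t = edge k 0 + t *: (edge k 1 - edge k 0).
Proof.
by case: (ord3P k) => ->; rewrite !edgeE; apply/rowP => i; rewrite !mxE;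
  case: ifP => _; ring.
Qed.

Lemma edge_continuous k : continuous (edge k).
Proof.
rewrite (_ : edge k = fun t => edge k 0 + t *: (edge k 1 - edge k 0)).
  move=> t; apply: cvgD; first exact: cvg_cst.
  by apply: cvgZr_tmp; exact: cvg_id.
by apply/funext => t; exact: edge_affine.
Qed.

Lemma ccont_edge (f : 'rV[R]_2 -> R[i]) k : ccont T f -> ccont I01 (f \o edge k).
Proof.
apply: ccont_comp; last exact: edge_triangle.
by apply: continuous_subspaceT; exact: edge_continuous.
Qed.

(** The product of the transports along the edges, corrected by the values at
    two vertices, is the sign by which a square root changes around the
    triangle: each path contributes the quotient of its end values, and the
    correction accounts for the direction of the second edge. *)
Definition monodromy (f : 'rV[R]_2 -> R[i]) : R[i] :=
  transport (f \o edge 0) * transport (f \o edge 1) *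
  transport (f \o edge ord_max) * (f (pt2 0 0) / f (pt2 0 1)).

Definition boundary_neq0 (f : 'rV[R]_2 -> R[i]) : Prop :=
  forall k t, t \in `[0, 1]%R -> f (edge k t) != 0.

(** Each transport is a quotient of values of a square root on the whole
    triangle, and these quotients telescope. *)
Lemma monodromy1 (f : 'rV[R]_2 -> R[i]) :
  ccont T f -> (forall x, T x -> f x != 0) -> monodromy f = 1.
Proof.
move=> fc f0; have [u [uc uE]] := triangle_sqrt fc f0.
have u0 x : T x -> u x != 0.
  by move=> Tx; have := f0 x Tx; rewrite -uE // expf_eq0.
have trE k : transport (f \o edge k) = u (edge k 1) / u (edge k 0).
  rewrite (@transportE _ _ (u \o edge k)) //.
    by move=> t t01; apply: f0; exact: edge_triangle.
  split; first exact: ccont_edge.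
  by move=> t t01; rewrite /= uE //; exact: edge_triangle.
have v0 : u (pt2 0 0) != 0.
  by apply: u0; rewrite -(edge1 0); exact: (edge_triangle _ in01_0).
have v1 : u (pt2 1 0) != 0.
  by apply: u0; rewrite -(edge2 1); exact: (edge_triangle _ in01_1).
have v2 : u (pt2 0 1) != 0.
  by apply: u0; rewrite -(edge1 1); exact: (edge_triangle _ in01_1).
rewrite /monodromy !trE !edgeE subrr subr0 -!uE.
- by field; apply/and3P.
- by rewrite -(edge1 1); exact: (edge_triangle _ in01_1).
- by rewrite -(edge1 0); exact: (edge_triangle _ in01_0).
Qed.

Lemma monodromyM (f g : 'rV[R]_2 -> R[i]) :
  ccont T f -> ccont T g -> boundary_neq0 f -> boundary_neq0 g ->
  monodromy (fun x => f x * g x) = monodromy f * monodromy g.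
Proof.
move=> fc gc f0 g0.
have trM k : transport ((fun x => f x * g x) \o edge k) =
    transport (f \o edge k) * transport (g \o edge k).
  apply: transportM; try exact: ccont_edge.
    by move=> t; exact: f0.
  by move=> t; exact: g0.
by rewrite /monodromy !trM invfM; ring.
Qed.

Lemma monodromy_ext (f g : 'rV[R]_2 -> R[i]) :
  (forall x, T x -> f x = g x) -> monodromy f = monodromy g.
Proof.
move=> fg; rewrite /monodromy -!fg.
- congr (_ * _ * _ * _); apply: transport_ext => t t01; apply: fg;
  exact: edge_triangle.
- by rewrite -(edge1 1); exact: (edge_triangle _ in01_1).
- by rewrite -(edge1 0); exact: (edge_triangle _ in01_0).
Qed.

Definition lin (a b : R[i]) (p x : 'rV[R]_2) : R[i] :=
  a * (x 0 0 - p 0 0)%:C%C + b * (x 0 1 - p 0 1)%:C%C.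

(** The determinant of the real linear map x |-> a x_0 + b x_1. *)
Definition cross (a b : R[i]) : R := Re a * Im b - Im a * Re b.

Lemma linZ c a b p x : lin (c * a) (c * b) p x = c * lin a b p x.
Proof. by rewrite /lin mulrDr !mulrA. Qed.

Lemma lin_neq0 a b p x : cross a b != 0 -> x != p -> lin a b p x != 0.
Proof.
move=> ab; apply: contra_neq => l0; rewrite -[x]pt2_eta -[RHS]pt2_eta.
have := congr1 (@complex.Re R) l0; have := congr1 (@complex.Im R) l0.
rewrite /lin; case: a b ab {l0} => [a1 a2] [b1 b2]; rewrite /cross; simpc => /= ab.
set u := x 0 0 - _; set v := x 0 1 - _ => e1 e2.
have u0 : u = 0.
  apply: (mulfI ab); rewrite mulr0.
  have -> : (a1 * b2 - a2 * b1) * u = b2 * (a1 * u + b1 * v) - b1 * (a2 * u + b2 * v) by ring.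
  by rewrite e1 e2 !mulr0 subrr.
have v0 : v = 0.
  apply: (mulfI ab); rewrite mulr0.
  have -> : (a1 * b2 - a2 * b1) * v = a1 * (a2 * u + b2 * v) - a2 * (a1 * u + b1 * v) by ring.
  by rewrite e1 e2 !mulr0 subrr.
by congr pt2; apply/eqP; rewrite -subr_eq0 ?[_ - _]u0 ?[_ - _]v0.
Qed.

Lemma lin_continuous a b p x : ccvg (nbhs x) (lin a b p) (lin a b p x).
Proof.
have co i (c : R) : c * (y 0 i - p 0 i) @[y --> x] --> c * (x 0 i - p 0 i).
  apply: cvgMr; apply: cvgB; last exact: cvg_cst.
  exact: coord_continuous.
case: a b => [a1 a2] [b1 b2]; rewrite /lin; split.
  under eq_fun do simpc => /=.
  by simpc => /=; apply: cvgD; exact: co.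
under eq_fun do simpc => /=.
by simpc => /=; apply: cvgD; exact: co.
Qed.

(** The interior of the triangle, in coordinates. *)
Definition inside (p : 'rV[R]_2) : Prop :=
  [/\ 0 < p 0 0, 0 < p 0 1 & p 0 0 + p 0 1 < 1].

Lemma edge_inside k t p : t \in `[0, 1]%R -> inside p -> edge k t != p.
Proof.
move=> _ [p0 p1 p01]; apply/eqP => e; move: p0 p1 p01; rewrite -e.
by case: (ord3P k) => ->; rewrite edgeE !pt2E; lra.
Qed.

Lemma Im_div_cross (a b : R[i]) : Im (b / a) = cross a b / (Re a ^+ 2 + Im a ^+ 2).
Proof. by rewrite complex_ImM complex_ReV complex_ImV /cross; ring. Qed.

Lemma sqr_sign_Im (r z : R[i]) : 0 < Re r -> r ^+ 2 = z ->
  (0 < Im z -> 0 < Im r) /\ (Im z < 0 -> Im r < 0).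
Proof.
case: r => x y /= x0 <-; rewrite expr2 /=; split=> h.
  by rewrite -(pmulr_rgt0 _ x0); nra.
by rewrite -(pmulr_rlt0 _ x0); nra.
Qed.

(** Around a zero of a linear isomorphism the square root changes sign.  The
    principal transports of the three edges have positive real parts, and the
    signs of their imaginary parts are given by the orientation of the image
    triangle around the origin. *)
Lemma monodromy_lin a b p : cross a b != 0 -> inside p ->
  monodromy (lin a b p) = -1.
Proof.
move=> ab pin; set h := lin a b p.
have h0 k t : t \in `[0, 1]%R -> h (edge k t) != 0.
  by move=> t01; apply: lin_neq0 => //; exact: edge_inside.
have crossE x y : cross (h x) (h y) = cross a b *
   ((x 0 0 - p 0 0) * (y 0 1 - p 0 1) - (x 0 1 - p 0 1) * (y 0 0 - p 0 0)).
  by rewrite /cross /h /lin; case: (a) (b) => [a1 a2] [b1 b2]; simpc => /=; ring.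
have segE k : transport (h \o edge k) =
    transport (fun t => h (edge k 0) + t%:C%C * (h (edge k 1) - h (edge k 0))).
  apply: transport_ext => t _; rewrite /h /lin /= edge_affine.
  case: (a) (b) => [a1 a2] [b1 b2]; rewrite !mxE; simpc.
  by apply/eqP; rewrite eq_complex /=; apply/andP; split; apply/eqP; ring.
have sg k : let r := transport (h \o edge k) in
    cross (h (edge k 0)) (h (edge k 1)) != 0 ->
    [/\ r ^+ 2 = h (edge k 1) / h (edge k 0), 0 < Re r,
      0 < cross (h (edge k 0)) (h (edge k 1)) -> 0 < Im r &
      cross (h (edge k 0)) (h (edge k 1)) < 0 -> Im r < 0].
  move=> r c0; have n0 := complex_sqr_norm_gt0 (h0 k _ in01_0).
  have : Im (h (edge k 1) / h (edge k 0)) != 0.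
    by rewrite Im_div_cross mulf_neq0 // invr_neq0 // gt_eqF.
  move=> /(transport_segment (h0 k _ in01_0)); rewrite -segE => -[r2 rpos].
  have [s1 s2] := sqr_sign_Im rpos r2; split=> // c.
    by apply: s1; rewrite Im_div_cross divr_gt0.
  by apply: s2; rewrite Im_div_cross ltr_pdivrMr // mul0r.
have := sg 0; have := sg 1; have := sg ord_max.
rewrite /monodromy !crossE !edgeE !pt2E !subr0 !subrr.
set r2 := transport _; set r1 := transport _; set r0 := transport _.
case: pin => p0 p1 p01.
have d2 : (0 - p 0 0) * (0 - p 0 1) - (0 - p 0 1) * (1 - p 0 0) = p 0 1 by ring.
have d1 : (0 - p 0 0) * (1 - p 0 1) - (0 - p 0 1) * (0 - p 0 0) = - p 0 0 by ring.
have d0 : (1 - p 0 0) * (1 - p 0 1) - (0 - p 0 1) * (0 - p 0 0) = 1 - p 0 0 - p 0 1 by ring.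
rewrite d0 d1 d2 {d0 d1 d2 crossE segE sg}.
have v0 : h (pt2 0 0) != 0 by rewrite -(edge1 0); exact: (h0 _ _ in01_0).
have v1 : h (pt2 1 0) != 0 by rewrite -(edge2 1); exact: (h0 _ _ in01_1).
have v2 : h (pt2 0 1) != 0 by rewrite -(edge1 1); exact: (h0 _ _ in01_1).
case; first by rewrite mulf_neq0 // gt_eqF.
move=> e2 R2 I2p I2n; case; first by rewrite mulf_neq0 // oppr_eq0 gt_eqF.
move=> e1 R1 I1p I1n; case; first by rewrite mulf_neq0 // gt_eqF; lra.
move=> e0 R0 I0p I0n.
have r1n : r1 != 0.
  by apply/eqP => r10; move: R1; rewrite r10 ltxx.
rewrite -[h (pt2 0 0) / _]invf_div -e1 expr2 invfM mulrA.
have -> : r0 * r1 * r2 / r1 / r1 = r0 * r2 / r1 by field.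
have : (r0 * r2) ^+ 2 = r1 ^+ 2.
  by rewrite exprMn e0 e1 e2; field; apply/andP.
move/eqP; rewrite eqf_sqr => /orP[]/eqP e; last by rewrite e mulNr divff.
exfalso; have := congr1 (@complex.Im R) e; rewrite complex_ImM.
move: (cross a b) ab I0p I0n I1p I1n I2p I2n => c.
rewrite neq_lt => /orP[] c0 I0p I0n I1p I1n I2p I2n.
  have j0 : Im r0 < 0 by apply: I0n; rewrite pmulr_llt0 //; lra.
  have j1 : 0 < Im r1 by apply: I1p; rewrite nmulr_rgt0 // oppr_lt0.
  have j2 : Im r2 < 0 by apply: I2n; rewrite pmulr_llt0.
  by move=> ej; nra.
have j0 : 0 < Im r0 by apply: I0p; rewrite pmulr_lgt0 //; lra.
have j1 : Im r1 < 0 by apply: I1n; rewrite pmulr_rlt0 // oppr_lt0.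
have j2 : 0 < Im r2 by apply: I2p; rewrite pmulr_lgt0.
by move=> ej; nra.
Qed.

End Monodromy.

(** * Counting simple zeros *)

Section Zeros.
Context {R : realType}.
Local Notation Re := complex.Re.
Local Notation Im := complex.Im.
Local Notation T := (triangle R).

(** The real linear map of which f is the first order approximation at p is
    invertible.  The quotient f / lin extends to p with the value 1, which is
    all that the removal of the zero requires. *)
Definition simple_zero (f : 'rV[R]_2 -> R[i]) (p : 'rV[R]_2) : Prop :=
  inside p /\ exists a b, cross a b != 0 /\
    ccvg p^' (fun x => f x / lin a b p x) 1.

Lemma nbhs_neq (x p : 'rV[R]_2) : x != p -> nbhs x [set y | y != p].
Proof.
move=> xp; have o : open (~` [set p]).
  apply: closed_openC; apply: accessible_closed_set1.
  by apply: hausdorff_accessible; exact: norm_hausdorff.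
have : nbhs x (~` [set p]) by apply: open_nbhs_nbhs; split=> //; exact/eqP.
by apply: filterS => y /eqP.
Qed.

Lemma inside_triangle (p : 'rV[R]_2) : inside p -> T p.
Proof. by case=> *; split; lra. Qed.

Lemma cross_div (a b c : R[i]) : c != 0 ->
  cross (a / c) (b / c) = cross a b / (Re c ^+ 2 + Im c ^+ 2).
Proof.
move=> c0; have := complex_sqr_norm_gt0 c0.
rewrite /cross !complex_ReM !complex_ImM !complex_ReV !complex_ImV => n0.
by field; rewrite gt_eqF.
Qed.

(** Dividing f by its linear approximation at a zero removes this zero and
    changes the monodromy by the factor -1. *)
Lemma monodromy_zeros (f : 'rV[R]_2 -> R[i]) (Z : seq 'rV[R]_2) : uniq Z ->
  ccont T f -> (forall x, T x -> (f x == 0) = (x \in Z)) ->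
  (forall p, p \in Z -> simple_zero f p) ->
  monodromy f = (-1) ^+ size Z.
Proof.
elim: Z f => [|p Z IH] f.
  move=> _ fc f0 _; rewrite monodromy1 // => x Tx.
  by rewrite f0 // in_nil.
move=> /andP[pZ uZ] fc f0 fZ.
have [pin [a [b [ab fp]]]] := fZ p (mem_head _ _).
pose l := lin a b p.
have lp : l p = 0 by rewrite /l /lin !subrr !mulr0 addr0.
have l0 x : x != p -> l x != 0 by exact: lin_neq0.
pose g x := if x == p then 1 else f x / l x.
have fE x : T x -> g x * l x = f x.
  move=> Tx; rewrite /g; have [->|xp] := eqVneq x p.
    apply/esym/eqP; rewrite lp mulr0 f0 ?mem_head //.
    exact: inside_triangle.
  by rewrite divfK // l0.
have gc : ccont T g.
  move=> x Tx; have [xp|xp] := eqVneq x p.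
    rewrite xp; apply: ccont_cvg.
    have -> : g p = 1 by rewrite /g eqxx.
    have gp : ccvg p^' g 1.
      apply: ccvg_near_eq fp; rewrite near_withinE.
      by apply: nearW => y yp; rewrite /g (negPf yp).
    case: gp => gr gi; split=> Q Qn.
      have h : nbhs p (fun y => y != p -> Q (Re (g y))) by exact: (gr _ Qn).
      suff : nbhs p (fun y => Q (Re (g y))) by [].
      apply: filterS h => y h; have [->|/h //] := eqVneq y p.
      by rewrite /g eqxx; exact: nbhs_singleton.
    have h : nbhs p (fun y => y != p -> Q (Im (g y))) by exact: (gi _ Qn).
    suff : nbhs p (fun y => Q (Im (g y))) by [].
    apply: filterS h => y h; have [->|/h //] := eqVneq y p.
    by rewrite /g eqxx; exact: nbhs_singleton.
  have : ccvg (within T (nbhs x)) (fun y => f y / l y) (g x).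
    rewrite /g (negPf xp); apply: ccvgM; first exact: fc.
    by apply: ccvgV; [exact: l0|apply: ccont_cvg; exact: lin_continuous].
  apply: ccvg_near_eq; rewrite near_withinE.
  have : nbhs x [set y | y != p] by exact: nbhs_neq.
  by apply: filterS => y /= yp _; rewrite /g (negPf yp).
have gZ x : T x -> (g x == 0) = (x \in Z).
  move=> Tx; rewrite /g; have [->|xp] := eqVneq x p.
    by rewrite oner_eq0 (negPf pZ).
  by rewrite mulf_eq0 invr_eq0 (negPf (l0 _ xp)) orbF f0 // in_cons (negPf xp).
have gs q : q \in Z -> simple_zero g q.
  move=> qZ; have [|qin [a' [b' [ab' fq]]]] := fZ q; first by rewrite in_cons qZ orbT.
  have qp : q != p by apply: contraNneq pZ => <-.
  split=> //; exists (a' / l q), (b' / l q); split.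
    rewrite cross_div ?l0 // mulf_neq0 // invr_neq0 // gt_eqF //.
    by apply: complex_sqr_norm_gt0; exact: l0.
  have : ccvg q^' (fun x => f x / lin a' b' q x * ((l x)^-1 * l q)) (1 * ((l q)^-1 * l q)).
    apply: ccvgM => //; apply: ccvgM; last exact: ccvg_cst.
    apply: ccvgV; first exact: l0.
    have [lr li] := lin_continuous a b p q.
    by split; [move: lr|move: li]; apply: cvg_trans; apply: cvg_app; exact: cvg_within.
  rewrite mul1r mulVf ?l0 //; apply: ccvg_near_eq.
  have : nbhs q [set y | y != p] by exact: nbhs_neq.
  rewrite near_withinE; apply: filterS => y /= yp yq.
  rewrite /g (negPf yp) ![_ / l q]mulrC linZ.
  have := lin_neq0 ab' yq; have := l0 _ yp; have := l0 _ qp.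
  by move=> ? ? ?; field; apply/and3P.
rewrite -(monodromy_ext fE) monodromyM //.
- by rewrite (IH g) // monodromy_lin // mulrC exprS.
- by move=> x Tx; apply: ccont_cvg; exact: lin_continuous.
- move=> k t t01; apply: contraTneq isT => gk0.
  have Te := edge_triangle k t01.
  have : edge k t \in Z by rewrite -gZ // gk0.
  by move=> /gs[ein _]; have := edge_inside k t01 ein; rewrite eqxx.
- by move=> k t t01; apply: l0; exact: edge_inside.
Unshelve. all: by end_near.
Qed.

End Zeros.

(** * Closed curves that meet each ray once *)

Section Arcs.
Context {R : realType}.
Local Notation Re := complex.Re.
Local Notation Im := complex.Im.
Local Notation I01 := (`[0 : R, 1]%classic : set R).

Lemma sqr_imaginary (z : R[i]) : Re z = 0 -> z ^+ 2 = (- (Im z) ^+ 2)%:C%C.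
Proof.
by case: z => x y /= ->; apply/eqP; rewrite expr2 eq_complex /=; apply/andP; split; apply/eqP; ring.
Qed.

Lemma complex_ReN (z : R[i]) : Re (- z) = - Re z.
Proof. by case: z. Qed.

(** The branch of the square root that is cut along the ray through - b ^ 2. *)
Definition sqrt_section (b z : R[i]) : R[i] :=
  if 0 <= Re (sqrtc z / b) then sqrtc z else - sqrtc z.

Lemma sqrt_section_sqr b z : sqrt_section b z ^+ 2 = z.
Proof. by rewrite /sqrt_section; case: ifP; rewrite ?sqrrN sqr_sqrtc. Qed.

Lemma sqrt_section_pos b v : 0 < Re (v / b) -> sqrt_section b (v ^+ 2) = v.
Proof.
move=> v0; have : sqrtc (v ^+ 2) ^+ 2 == v ^+ 2 by rewrite sqr_sqrtc.
rewrite /sqrt_section eqf_sqr => /orP[]/eqP ->; first by rewrite ltW.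
by rewrite mulNr complex_ReN oppr_ge0 leNgt v0 /= opprK.
Qed.

Lemma sqrt_section_neg b v : Re (v / b) < 0 -> sqrt_section b (v ^+ 2) = - v.
Proof.
move=> v0; rewrite -sqrrN; apply: sqrt_section_pos.
by rewrite mulNr complex_ReN oppr_gt0.
Qed.

(** A path whose square crosses the negative ray once, in its interior, and
    never meets the same ray twice, goes from one half plane to the other.
    Otherwise a ray slightly off the imaginary axis would be met once before
    and once after the crossing. *)
Lemma half_plane_crossing (V : R -> R[i]) : ccont I01 V ->
  {in `[0, 1]%R, forall t, V t != 0} -> Re (V (1 / 2)) = 0 ->
  (forall s t r, s \in `]0, 1[%R -> t \in `]0, 1[%R -> V s = r%:C%C * V t -> s = t) ->
  0 < Re (V 0) -> 0 < Re (V 1) -> False.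
Proof.
move=> /ccontP[rc ic] V0 r12 inj p0 p1.
have y0 : Im (V (1 / 2)) != 0.
  have : V (1 / 2) != 0 by apply: V0; rewrite in_itv /=; lra.
  by rewrite eq_complex /= r12 eqxx.
set y := Im (V (1 / 2)) in y0.
pose M := `|y * Im (V 0)| + `|y * Im (V 1)| + 1.
have M0 : 0 < M by rewrite ltr_wpDl // addr_ge0.
(* v is so small that the real part dominates in D at both end points *)
pose v := Num.min (Re (V 0)) (Re (V 1)) / M.
have v0 : 0 < v by rewrite divr_gt0 // lt_min p0 p1.
pose D t := Re (V t) - v * (y * Im (V t)).
have Dc : {within `[0, 1], continuous D}.
  move=> t; apply: cvgB; first exact: rc.
  by apply: cvgMr; apply: cvgMr; exact: ic.
have vM : v * M = Num.min (Re (V 0)) (Re (V 1)) by rewrite divfK // gt_eqF.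
have D0 : 0 < D 0.
  have h : v * M <= Re (V 0) by rewrite vM ge_min lexx.
  rewrite subr_gt0; apply: lt_le_trans h; rewrite ltr_pM2l //.
  apply: (le_lt_trans (ler_norm _)); rewrite /M -addrA ltrDl.
  by rewrite ltr_wpDl.
have D1 : 0 < D 1.
  have h : v * M <= Re (V 1) by rewrite vM ge_min lexx orbT.
  rewrite subr_gt0; apply: lt_le_trans h; rewrite ltr_pM2l //.
  apply: (le_lt_trans (ler_norm _)); rewrite /M [X in X + 1]addrC -addrA ltrDl.
  by rewrite ltr_wpDl.
have D12 : D (1 / 2) < 0.
  rewrite /D r12 sub0r oppr_lt0 mulr_gt0 // -expr2.
  by rewrite lt_neqAle sqr_ge0 eq_sym sqrf_eq0 y0.
have [s s12 Ds] : exists2 s, s \in `[0, 1 / 2]%R & D s = 0.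
  apply: IVT; first by lra.
    by apply: continuous_subspaceW Dc => t /=; rewrite !in_itv /=; lra.
  by rewrite ge_min le_max (ltW D12) (ltW D0) orbT.
have [t t12 Dt] : exists2 t, t \in `[1 / 2, 1]%R & D t = 0.
  apply: IVT; first by lra.
    by apply: continuous_subspaceW Dc => t /=; rewrite !in_itv /=; lra.
  by rewrite ge_min le_max (ltW D12) (ltW D1) orbT.
have neq (u u' : R) : D u' != 0 -> D u = 0 -> u != u'.
  by move=> u'0 u0; apply: contraNneq u'0 => <-; rewrite u0.
have s0 : s != 0 by apply: neq => //; rewrite gt_eqF.
have sh : s != 1 / 2 by apply: neq => //; rewrite lt_eqF.
have t1 : t != 1 by apply: neq => //; rewrite gt_eqF.
have th : t != 1 / 2 by apply: neq => //; rewrite lt_eqF.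
move: s12 t12; rewrite !in_itv /= => /andP[s1 s2] /andP[t2 t3].
have s1' : 0 < s by rewrite lt_neqAle eq_sym s0.
have s2' : s < 1 / 2 by rewrite lt_neqAle sh.
have t2' : 1 / 2 < t by rewrite lt_neqAle eq_sym th.
have t3' : t < 1 by rewrite lt_neqAle t1.
have it : Im (V t) != 0.
  have : V t != 0 by apply: V0; rewrite in_itv /=; lra.
  apply: contraNneq => i0; move: Dt; rewrite /D i0 !mulr0 subr0 => r0.
  by rewrite eq_complex /= r0 i0 !eqxx.
have st : s = t.
  apply: (inj s t (Im (V s) / Im (V t))).
  - by rewrite in_itv /=; lra.
  - by rewrite in_itv /=; lra.
  have rs : Re (V s) = v * (y * Im (V s)) by apply/eqP; rewrite -subr_eq0; apply/eqP.
  have rt : Re (V t) = v * (y * Im (V t)) by apply/eqP; rewrite -subr_eq0; apply/eqP.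
  case: (V s) (V t) rs rt it => [a b] [c d] /= -> -> d0; simpc.
  by apply/eqP; rewrite eq_complex /=; apply/andP; split; apply/eqP; field.
by move: s2' t2'; rewrite st; lra.
Qed.

(** Arcs that together meet each ray from the origin at most once, except at
    end points, have total sign -1 for a square root that is cut along a ray
    through an interior point of one arc. *)
Lemma arcs_transport m (w : 'I_m -> R -> R[i]) : (0 < m)%N ->
  (forall i, ccont I01 (w i)) ->
  (forall i, {in `[0, 1]%R, forall t, w i t != 0}) ->
  (forall i j s t r, s \in `[0, 1]%R -> t \in `[0, 1]%R -> 0 < r ->
     w i s = r%:C%C * w j t ->
     (i = j /\ s = t) \/ ((s = 0 \/ s = 1) /\ (t = 0 \/ t = 1))) ->
  exists b, \prod_i (transport (w i) *
    (sqrt_section b (w i 0) / sqrt_section b (w i 1))) = -1.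
Proof.
case: m w => // m w _ wc w0 wray.
have h01 : 1 / 2 \in `[0 : R, 1]%R by rewrite in_itv /=; lra.
have h0 : 0 <> 1 / 2 :> R by lra.
have h1 : 1 <> 1 / 2 :> R by lra.
pose P := w ord0 (1 / 2); have P0 : P != 0 by exact: w0.
pose b := sqrtc (- P); have bb : b ^+ 2 = - P by rewrite sqr_sqrtc.
have b0 : b != 0 by rewrite sqrtc_eq0 oppr_eq0.
exists b.
have P_ray i t : t \in `[0, 1]%R -> forall v, v ^+ 2 = w i t ->
    Re (v / b) = 0 -> i = ord0 /\ t = 1 / 2.
  move=> t01 v vE /sqr_imaginary; rewrite exprMn exprVn vE bb => e.
  have wE : w i t = ((Im (v / b)) ^+ 2)%:C%C * P.
    apply: (mulIf (x := (- P)^-1)); first by rewrite invr_eq0 oppr_eq0.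
    by rewrite e invrN mulrN mulfK // raddfN.
  have y0 : 0 < Im (v / b) ^+ 2.
    rewrite lt_neqAle sqr_ge0 andbT eq_sym; apply: contraTneq isT => y0.
    by have := w0 i t t01; rewrite wE y0 mul0r eqxx.
  by case: (wray _ _ _ _ _ t01 h01 y0 wE) => // -[_ [] /esym].
have ends i u : sqrt_path (w i) u -> Re (u 0 / b) != 0 /\ Re (u 1 / b) != 0.
  move=> [_ uE]; split; apply/eqP => r0.
    by have [_] := P_ray i 0 in01_0 _ (uE _ in01_0) r0; exact: h0.
  by have [_] := P_ray i 1 in01_1 _ (uE _ in01_1) r0; exact: h1.
(* each factor is the sign that compares the half planes of both ends *)
have sec i u : sqrt_path (w i) u ->
    transport (w i) * (sqrt_section b (w i 0) / sqrt_section b (w i 1)) =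
    if (0 < Re (u 0 / b)) == (0 < Re (u 1 / b)) then 1 else -1.
  move=> su; have [e0 e1] := ends _ _ su; rewrite (transportE (w0 i) su).
  have un := sqrt_path_neq0 (w0 i) su.
  have := un _ (in01_0); have := un _ (in01_1) => u1n u0n.
  case: su => _ uE; rewrite -!uE ?in01_0 ?in01_1 //.
  have [p0|n0|] := ltgtP 0 (Re (u 0 / b)); last by move=> z; rewrite -z eqxx in e0.
  - have [p1|n1|] := ltgtP 0 (Re (u 1 / b)); last by move=> z; rewrite -z eqxx in e1.
    + by rewrite !sqrt_section_pos //=; field; apply/andP.
    + by rewrite sqrt_section_pos // sqrt_section_neg //=; field; apply/andP.
  - have [p1|n1|] := ltgtP 0 (Re (u 1 / b)); last by move=> z; rewrite -z eqxx in e1.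
    + by rewrite sqrt_section_neg // sqrt_section_pos //=; field; apply/andP.
    + by rewrite !sqrt_section_neg //=; field; apply/andP.
have Vc i u (k : R[i]) : sqrt_path (w i) u -> ccont I01 (fun t => k * (u t / b)).
  by case=> uc _; apply: ccontM; [exact: ccont_cst|apply: ccontM => //; exact: ccont_cst].
rewrite big_ord_recl big1 ?mulr1 => [|i _].
  have [u su] := sqrt_path_exists (w0 ord0) (@wc ord0).
  rewrite (sec _ _ su); have [e0 e1] := ends _ _ su.
  have un := sqrt_path_neq0 (w0 ord0) su.
  have no (k : R[i]) : k ^+ 2 = 1 -> 0 < Re (k * (u 0 / b)) -> 0 < Re (k * (u 1 / b)) -> False.
    move=> k2; have k0 : k != 0 by apply: contraTneq isT => k0; have /eqP := k2; rewrite k0 expr0n /= eq_sym oner_eq0.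
    have uE := su.2.
    apply: (@half_plane_crossing (fun t => k * (u t / b))); first exact: Vc su.
    - by move=> t t01; rewrite !mulf_neq0 ?invr_eq0 // un.
    - have e : Im (u (1 / 2) / b) ^+ 2 = 1 /\ Re (u (1 / 2) / b) = 0.
        have : (u (1 / 2) / b) ^+ 2 = -1.
          by rewrite exprMn exprVn uE // bb invrN mulrN divff.
        case: (u (1 / 2) / b) => x y; rewrite expr2; simpc => /= -[e1' e2'].
        have xy : x * y = 0 by lra.
        have x0 : x = 0.
          move/eqP: xy; rewrite mulf_eq0 => /orP[/eqP //|/eqP y0].
          by move: e1'; rewrite y0; nra.
        by split=> //; move: e1'; rewrite x0 expr2; lra.
      have : (k == 1) || (k == -1) by rewrite -eqf_sqr k2 expr1n.
      case/orP=> /eqP ->; first by rewrite mul1r e.2.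
      by rewrite mulN1r complex_ReN e.2 oppr0.
    - move=> s t r; rewrite !in_itv /= => /andP[s0 s1] /andP[t0 t1] e.
      have s01 : s \in `[0, 1]%R by rewrite in_itv /=; lra.
      have t01 : t \in `[0, 1]%R by rewrite in_itv /=; lra.
      have us : u s = r%:C%C * u t.
        apply: (mulfI k0); apply: (mulIf (x := b^-1)); first by rewrite invr_eq0.
        by rewrite -mulrA e; ring.
      have r0 : 0 < r ^+ 2.
        rewrite lt_neqAle sqr_ge0 andbT eq_sym sqrf_eq0; apply: contraTneq isT => r0.
        by have := un _ s01; rewrite us r0 mul0r eqxx.
      case: (wray ord0 ord0 s t (r ^+ 2)) => //.
      + by rewrite -!uE // us exprMn -rmorphXn.
      + by case.
      + by case=> -[] ? _; lra.
  case: ifP => // /eqP e; exfalso.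
  have [p0|n0|] := ltgtP 0 (Re (u 0 / b)); last by move=> z; rewrite -z eqxx in e0.
    apply: (no 1); rewrite ?expr1n ?mul1r //.
    by rewrite -e.
  apply: (no (-1)); rewrite ?sqrrN ?expr1n ?mulN1r ?complex_ReN ?oppr_gt0 //.
  by rewrite lt_neqAle e1 leNgt -e -leNgt ltW.
have [u su] := sqrt_path_exists (w0 (lift ord0 i)) (@wc (lift ord0 i)).
rewrite (sec _ _ su); case: ifP => // /negP[]; apply/eqP.
have uE := su.2.
have n0 : {in `[0, 1]%R, forall t, Re (u t / b) != 0}.
  by move=> t t01; apply/eqP => r0; have [] := P_ray _ _ t01 _ (uE _ t01) r0.
have /ccontP[rc _] : ccont I01 (fun t => u t / b).
  by case: su => uc _; apply: ccontM => //; exact: ccont_cst.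
have rNc : {within `[0, 1], continuous (fun t => - Re (u t / b))}.
  by move=> t; apply: cvgN; exact: rc.
have [e0 e1] := ends _ _ su.
apply/idP/idP.
  exact: (@nonvanishing_pos _ 0 1 (fun t => Re (u t / b)) ler01 rc n0).
apply: contraLR; rewrite -!leNgt => r0.
have : 0 < - Re (u 1 / b).
  apply: (@nonvanishing_pos _ 0 1 (fun t => - Re (u t / b))) => //.
    by move=> t t01; rewrite oppr_eq0 n0.
  by rewrite oppr_gt0 lt_neqAle e0.
by rewrite oppr_gt0 => /ltW.
Qed.

End Arcs.

(** * Parity of the intersection number *)

Section Parity.
Context {R : realType}.
Local Notation I01 := (`[0 : R, 1]%classic : set R).

Lemma even_count_prod (K : eqType) (F : comNzRingType) (s : seq K) (H : K -> F) :
  {in s, forall k, H k ^+ 2 = 1} -> {in s, forall k, ~~ odd (count_mem k s)} ->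
  \prod_(k <- s) H k = 1.
Proof.
move=> H2 ev; rewrite -(@big_undup_iterop_count _ _ _ _ s) big_seq big1 // => k.
rewrite mem_undup => ks; rewrite -[iterop _ _ _ _]/(H k ^+ count_mem k s).
by rewrite -(odd_double_half (count_mem k s)) (negPf (ev k ks)) add0n -mul2n exprM H2 // expr1n.
Qed.

(** Modulo 2 the faces of a chain whose multiplicity is even cancel in any
    product of signs attached to paths. *)
Lemma boundary_prod n (c : chain2 R n) m (a : 'I_m -> R -> 'rV[R]_3)
    (F : fieldType) (H : (R -> 'rV[R]_3) -> F) :
  (forall f g, {in `[0, 1]%R, f =1 g} -> H f = H g) ->
  (forall i k, H (face (c i) k) ^+ 2 = 1) -> (forall i, H (a i) ^+ 2 = 1) ->
  (forall i j, {in `[0, 1]%R, a i =1 a j} -> i = j) ->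
  (forall tau, odd (boundary_coef c tau) <->
     exists i, {in `[0, 1]%R, a i =1 tau}) ->
  \prod_i \prod_k H (face (c i) k) = \prod_i H (a i).
Proof.
move=> Hext Hc Ha ainj codd.
(* only the values on the unit interval identify a path *)
pose tr (f : R -> 'rV[R]_3) : R -> 'rV[R]_3 :=
  fun t => if t \in `[0, 1]%R then f t else 0.
have trE f : {in `[0, 1]%R, tr f =1 f} by move=> t t01; rewrite /tr t01.
have treq f g : (tr f == tr g) = `[< {in `[0, 1]%R, f =1 g} >].
  apply/eqP/asboolP => [e t t01|e]; first by rewrite -trE // e trE.
  by apply/funext => t; rewrite /tr; case: ifP => // t01; exact: e.
have Htr f : H (tr f) = H f by apply: Hext; exact: trE.
pose s1 := [seq tr (face (c x.1) x.2) | x <- index_enum ('I_n * 'I_3)%type].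
pose s2 := [seq tr (a i) | i <- index_enum 'I_m].
have P1 : \prod_(k <- s1) H k = \prod_i \prod_k H (face (c i) k).
  rewrite big_map pair_big /=; apply: eq_bigr => x _; exact: Htr.
have P2 : \prod_(k <- s2) H k = \prod_i H (a i).
  by rewrite big_map; apply: eq_bigr => x _; exact: Htr.
have c1 f : count_mem (tr f) s1 = boundary_coef c f.
  rewrite count_map -sum1_count /boundary_coef pair_big /= big_mkcond /=.
  by apply: eq_bigr => x _; rewrite treq; case: asboolP.
have c2 f : count_mem (tr f) s2 = `[< exists i, {in `[0, 1]%R, a i =1 f} >] :> nat.
  rewrite count_map -sum1_count; case: asboolP => [[i ai]|nai].
    rewrite (big_pred1 i) // => j /=; rewrite treq; apply/asboolP/eqP => [aj|->//].
    by apply: ainj => t t01; rewrite aj // ai.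
  by rewrite big1 // => j /=; rewrite treq => /asboolP aj; case: nai; exists j.
have sq2 : (\prod_i H (a i)) ^+ 2 = 1.
  by rewrite -prodrXl big1 // => i _; exact: Ha.
have prod1 : \prod_(k <- s1 ++ s2) H k = 1.
  apply: even_count_prod => [k|k].
    rewrite mem_cat => /orP[] /mapP[x _ ->]; rewrite Htr ?Hc ?Ha //.
  move=> ks; have [f ->] : exists f, k = tr f.
    move: ks; rewrite mem_cat => /orP[] /mapP[x _ ->]; by eexists.
  rewrite count_cat c1 c2 oddD; case: asboolP => [/codd ->//|nf] /=.
  by rewrite addbF; apply/negP => /codd.
have nz : \prod_i H (a i) != 0.
  by apply: contraTneq isT => e; move/eqP: sq2; rewrite e expr0n /= eq_sym oner_eq0.
apply: (mulIf nz); rewrite -P1 -[in LHS]P2 -big_cat prod1.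
by rewrite -expr2 sq2.
Qed.

(** The linking argument.  The zeros of the complex function g are L, so that
    a square root of g changes sign along small loops around L.  The sign
    around each triangle of a chain counts its crossings with L, and these
    signs multiply to the sign along the boundary K, on which g takes each
    direction at most once. *)
Lemma odd_intersection (g : 'rV[R]_3 -> R[i]) (K L : set 'rV[R]_3) :
  ccont setT g -> (forall h, L h <-> g h = 0) ->
  (forall h, K h -> g h != 0) ->
  (forall h h' r, K h -> K h' -> 0 < r -> g h = r%:C%C * g h' -> h = h') ->
  K !=set0 ->
  (forall s p, transversal_at s L p -> L (s p) -> simple_zero (g \o s) p) ->
  forall n (c : chain2 R n), spanning_chain c K L ->
    odd (intersection_number c L).
Proof.
move=> gc Lg K0 Kray Kn0 simple n c [cc [m [a [[ac ainj Ka] codd]]] gp].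
have m0 : (0 < m)%N.
  by case: m a ac ainj Ka codd => // a _ _ Ka _; case: Kn0 => h; rewrite Ka => -[[]].
have aK i t : t \in `[0, 1]%R -> K (a i t).
  by move=> t01; rewrite Ka; exists i => //; exists t.
have gac i : ccont I01 (g \o a i) by apply: ccont_comp gc; [exact: ac|].
have gcc i : ccont (triangle R) (g \o c i) by apply: ccont_comp gc; [exact: cc|].
have ga0 i : {in `[0, 1]%R, forall t, (g \o a i) t != 0}.
  by move=> t t01; apply: K0; exact: aK.
have cross_simple i p : triangle R p -> g (c i p) = 0 -> simple_zero (g \o c i) p.
  move=> Tp gp0; have Lp : L (c i p) by exact/Lg.
  by apply: simple => //; case: (gp i) => _; apply.
have gb0 i k t : t \in `[0, 1]%R -> g (c i (edge k t)) != 0.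
  move=> t01; apply/eqP => /(cross_simple _ _ (edge_triangle k t01))[ein _].
  by have := edge_inside k t01 ein; rewrite eqxx.
have [|b arcs] := arcs_transport m0 gac ga0.
  move=> i j s t r s01 t01 r0 e; apply: ainj => //.
  by apply: (Kray _ _ r) => //; exact: aK.
pose sg := sqrt_section b.
have sg2 z : sg z ^+ 2 = z by exact: sqrt_section_sqr.
have sg0 z : z != 0 -> sg z != 0.
  by move=> z0; apply: contra_neq z0 => sz; rewrite -(sg2 z) sz expr0n.
(* the sign of a square root continued along tau, relative to the section *)
pose H (tau : R -> 'rV[R]_3) :=
  transport (g \o tau) * (sg (g (tau 0)) / sg (g (tau 1))).
have H2 tau : {in `[0, 1]%R, forall t, (g \o tau) t != 0} ->
    ccont I01 (g \o tau) -> H tau ^+ 2 = 1.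
  move=> t0 tc; rewrite /H !exprMn exprVn !sg2 transport_sqr //=.
  have := t0 _ in01_0; have := t0 _ in01_1 => /= ? ?.
  by field; apply/andP.
have Hprod : \prod_i \prod_k H (face (c i) k) = \prod_i H (a i).
  apply: boundary_prod => //.
  - move=> f h e; rewrite /H !e ?in01_0 ?in01_1 //; congr (_ * _).
    by apply: transport_ext => t t01; rewrite /= e.
  - by move=> i k; apply: H2; [move=> t; exact: gb0|exact: ccont_edge (gcc i)].
  - by move=> i; apply: H2.
  - move=> i j aij.
    have h : 1 / 2 \in `[0 : R, 1]%R by rewrite in_itv /=; lra.
    by case: (ainj i j (1 / 2) (1 / 2) h h (aij _ h)) => [[]|[[] e _]] //; exfalso; clear -e; lra.
have mono i : \prod_k H (face (c i) k) = monodromy (g \o c i).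
  rewrite !big_ord_recr big_ord0 /= mul1r.
  have -> : widen_ord (leqnSn 2) (widen_ord (leqnSn 1) ord_max) = 0 by exact/val_inj.
  have -> : widen_ord (leqnSn 2) ord_max = 1 by exact/val_inj.
  have HE k : H (face (c i) k) = transport ((g \o c i) \o edge k) *
      (sg (g (c i (edge k 0))) / sg (g (c i (edge k 1)))) by [].
  rewrite !HE !edgeE !subrr !subr0 /monodromy.
  have v0 := gb0 i 1 0 in01_0; have v2 := gb0 i 1 1 in01_1.
  have v1 := gb0 i ord_max 1 in01_1; rewrite !edgeE in v0 v1 v2.
  have := sg0 _ v0; have := sg0 _ v1; have := sg0 _ v2 => ? ? ?.
  have -> : (g \o c i) (pt2 0 0) / (g \o c i) (pt2 0 1) =
      sg (g (c i (pt2 0 0))) ^+ 2 / sg (g (c i (pt2 0 1))) ^+ 2 by rewrite !sg2.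
  by field; apply/andP.
have cnt i : monodromy (g \o c i) =
    (-1) ^+ #|` fset_set (crossings (c i) L)|.
  have [fin _] := gp i.
  have memZ p : (p \in fset_set (crossings (c i) L)) = (p \in crossings (c i) L).
    by rewrite in_fset_set.
  apply: monodromy_zeros => //.
  - exact: fset_uniq.
  - move=> x Tx; rewrite memZ; apply/eqP/idP => [gx|]; first by rewrite inE; split=> //; exact/Lg.
    by rewrite inE => -[_ /Lg].
  - by move=> p; rewrite memZ inE => -[Tp /Lg]; exact: cross_simple.
have : (-1 : R[i]) ^+ intersection_number c L = \prod_i H (a i).
  by rewrite -Hprod expr_sum; apply: eq_bigr => i _; rewrite mono cnt.
rewrite [RHS]arcs -signr_odd; case: odd => // /eqP.
by rewrite expr0 eq_sym eqNr oner_eq0.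
Qed.

End Parity.

(** * Zeros with invertible differential *)

Section SimpleZero.
Context {R : realType}.
Local Notation Re := complex.Re.
Local Notation Im := complex.Im.

Lemma interior_triangle (p : 'rV[R]_2) : (triangle R)° p -> inside p.
Proof.
move=> /nbhs_ballP[e /= e0 he].
have near u v : `|u| <= e / 2 -> `|v| <= e / 2 -> triangle R (pt2 (p 0 0 + u) (p 0 1 + v)).
  move=> u0 v0; apply: he; rewrite -ball_normE /ball_ /=.
  apply: (@le_lt_trans _ _ (e / 2)); last by lra.
  apply/norm_rV2_le; rewrite !mxE /= !opprD !addrA !subrr !add0r !normrN.
  by split.
have e20 : 0 <= e / 2 by lra.
have en : `|e / 2| <= e / 2 by rewrite ger0_norm.
have enN : `|- (e / 2)| <= e / 2 by rewrite normrN.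
have [a0 a1 _] := near _ _ enN enN; have [_ _ b] := near _ _ en en.
by move: a0 a1 b; rewrite !pt2E => a0 a1 b; split; lra.
Qed.

Lemma differentiable_remainder (f : 'rV[R]_2 -> R) p : differentiable f p ->
  f p = 0 ->
  forall e, 0 < e -> \forall x \near p, `|f x - 'd f p (x - p)| <= e * `|x - p|.
Proof.
move=> fd fp0 e e0.
have /eqaddoP/(_ _ e0) h0 := diff_locally fd.
rewrite (near_shift 0 p) /=.
apply: filterS h0 => h; rewrite /= subr0 addrK; congr (`|_| <= _).
by rewrite !fctE fp0 add0r.
Qed.

Lemma linE (a b : R[i]) p x : lin a b p x =
  Complex (Re a * (x - p) 0 0 + Re b * (x - p) 0 1)
          (Im a * (x - p) 0 0 + Im b * (x - p) 0 1).
Proof.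
case: a b => [a1 a2] [b1 b2]; rewrite /lin !mxE; simpc.
by apply/eqP; rewrite eq_complex /=; apply/andP; split; apply/eqP; ring.
Qed.

(** An invertible linear map is bounded below, by the formula for the inverse
    matrix. *)
Lemma norm_le_lin (a b : R[i]) p x : cross a b != 0 ->
  `|x - p| <= (`|Re a| + `|Re b| + `|Im a| + `|Im b|) / `|cross a b| *
    (`|Re (lin a b p x)| + `|Im (lin a b p x)|).
Proof.
move=> ab; have c0 : 0 < `|cross a b| by rewrite normr_gt0.
rewrite linE /= mulrAC ler_pdivlMr //; set v := x - p.
set u := Re a * _ + _; set w := Im a * _ + _.
have e0 : cross a b * v 0 0 = Im b * u - Re b * w by rewrite /cross /u /w; ring.
have e1 : cross a b * v 0 1 = Re a * w - Im a * u by rewrite /cross /u /w; ring.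
rewrite mulrC -[X in X * _]normr_id -normrZ; apply/norm_rV2_le.
have n0 (x1 y z t : R) : `|x1 * y - z * t| <= (`|x1| + `|z|) * (`|y| + `|t|).
  apply: (le_trans (ler_normB _ _)); rewrite !normrM.
  have := mulr_ge0 (normr_ge0 x1) (normr_ge0 t).
  have := mulr_ge0 (normr_ge0 z) (normr_ge0 y).
  by rewrite mulrDl !mulrDr; lra.
have ne i : `|(`|cross a b| *: v) 0 i| = `|cross a b * v 0 i|.
  by rewrite mxE !normrM normr_id.
rewrite !ne e0 e1; split.
  apply: (le_trans (n0 _ _ _ _)); apply: ler_wpM2r; first by rewrite addr_ge0.
  by have := normr_ge0 (Re a); have := normr_ge0 (Im a); lra.
rewrite [X in _ <= _ * X]addrC.
apply: (le_trans (n0 _ _ _ _)); apply: ler_wpM2r; first by rewrite addr_ge0.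
by have := normr_ge0 (Re b); have := normr_ge0 (Im b); lra.
Qed.

Lemma approx_simple_zero (f : 'rV[R]_2 -> R[i]) p (a b : R[i]) :
  inside p -> cross a b != 0 ->
  (forall e, 0 < e -> \forall x \near p,
     `|Re (f x) - Re (lin a b p x)| <= e * `|x - p|) ->
  (forall e, 0 < e -> \forall x \near p,
     `|Im (f x) - Im (lin a b p x)| <= e * `|x - p|) ->
  simple_zero f p.
Proof.
move=> pin ab d1 d2; split=> //; exists a, b; split=> //.
pose M := (`|Re a| + `|Re b| + `|Im a| + `|Im b|) / `|cross a b|.
have M0 : 0 <= M by rewrite divr_ge0 // !addr_ge0.
have Mb x := norm_le_lin p x ab; rewrite -/M in Mb; clearbody M.
have key e : 0 < e -> \forall x \near p, x != p ->
    `|Re (f x / lin a b p x) - 1| <= e /\ `|Im (f x / lin a b p x)| <= e.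
  move=> e0; pose k := e / (2 * M + 1).
  have k0 : 0 < k by rewrite divr_gt0 //; lra.
  have ke : k * (2 * M) <= e.
    rewrite /k mulrAC ler_pdivrMr; last by lra.
    by apply: ler_wpM2l; [exact: ltW|lra].
  clearbody k.
  have := d2 _ k0; have := d1 _ k0.
  apply: filterS2 => x r1 r2 xp.
  have l0 : lin a b p x != 0 by exact: lin_neq0.
  have := complex_sqr_norm_gt0 l0; have := Mb x.
  rewrite complex_ReM complex_ImM complex_ReV complex_ImV.
  move: (Re (lin a b p x)) (Im (lin a b p x)) `|x - p| (Re (f x)) (Im (f x)) r1 r2.
  move=> u v nn fr fi r1 r2 nb; set N := u ^+ 2 + v ^+ 2 => N0.
  have N0' : N != 0 by rewrite gt_eqF.
  have -> : fr * (u / N) - fi * (- v / N) - 1 = ((fr - u) * u + (fi - v) * v) / N.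
    by apply: (mulIf N0'); rewrite divfK // !mulrBl mul1r -!mulrA mulVf // !mulr1 /N; ring.
  have -> : fr * (- v / N) + fi * (u / N) = ((fi - v) * u - (fr - u) * v) / N.
    by apply: (mulIf N0'); rewrite divfK // mulrDl -!mulrA mulVf // !mulr1 /N; ring.
  have uv2 : (`|u| + `|v|) ^+ 2 <= 2 * N.
    rewrite /N -(real_normK (num_real u)) -(real_normK (num_real v)).
    by have := sqr_ge0 (`|u| - `|v|); rewrite !expr2; lra.
  have S0 : 0 <= `|u| + `|v| by rewrite addr_ge0.
  have est (s : R) : `|s| <= (k * nn) * (`|u| + `|v|) -> `|s / N| <= e.
    move=> sb; rewrite normrM normfV (gtr0_norm N0) ler_pdivrMr //.
    apply: (le_trans sb); apply: (@le_trans _ _ (k * (2 * M) * N)); last first.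
      by apply: ler_wpM2r => //; exact: ltW.
    rewrite -!mulrA; apply: ler_wpM2l; first exact: ltW.
    apply: (@le_trans _ _ (M * (`|u| + `|v|) ^+ 2)).
      by rewrite expr2 mulrA; apply: ler_wpM2r.
    by rewrite [leRHS]mulrCA; apply: ler_wpM2l.
  split; apply: est.
    apply: (le_trans (ler_normD _ _)); rewrite !normrM mulrDr; apply: lerD.
      by apply: ler_wpM2r.
    by apply: ler_wpM2r.
  apply: (le_trans (ler_normB _ _)); rewrite !normrM mulrDr; apply: lerD.
    by apply: ler_wpM2r.
  by apply: ler_wpM2r.
split; apply/cvgrPdist_le => e e0.
  rewrite near_withinE; apply: filterS (key e e0) => x h xp.
  by rewrite distrC; have [] := h xp.
rewrite near_withinE; apply: filterS (key e e0) => x h xp.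
by rewrite sub0r normrN; have [] := h xp.
Qed.

Lemma diff_rV2 (f : 'rV[R]_2 -> R) p w :
  'd f p w = 'd f p (pt2 1 0) * w 0 0 + 'd f p (pt2 0 1) * w 0 1.
Proof.
have wE : w = w 0 0 *: pt2 1 0 + w 0 1 *: pt2 0 1.
  by rewrite -{1}[w]pt2_eta; apply/rowP => i; rewrite !mxE; case: ifP => _; ring.
rewrite {1}wE linearD linearZ linearZ.
by congr (_ + _); rewrite mulrC.
Qed.

Lemma injective_approx_simple_zero (f : 'rV[R]_2 -> R[i]) p (D1 D2 : 'rV[R]_2 -> R) :
  inside p -> (forall w, D1 w = 0 -> D2 w = 0 -> w = 0) ->
  (forall w, D1 w = D1 (pt2 1 0) * w 0 0 + D1 (pt2 0 1) * w 0 1) ->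
  (forall w, D2 w = D2 (pt2 1 0) * w 0 0 + D2 (pt2 0 1) * w 0 1) ->
  (forall e, 0 < e -> \forall x \near p, `|Re (f x) - D1 (x - p)| <= e * `|x - p|) ->
  (forall e, 0 < e -> \forall x \near p, `|Im (f x) - D2 (x - p)| <= e * `|x - p|) ->
  simple_zero f p.
Proof.
move=> pin inj E1 E2 r1 r2.
pose a := Complex (D1 (pt2 1 0)) (D2 (pt2 1 0)).
pose b := Complex (D1 (pt2 0 1)) (D2 (pt2 0 1)).
have inj2 u v : Re a * u + Re b * v = 0 -> Im a * u + Im b * v = 0 -> u = 0 /\ v = 0.
  move=> e1 e2; have h : pt2 u v = 0.
    apply: inj; first by rewrite E1 pt2E0 pt2E1; exact: e1.
    by rewrite E2 pt2E0 pt2E1; exact: e2.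
  by rewrite -(pt2E0 u v) -{2}(pt2E1 u v) h !mxE.
have ab : cross a b != 0.
  apply/eqP => c0; have c0' : Re a * Im b = Im a * Re b.
    by apply/eqP; rewrite -subr_eq0 -/(cross a b) c0.
  have [rb ra] : Re b = 0 /\ - Re a = 0.
    by apply: inj2; [ring|rewrite mulrN [Im b * _]mulrC c0' subrr].
  have [ib ia] : Im b = 0 /\ - Im a = 0.
    by apply: inj2; [rewrite mulrN c0' [Im a * _]mulrC subrr|ring].
  have [/eqP] : (1 : R) = 0 /\ (0 : R) = 0.
    apply: inj2; rewrite !mulr0 addr0 mulr1; first by rewrite -[Re a]opprK ra oppr0.
    by rewrite -[Im a]opprK ia oppr0.
  by rewrite oner_eq0.
apply: (approx_simple_zero (a := a) (b := b) pin ab) => e e0.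
  by apply: filterS (r1 e e0) => x; rewrite linE /= -E1.
by apply: filterS (r2 e e0) => x; rewrite linE /= -E2.
Qed.

Lemma differentiable_simple_zero (f : 'rV[R]_2 -> R[i]) p :
  inside p -> f p = 0 ->
  differentiable (fun x => Re (f x)) p -> differentiable (fun x => Im (f x)) p ->
  (forall w, 'd (fun x => Re (f x)) p w = 0 -> 'd (fun x => Im (f x)) p w = 0 -> w = 0) ->
  simple_zero f p.
Proof.
move=> pin fp0 d1 d2 inj.
have r0 : Re (f p) = 0 by rewrite fp0.
have i0 : Im (f p) = 0 by rewrite fp0.
exact (@injective_approx_simple_zero f p
  ('d (fun x => Re (f x)) p) ('d (fun x => Im (f x)) p) pin inj
  (@diff_rV2 (fun x => Re (f x)) p) (@diff_rV2 (fun x => Im (f x)) p)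
  (differentiable_remainder d1 r0) (differentiable_remainder d2 i0)).
Qed.

End SimpleZero.

(** * An ellipse and a branch of its focal hyperbola *)

Section FocalConics.
Context {R : realType}.
Local Notation Re := complex.Re.
Local Notation Im := complex.Im.
Local Notation z3 := (ord_max : 'I_3).

(** The coordinates in which the ellipse and the hyperbola are in standard
    position. *)
Definition affine_coord (h0 : 'rV[R]_3) (M : 'M[R]_3) (h : 'rV[R]_3) : 'rV[R]_3 :=
  (h - h0) *m M.

(** The ellipse with half axes a and sqrt (a ^ 2 - c ^ 2) and with foci at
    height c and - c. *)
Definition focal_ellipse (a c : R) : set 'rV[R]_3 :=
  [set v | v 0 0 = 0 /\ v 0 1 ^+ 2 / (a ^+ 2 - c ^+ 2) + v 0 z3 ^+ 2 / a ^+ 2 = 1].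

(** The vertex is the focus of the ellipse at height c; the other branch is
    the mirror image in the plane of height 0. *)
Definition focal_branch (a c : R) : set 'rV[R]_3 :=
  [set v | [/\ v 0 1 = 0, 0 < v 0 z3 &
     v 0 z3 ^+ 2 / c ^+ 2 - v 0 0 ^+ 2 / (a ^+ 2 - c ^+ 2) = 1]].

Definition row3 (x y z : R) : 'rV[R]_3 :=
  \row_i if i == 0 then x else if i == 1 then y else z.

Lemma row3E x y z : (row3 x y z 0 0 = x) * (row3 x y z 0 1 = y) * (row3 x y z 0 z3 = z).
Proof. by rewrite !mxE. Qed.

Lemma row3_eta (v : 'rV[R]_3) : v = row3 (v 0 0) (v 0 1) (v 0 z3).
Proof.
apply/rowP => i; rewrite mxE.
by case: i => [[|[|[|//]]] hi] /=; congr (v _ _); apply/val_inj.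
Qed.

Lemma mulmx_rV3 (u : 'rV[R]_3) (M : 'M[R]_3) k :
  (u *m M) 0 k = u 0 0 * M 0 k + u 0 1 * M 1 k + u 0 z3 * M z3 k.
Proof.
rewrite mxE !big_ord_recr big_ord0 /= add0r.
have -> : widen_ord (leqnSn 2) (widen_ord (leqnSn 1) ord_max) = 0 by exact/val_inj.
by have -> : widen_ord (leqnSn 2) ord_max = 1 by exact/val_inj.
Qed.

Lemma mulmx_coord_continuous (M : 'M[R]_3) k :
  continuous (fun u : 'rV[R]_3 => (u *m M) 0 k : R).
Proof.
under eq_fun do rewrite mulmx_rV3.
move=> v; have term j : (fun u : 'rV[R]_3 => u 0 j * M j k : R) @ v --> v 0 j * M j k.
  apply: (@cvgM R _ (nbhs v) _ (fun u : 'rV[R]_3 => u 0 j : R) (fun=> M j k)).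
    exact: coord_continuous.
  exact: cvg_cst.
exact: (cvgD (cvgD (term 0) (term 1)) (term z3)).
Qed.

Lemma affine_coord_diff h0 (M : 'M[R]_3) k x :
  differentiable (fun h => affine_coord h0 M h 0 k) x /\
  ('d (fun h => affine_coord h0 M h 0 k) x = (fun u => (u *m M) 0 k) :> (_ -> _)).
Proof.
have fl : linear (fun u : 'rV[R]_3 => (u *m M) 0 k : R).
  by move=> r u v; rewrite mulmxDl -scalemxAl !mxE.
pose fL : {linear 'rV[R]_3 -> R} := HB.pack (fun u : 'rV[R]_3 => (u *m M) 0 k : R)
  (GRing.isLinear.Build _ _ _ _ _ fl).
have fc : continuous fL by exact: mulmx_coord_continuous.
have -> : (fun h => affine_coord h0 M h 0 k) =
    (fL : 'rV[R]_3 -> R) + cst (- (h0 *m M) 0 k).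
  by apply/funext => h; rewrite /affine_coord fctE mulmxBl [LHS]mxE [X in _ + X]mxE.
have dl : differentiable fL x by exact: linear_differentiable.
have dc : differentiable (cst (- (h0 *m M) 0 k) : 'rV[R]_3 -> R) x.
  exact: differentiable_cst.
split; first exact: differentiableD.
rewrite diffD // diff_lin // diff_cst; apply/funext => u; exact: addr0.
Qed.

Lemma affine_coord_inj h0 (M : 'M[R]_3) : M \in unitmx -> injective (affine_coord h0 M).
Proof. by move=> Mu h h' /(can_inj (mulmxK Mu)) /addIr. Qed.

Definition branch_height (a c x : R) : R :=
  c * Num.sqrt (1 + x ^+ 2 / (a ^+ 2 - c ^+ 2)).

(** The zeros are the points of the branch, and on the plane of the ellipse
    the value is the position relative to the focus. *)
Definition focal_map (a c : R) (v : 'rV[R]_3) : R[i] :=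
  Complex (v 0 z3 - branch_height a c (v 0 0)) (v 0 1).

Lemma branch_height_diff a c x : c ^+ 2 < a ^+ 2 -> differentiable (branch_height a c) x.
Proof.
move=> ac; have b0 : 0 < a ^+ 2 - c ^+ 2 by rewrite subr_gt0.
apply: differentiableM; first exact: differentiable_cst.
pose f (t : R) : R := 1 + t ^+ 2 / (a ^+ 2 - c ^+ 2).
have df : differentiable f x.
  apply: differentiableD; first exact: differentiable_cst.
  by apply: differentiableM => //; exact: differentiable_cst.
have ds : differentiable (Num.sqrt : R -> R) (f x).
  apply/derivable1_diffP; have [] // := @is_derive1_sqrt R (f x).
  by rewrite ltr_pwDl // divr_ge0 ?sqr_ge0 // ltW.
exact: (differentiable_comp df ds).
Qed.

Lemma focal_map_zero a c v : 0 < c -> c ^+ 2 < a ^+ 2 ->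
  focal_branch a c v <-> focal_map a c v = 0.
Proof.
move=> c0 ac; have b0 : 0 < a ^+ 2 - c ^+ 2 by rewrite subr_gt0.
rewrite /focal_branch /focal_map /branch_height /=.
set x := v 0 0; set y := v 0 1; set z := v 0 z3.
have q0 : 0 < 1 + x ^+ 2 / (a ^+ 2 - c ^+ 2).
  by rewrite ltr_pwDl // divr_ge0 ?sqr_ge0 // ltW.
set q := 1 + _ in q0 *.
split=> [[-> z0 e]|/eqP].
  suff -> : z = c * Num.sqrt q by rewrite subrr.
  have e' : z ^+ 2 = c ^+ 2 * q.
    have -> : q = z ^+ 2 / c ^+ 2 by rewrite /q -e; ring.
    by rewrite mulrC divfK // expf_neq0 // gt_eqF.
  apply/eqP; rewrite -(@eqrXn2 _ 2) ?mulr_ge0 ?sqrtr_ge0 ?(ltW z0) ?(ltW c0) //.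
  by rewrite exprMn sqr_sqrtr ?e' // ltW.
rewrite eq_complex /= => /andP[/eqP e /eqP ->].
have ez : z = c * Num.sqrt q by lra.
split=> //; first by rewrite ez mulr_gt0 // sqrtr_gt0.
rewrite ez exprMn sqr_sqrtr ?(ltW q0) // mulrAC divff ?mul1r /q; first by ring.
by rewrite expf_neq0 // gt_eqF.
Qed.

(** The distance from the focus to a point of the ellipse is an affine
    function of the point. *)
Lemma focal_distance a c v : 0 < c < a -> focal_ellipse a c v ->
  [/\ 0 < a - c * v 0 z3 / a, Re (focal_map a c v) = v 0 z3 - c &
   Re (focal_map a c v) ^+ 2 + Im (focal_map a c v) ^+ 2 = (a - c * v 0 z3 / a) ^+ 2].
Proof.
move=> /andP[c0 ca] [/= x0]; rewrite /branch_height x0 expr0n /= mul0r addr0 sqrtr1 mulr1.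
set y := v 0 1; set z := v 0 z3 => e.
have a0 : 0 < a by lra.
have b0 : 0 < a ^+ 2 - c ^+ 2 by nra.
have y2 : y ^+ 2 = (a ^+ 2 - c ^+ 2) * (1 - z ^+ 2 / a ^+ 2).
  by rewrite -e addrK mulrC divfK // gt_eqF.
have za : z <= a.
  have : 0 <= 1 - z ^+ 2 / a ^+ 2.
    by rewrite -(pmulr_rge0 _ b0) -y2 sqr_ge0.
  rewrite subr_ge0 ler_pdivrMr ?exprn_gt0 // mul1r; nra.
split=> //.
  rewrite subr_gt0 ltr_pdivrMr //; nra.
by rewrite y2; field; rewrite gt_eqF.
Qed.

Lemma focal_map_neq0 a c v : 0 < c < a -> focal_ellipse a c v -> focal_map a c v != 0.
Proof.
move=> ca /(focal_distance ca)[r0 _ e]; apply: contraTneq r0 => f0.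
move: e; rewrite f0 /= expr0n /= addr0 => /esym/eqP; rewrite sqrf_eq0 => /eqP ->.
by rewrite ltxx.
Qed.

(** Points in the same direction from the focus have positions and distances
    in the same ratio; since the distance is an affine function of the
    position, the ratio is 1. *)
Lemma focal_map_ray a c v v' r : 0 < c < a -> focal_ellipse a c v -> focal_ellipse a c v' ->
  0 < r -> focal_map a c v = r%:C%C * focal_map a c v' -> v = v'.
Proof.
move=> ca Kv Kv' r0 e.
have [p q d] := focal_distance ca Kv; have [p' q' d'] := focal_distance ca Kv'.
have [eR eI] : Re (focal_map a c v) = r * Re (focal_map a c v') /\
    Im (focal_map a c v) = r * Im (focal_map a c v').
  by rewrite e complex_ReM complex_ImM; case: (focal_map a c v') => s t /=; split; ring.
have x0 : v 0 0 = 0 by case: Kv. have x0' : v' 0 0 = 0 by case: Kv'.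
have dd : a - c * v 0 z3 / a = r * (a - c * v' 0 z3 / a).
  apply/eqP; rewrite -(@eqrXn2 _ 2) ?(ltW p) ?mulr_ge0 ?(ltW p') ?(ltW r0) //.
  by rewrite exprMn -d -d' eR eI; apply/eqP; ring.
have [c0 ac] := andP ca; have a0 : 0 < a by lra.
rewrite q q' in eR; rewrite /= in eI.
have r1 : r = 1.
  have : (a ^+ 2 - c ^+ 2) * (r - 1) = 0.
    have E1 : a ^+ 2 - c * v 0 z3 = r * (a ^+ 2 - c * v' 0 z3).
      have := congr1 ( *%R a) dd.
      have -> : a * (a - c * v 0 z3 / a) = a ^+ 2 - c * v 0 z3 by field; rewrite gt_eqF.
      by move=> ->; field; rewrite gt_eqF.
    have E2 := congr1 ( *%R c) eR.
    by lra.
  by move/eqP; rewrite mulf_eq0 subr_eq0 => /orP[]/eqP; [nra|lra].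
rewrite r1 !mul1r in eR eI.
rewrite (row3_eta v) (row3_eta v') x0 x0'; congr row3; lra.
Qed.

End FocalConics.

(** * Crossings of a chain with the branch *)

Section FocalLinking.
Context {R : realType}.
Local Notation Re := complex.Re.
Local Notation Im := complex.Im.
Local Notation z3 := (ord_max : 'I_3).
Variables (a c : R) (h0 : 'rV[R]_3) (M : 'M[R]_3).
Hypotheses (ca : 0 < c < a) (Mu : M \in unitmx).
Local Notation A := (affine_coord h0 M).
Local Notation K := (A @^-1` focal_ellipse a c).
Local Notation L := (A @^-1` focal_branch a c).

Let c0 : 0 < c. Proof. by case/andP: ca. Qed.
Let a0 : 0 < a. Proof. by case/andP: ca => *; lra. Qed.
Let ca2 : c ^+ 2 < a ^+ 2. Proof. by case/andP: ca => *; nra. Qed.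
Let b0 : 0 < a ^+ 2 - c ^+ 2. Proof. by rewrite subr_gt0. Qed.

Definition affine_point (v : 'rV[R]_3) : 'rV[R]_3 := v *m invmx M + h0.

Lemma affine_pointK v : A (affine_point v) = v.
Proof. by rewrite /affine_coord /affine_point addrK mulmxKV. Qed.

Lemma affine_coordK h : affine_point (A h) = h.
Proof. by rewrite /affine_coord /affine_point mulmxK // subrK. Qed.

Definition branch_point (t : R) : 'rV[R]_3 :=
  affine_point (row3 t 0 (branch_height a c t)).

Lemma branch_pointL t : L (branch_point t).
Proof.
rewrite /= /branch_point affine_pointK; apply/focal_map_zero => //.
by rewrite /focal_map !row3E subrr.
Qed.

Lemma branch_pointE h : L h -> branch_point (A h 0 0) = h.
Proof.
move=> Lh; have /focal_map_zero/eqP : focal_branch a c (A h) by [].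
move=> /(_ c0 ca2); rewrite eq_complex /= => /andP[/eqP e /eqP y0].
rewrite /branch_point -[RHS]affine_coordK [in RHS](row3_eta (A h)) y0.
by congr (affine_point (row3 _ _ _)); apply/esym/eqP; rewrite -subr_eq0 e.
Qed.

Lemma branch_point_differentiable t : differentiable branch_point t.
Proof.
have dbh := branch_height_diff t ca2.
have bE : branch_point = (fun t => t *: row 0 (invmx M)) +
   ((fun t => branch_height a c t *: row z3 (invmx M)) + cst h0).
  apply/funext => r; rewrite /branch_point /affine_point !fctE addrA; congr (_ + _).
  by apply/rowP => k; rewrite mulmx_rV3 !row3E !mxE; ring.
rewrite bE; apply: differentiableD; first exact: differentiableZl.
by apply: differentiableD; [exact: differentiableZl|exact: differentiable_cst].
Qed.

Lemma diff_affine_comp (V : normedModType R) (f : V -> 'rV[R]_3) (x : V) k (u : V) :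
  differentiable f x ->
  differentiable (fun y => A (f y) 0 k) x /\
  ('d (fun y => A (f y) 0 k) x u = (('d f x u : 'rV[R]_3) *m M) 0 k).
Proof.
move=> df; have [dA dAE] := affine_coord_diff h0 M k (f x).
split; first exact: (differentiable_comp df dA).
have dE := diff_comp df dA.
transitivity (('d (fun h => A h 0 k) (f x) \o 'd f x) u); first by rewrite -dE.
by rewrite dAE.
Qed.

Lemma branch_point_diff t r : ('d branch_point t r : 'rV[R]_3) *m M =
  row3 r 0 ('d (branch_height a c) t r).
Proof.
have db := branch_point_differentiable t.
have bh s : A (branch_point s) = row3 s 0 (branch_height a c s).
  exact: affine_pointK.
have E0 : (fun s => A (branch_point s) 0 0) = id.
  by apply/funext => s; rewrite bh row3E.
have E1 : (fun s => A (branch_point s) 0 1) = cst 0.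
  by apply/funext => s; rewrite bh row3E.
have E2 : (fun s => A (branch_point s) 0 z3) = branch_height a c.
  by apply/funext => s; rewrite bh row3E.
rewrite [LHS]row3_eta; congr row3.
- by have [_ <-] := diff_affine_comp 0 r db; rewrite E0 diff_val.
- by have [_ <-] := diff_affine_comp 1 r db; rewrite E1 diff_cst.
- by have [_ <-] := diff_affine_comp z3 r db; rewrite E2.
Qed.

(** Any equation F of the branch has a differential that vanishes along the
    tangent vector of the branch, which is also the kernel of the differential
    of the focal map.  So transversality with respect to F is transversality
    with respect to the focal map. *)
Lemma diff_branch_eq0 (F : 'rV[R]_3 -> 'rV[R]_2) t r :
  differentiable F (branch_point t) ->
  (\forall y \near branch_point t, L y <-> F y = 0) ->
  'd F (branch_point t) ('d branch_point t r) = 0.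
Proof.
move=> dF FL; have db := branch_point_differentiable t.
transitivity ('d (F \o branch_point) t r).
  by have dE := diff_comp db dF; rewrite dE.
rewrite -deriveE; last exact: differentiable_comp.
have near0 : \forall s \near t, (F \o branch_point) s = cst 0 s.
  have h : nbhs t (fun s => L (branch_point s) <-> F (branch_point s) = 0).
    exact: (differentiable_continuous db FL).
  by apply: filterS h => s [h _]; apply: h; exact: branch_pointL.
by rewrite (near_eq_derive _ near0) derive_cst.
Qed.

Lemma transversal_simple_zero s p : transversal_at s L p -> L (s p) ->
  simple_zero ((focal_map a c \o A) \o s) p.
Proof.
move=> [/interior_triangle pin ds [F [FC FL Fu]]] Lsp.
have dF : differentiable F (s p) by have [] := nbhs_singleton FC.
pose t := A (s p) 0 0; have bt : branch_point t = s p by exact: branch_pointE.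
have dx w := diff_affine_comp 0 w ds; have dy w := diff_affine_comp 1 w ds.
have dz w := diff_affine_comp z3 w ds.
have dg : differentiable (branch_height a c) t by exact: branch_height_diff.
have dgx : differentiable (branch_height a c \o (fun x => A (s x) 0 0)) p.
  exact: differentiable_comp (dx 0).1 dg.
have f0 : (focal_map a c \o A) (s p) = 0 by apply/focal_map_zero.
apply: (differentiable_simple_zero pin f0).
- exact: differentiableB (dz 0).1 dgx.
- exact: (dy 0).1.
move=> w e1 e2.
have e1' : ((('d s p w : 'rV[R]_3) *m M) 0 z3) -
    'd (branch_height a c \o (fun x => A (s x) 0 0)) p w = 0.
  have dB := diffB (dz 0).1 dgx.
  rewrite -(dz w).2.
  exact: (etrans (esym (congr1 (fun D : 'rV[R]_2 -> R => D w) dB)) e1).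
have {}e2 : (('d s p w : 'rV[R]_3) *m M) 0 1 = 0 by rewrite -(dy w).2.
pose u : 'rV[R]_3 := 'd s p w; pose r := (u *m M) 0 0.
have e3 : 'd (branch_height a c \o (fun x => A (s x) 0 0)) p w = 'd (branch_height a c) t r.
  by have dE := diff_comp (dx 0).1 dg; rewrite dE /= (dx w).2.
have uE : u = 'd branch_point t r.
  apply: (can_inj (mulmxK Mu)); rewrite branch_point_diff [LHS]row3_eta.
  by congr row3; [exact: e2|apply/eqP; rewrite -subr_eq0 -e3; apply/eqP; exact: e1'].
have Fw : 'd (F \o s) p w = 0.
  have dE := diff_comp ds dF; rewrite dE /= -/u uE -bt.
  by apply: diff_branch_eq0; rewrite bt.
have : w *m jacobian (F \o s) p = 0 by rewrite /jacobian mul_rV_lin1.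
by move/(congr1 (mulmx^~ (invmx (jacobian (F \o s) p)))); rewrite mulmxK // mul0mx.
Qed.

Lemma focal_odd_intersection n (c' : chain2 R n) :
  spanning_chain c' K L -> odd (intersection_number c' L).
Proof.
apply: (@odd_intersection R (focal_map a c \o A)).
- apply/ccontP; split.
    apply: continuous_subspaceT => h; apply: differentiable_continuous.
    apply: (differentiableB (affine_coord_diff h0 M z3 h).1).
    apply: (differentiable_comp (affine_coord_diff h0 M 0 h).1).
    exact: branch_height_diff.
  apply: continuous_subspaceT => h; apply: differentiable_continuous.
  exact: (affine_coord_diff h0 M 1 h).1.
- by move=> h; apply: focal_map_zero.
- by move=> h; apply: focal_map_neq0.
- move=> h h' r Kh Kh' r0 e; apply: (affine_coord_inj Mu).
  exact: (focal_map_ray ca Kh Kh' r0 e).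
- exists (affine_point (row3 0 0 a)); rewrite /= affine_pointK; split; rewrite !row3E //.
  by rewrite expr0n /= mul0r add0r divff // expf_neq0 // gt_eqF.
- exact: transversal_simple_zero.
Qed.

End FocalLinking.

(** * The triangle as a disc cut along a radius *)

Section DiscChart.
Context {R : realType}.
Local Notation T := (triangle R).

(** In complex notation with z = x 0 0 + i x 0 1, the point
    disc_re x + i disc_im x is - (x 0 0 + x 0 1) (z / |z|) ^ 4: the angle at the
    origin is opened to a full turn, so that the triangle becomes the unit disc
    cut along a radius and the edge opposite to the origin the unit circle. *)
Definition disc_re (x : 'rV[R]_2) : R :=
  - (x 0 0 + x 0 1) * ((x 0 0 ^+ 2 - x 0 1 ^+ 2) ^+ 2 - (2 * x 0 0 * x 0 1) ^+ 2) /
  (x 0 0 ^+ 2 + x 0 1 ^+ 2) ^+ 2.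

Definition disc_im (x : 'rV[R]_2) : R :=
  - (x 0 0 + x 0 1) * (2 * (x 0 0 ^+ 2 - x 0 1 ^+ 2) * (2 * x 0 0 * x 0 1)) /
  (x 0 0 ^+ 2 + x 0 1 ^+ 2) ^+ 2.

Lemma norm_sqr_neq0 (x : 'rV[R]_2) : x != 0 -> x 0 0 ^+ 2 + x 0 1 ^+ 2 != 0.
Proof.
apply: contra_neq => /eqP; rewrite paddr_eq0 ?sqr_ge0 // !sqrf_eq0.
case/andP=> /eqP e0 /eqP e1; rewrite -[x]pt2_eta e0 e1.
by apply/rowP => i; rewrite !mxE; case: ifP.
Qed.

Lemma disc_norm x : x != 0 -> disc_re x ^+ 2 + disc_im x ^+ 2 = (x 0 0 + x 0 1) ^+ 2.
Proof. by move=> /norm_sqr_neq0 N0; rewrite /disc_re /disc_im; field. Qed.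

Lemma disc0 : disc_re 0 = 0 /\ disc_im 0 = 0.
Proof. by rewrite /disc_re /disc_im !mxE addr0 oppr0 !mul0r. Qed.

Lemma disc_bound x : `|disc_re x| <= `|x 0 0 + x 0 1| /\ `|disc_im x| <= `|x 0 0 + x 0 1|.
Proof.
have [->|x0] := eqVneq x 0; first by rewrite disc0.1 disc0.2 normr0.
have e := disc_norm x0.
have abs_le (u v : R) : u ^+ 2 <= v ^+ 2 -> `|u| <= `|v|.
  by move=> uv; rewrite -(@ler_pXn2r _ 2) ?nnegrE // !real_normK ?num_real.
have := sqr_ge0 (disc_re x); have := sqr_ge0 (disc_im x).
by split; apply: abs_le; rewrite -e; lra.
Qed.

Lemma differentiable_sqr (V : normedModType R) (f : V -> R) x :
  differentiable f x -> differentiable (fun y => f y ^+ 2) x.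
Proof.
move=> df; rewrite (_ : (fun y => _) = f * f); first exact: differentiableM.
by apply/funext => y; rewrite expr2.
Qed.

Lemma disc_differentiable x : x != 0 ->
  differentiable disc_re x /\ differentiable disc_im x.
Proof.
move=> /norm_sqr_neq0 N0.
have d0 : differentiable (fun x : 'rV[R]_2 => x 0 0 : R) x by exact: differentiable_coord.
have d1 : differentiable (fun x : 'rV[R]_2 => x 0 1 : R) x by exact: differentiable_coord.
have d2 : differentiable (fun x : 'rV[R]_2 => 2 * x 0 0 * x 0 1 : R) x.
  by apply: differentiableM d1; apply: differentiableM d0; exact: differentiable_cst.
have dB : differentiable (fun x : 'rV[R]_2 => x 0 0 ^+ 2 - x 0 1 ^+ 2 : R) x.
  exact: (differentiableB (differentiable_sqr d0) (differentiable_sqr d1)).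
have dN : differentiable (fun x : 'rV[R]_2 => ((x 0 0 ^+ 2 + x 0 1 ^+ 2) ^+ 2)^-1 : R) x.
  apply: (differentiableV (f := fun x : 'rV[R]_2 => (x 0 0 ^+ 2 + x 0 1 ^+ 2) ^+ 2 : R)).
    exact: (differentiable_sqr (differentiableD (differentiable_sqr d0) (differentiable_sqr d1))).
  by rewrite expf_neq0.
have dS := differentiableN (differentiableD d0 d1).
split.
  exact: (differentiableM (differentiableM dS (differentiableB (differentiable_sqr dB) (differentiable_sqr d2))) dN).
have d2c : differentiable (cst 2 : 'rV[R]_2 -> R) x by exact: differentiable_cst.
exact: (differentiableM (differentiableM dS (differentiableM (differentiableM d2c dB) d2)) dN).
Qed.

Lemma disc_continuous : continuous disc_re /\ continuous disc_im.
Proof.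
have sq (f : 'rV[R]_2 -> R) (p : 'rV[R]_2) : p = 0 -> f p = 0 ->
    (forall x, `|f x| <= `|x 0 0 + x 0 1|) -> {for p, continuous f}.
  move=> p0 f0 fb; apply: (proj2 (@cvgrPdist_lt _ _ _ (nbhs p) _ f (f p))) => e e0.
  have e20 : 0 < e / 2 by rewrite divr_gt0.
  have : nbhs p (ball p (e / 2)) by exact: nbhsx_ballx.
  apply: filterS => x; rewrite -ball_normE /ball_ /= {1}p0 sub0r normrN => xe.
  rewrite f0 sub0r normrN.
  apply: (le_lt_trans (fb x)); apply: (le_lt_trans (ler_normD _ _)).
  have [] := (norm_rV2_le x `|x|).1 (lexx _); lra.
split=> x; have [x0|x0] := eqVneq x 0.
- apply: (sq _ _ x0); first by rewrite x0 disc0.1.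
  by move=> y; have [] := disc_bound y.
- by apply: differentiable_continuous; have [] := disc_differentiable x0.
- apply: (sq _ _ x0); first by rewrite x0 disc0.2.
  by move=> y; have [] := disc_bound y.
- by apply: differentiable_continuous; have [] := disc_differentiable x0.
Qed.

(** Two directions at a right angle have the same fourth power. *)
Lemma disc_sides t : disc_re (pt2 0 t) = disc_re (pt2 t 0) /\
  disc_im (pt2 0 t) = disc_im (pt2 t 0).
Proof.
by rewrite /disc_re /disc_im !pt2E; split; [congr (_ * _ * _^-1)|]; ring.
Qed.

(** Along the edge opposite to the origin z / |z| runs through a quarter of
    the circle, so its fourth power runs once through the circle. *)
Lemma disc_loop_inj s t : s \in `[0, 1]%R -> t \in `[0, 1]%R ->
  disc_re (pt2 (1 - s) s) = disc_re (pt2 (1 - t) t) ->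
  disc_im (pt2 (1 - s) s) = disc_im (pt2 (1 - t) t) ->
  s = t \/ (s = 0 \/ s = 1) /\ (t = 0 \/ t = 1).
Proof.
rewrite !in_itv /= => /andP[s0 s1] /andP[t0 t1].
rewrite /disc_re /disc_im !pt2E !subrK !mulN1r.
have N0 (x : R) : (1 - x) ^+ 2 + x ^+ 2 != 0.
  by rewrite gt_eqF //; have := sqr_ge0 (1 - 2 * x); rewrite !expr2; lra.
(* the cosine and the sine of twice the argument of z *)
pose u (x : R) := ((1 - x) ^+ 2 - x ^+ 2) / ((1 - x) ^+ 2 + x ^+ 2).
pose v (x : R) := (2 * (1 - x) * x) / ((1 - x) ^+ 2 + x ^+ 2).
have uv (x : R) : u x ^+ 2 + v x ^+ 2 = 1 by rewrite /u /v; field.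
have e1 (x : R) : - (((1 - x) ^+ 2 - x ^+ 2) ^+ 2 - (2 * (1 - x) * x) ^+ 2) /
    ((1 - x) ^+ 2 + x ^+ 2) ^+ 2 = - (u x ^+ 2 - v x ^+ 2) by rewrite /u /v; field.
have e2 (x : R) : - (2 * ((1 - x) ^+ 2 - x ^+ 2) * (2 * (1 - x) * x)) /
    ((1 - x) ^+ 2 + x ^+ 2) ^+ 2 = - (2 * (u x * v x)) by rewrite /u /v; field.
rewrite !e1 !e2 => E1 E2.
have v0 (x : R) : 0 <= x -> x <= 1 -> 0 <= v x.
  move=> x0 x1; rewrite divr_ge0 //; last by rewrite addr_ge0 ?sqr_ge0.
  by rewrite !mulr_ge0 //; lra.
have vE : v s = v t.
  apply/eqP; rewrite -(@eqrXn2 _ 2) ?v0 //; apply/eqP.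
  by have := uv s; have := uv t; lra.
have [vt0|vt0] := eqVneq (v t) 0.
  right; have z (x : R) : v x = 0 -> x = 0 \/ x = 1.
    move=> /eqP; rewrite mulf_eq0 invr_eq0 (negPf (N0 x)) orbF !mulf_eq0.
    by case/orP=> [/orP[|]|] /eqP; [lra|right; lra|left].
  by split; apply: z; rewrite ?vE.
left; have uE : u s = u t.
  apply: (mulIf vt0); rewrite -{1}vE; lra.
have r1 (x : R) : x ^+ 2 / ((1 - x) ^+ 2 + x ^+ 2) = (1 - u x) / 2.
  by rewrite /u; field.
have r2 (x : R) : (1 - x) ^+ 2 / ((1 - x) ^+ 2 + x ^+ 2) = (1 + u x) / 2.
  by rewrite /u; field.
have sq : (s * (1 - t)) ^+ 2 = (t * (1 - s)) ^+ 2.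
  have h : (s ^+ 2 / ((1 - s) ^+ 2 + s ^+ 2)) * ((1 - t) ^+ 2 / ((1 - t) ^+ 2 + t ^+ 2)) =
           (t ^+ 2 / ((1 - t) ^+ 2 + t ^+ 2)) * ((1 - s) ^+ 2 / ((1 - s) ^+ 2 + s ^+ 2)).
    by rewrite !r1 !r2 uE; ring.
  have N1 := N0 s; have N2 := N0 t.
  have := congr1 (fun x => x * (((1 - s) ^+ 2 + s ^+ 2) * ((1 - t) ^+ 2 + t ^+ 2))) h.
  set Ns := (1 - s) ^+ 2 + s ^+ 2 in N1 *; set Nt := (1 - t) ^+ 2 + t ^+ 2 in N2 *.
  have -> : s ^+ 2 / Ns * ((1 - t) ^+ 2 / Nt) * (Ns * Nt) = (s * (1 - t)) ^+ 2.
    by field; apply/andP.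
  have -> // : t ^+ 2 / Nt * ((1 - s) ^+ 2 / Ns) * (Ns * Nt) = (t * (1 - s)) ^+ 2.
  by field; apply/andP.
have : s * (1 - t) = t * (1 - s).
  by apply/eqP; rewrite -(@eqrXn2 _ 2) ?mulr_ge0 ?subr_ge0 ?sq.
lra.
Qed.

(** The square root of a complex number of modulus one, by the half angle
    formulas. *)
Lemma unit_sqrt (x y : R) : x ^+ 2 + y ^+ 2 = 1 -> exists c s,
  [/\ 0 <= c, c ^+ 2 + s ^+ 2 = 1, c ^+ 2 - s ^+ 2 = x, 2 * c * s = y & (0 <= y -> 0 <= s)].
Proof.
move=> e; have x1 : -1 <= x <= 1 by rewrite -ler_norml -(@ler_pXn2r _ 2) ?nnegrE // real_normK ?num_real //; have := sqr_ge0 y; lra.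
have [xl xu] := andP x1.
pose c := Num.sqrt ((1 + x) / 2); pose s := Num.sqrt ((1 - x) / 2).
have c2 : c ^+ 2 = (1 + x) / 2 by rewrite sqr_sqrtr; lra.
have s2 : s ^+ 2 = (1 - x) / 2 by rewrite sqr_sqrtr; lra.
have c0 : 0 <= c by exact: sqrtr_ge0.
have s0 : 0 <= s by exact: sqrtr_ge0.
have cs : 2 * c * s = `|y|.
  apply/eqP; rewrite -(@eqrXn2 _ 2) ?mulr_ge0 //.
  by rewrite real_normK ?num_real // !exprMn c2 s2; apply/eqP; nra.
have [y0|y0] := leP 0 y.
  by exists c, s; split=> //; [lra|lra|rewrite cs ger0_norm].
exists c, (- s); split=> //; rewrite ?sqrrN ?mulrN ?cs ?(ltr0_norm y0) ?opprK; lra.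
Qed.

Lemma disc_loop_surj (x y : R) : x ^+ 2 + y ^+ 2 = 1 -> exists2 t, t \in `[0, 1]%R &
  disc_re (pt2 (1 - t) t) = x /\ disc_im (pt2 (1 - t) t) = y.
Proof.
move=> e; have [|u [v [_ uv1 uv2 uv3 _]]] := @unit_sqrt (- x) (- y).
  by rewrite !sqrrN.
have [u' [v' [v0 uv1' uv2' uv3']]] : exists u' v', [/\ 0 <= v', u' ^+ 2 + v' ^+ 2 = 1,
    u' ^+ 2 - v' ^+ 2 = - x & 2 * u' * v' = - y].
  have [v0|v0] := leP 0 v; first by exists u, v.
  by exists (- u), (- v); split; rewrite ?sqrrN //; [lra|rewrite -uv3; ring].
have [c [s [c0 cs1 cs2 cs3 /(_ v0) s0]]] := unit_sqrt uv1'.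
have S0 : 0 < c + s.
  rewrite lt_neqAle addr_ge0 // andbT eq_sym; apply/eqP => h.
  have c' : c = 0 by lra.
  have s' : s = 0 by lra.
  by move/eqP: cs1; rewrite c' s' expr0n /= addr0 eq_sym oner_eq0.
exists (s / (c + s)).
  by rewrite in_itv /= divr_ge0 ?(ltW S0) //= ler_pdivrMr // mul1r; lra.
have Sn : c + s != 0 by rewrite gt_eqF.
have E1 : 1 - s / (c + s) = c / (c + s) by field.
have N1 : (c / (c + s)) ^+ 2 + (s / (c + s)) ^+ 2 = ((c + s) ^+ 2)^-1.
  by rewrite !exprMn -mulrDl cs1 mul1r exprVn.
rewrite /disc_re /disc_im !pt2E subrK E1 N1.
have -> : (c / (c + s)) ^+ 2 - (s / (c + s)) ^+ 2 = u' / (c + s) ^+ 2.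
  by rewrite !exprMn -mulrBl cs2 exprVn.
have -> : 2 * (c / (c + s)) * (s / (c + s)) = v' / (c + s) ^+ 2.
  by rewrite -cs3; field.
split.
  have -> : x = - (u' ^+ 2 - v' ^+ 2) by rewrite uv2' opprK.
  by field.
have -> : y = - (2 * u' * v') by rewrite uv3' opprK.
by field.
Qed.

Lemma disc_center (x : 'rV[R]_2) (r : R) : 0 < r -> T x ->
  disc_re x = r -> disc_im x = 0 -> x = pt2 (r / 2) (r / 2).
Proof.
move=> r0 [x0 x1 _] er ei.
have xn : x != 0 by apply: contraTneq r0 => xz; rewrite -er xz disc0.1 ltxx.
have N0 := norm_sqr_neq0 xn.
(* the imaginary part vanishes on the two sides and the diagonal only *)
have S : x 0 0 + x 0 1 = r.
  apply/eqP; rewrite -(@eqrXn2 _ 2) ?addr_ge0 ?(ltW r0) //.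
  by rewrite -(disc_norm xn) er ei expr0n /= addr0.
move/eqP: ei; rewrite /disc_im S !mulf_eq0 invr_eq0 expf_eq0 /= (negPf N0) orbF.
rewrite oppr_eq0 (gt_eqF r0) /= pnatr_eq0 /=.
case/or3P=> [|/eqP x00|/eqP x10].
- rewrite subr_eq0 eqrXn2 // => /eqP e; rewrite -[LHS]pt2_eta.
  by congr pt2; lra.
- exfalso; move: er r0; rewrite /disc_re S x00 mulr0 mul0r expr0n /= subr0 => <-.
  rewrite mulNr mulNr oppr_gt0 ltNge mulr_ge0 // ?invr_ge0 ?sqr_ge0 // mulr_ge0 ?sqr_ge0 //.
  by rewrite -S x00; lra.
- exfalso; move: er r0; rewrite /disc_re S x10 mulr0 expr0n /= subr0 => <-.
  rewrite mulNr mulNr oppr_gt0 ltNge mulr_ge0 // ?invr_ge0 ?sqr_ge0 // mulr_ge0 ?sqr_ge0 //.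
  by rewrite -S x10; lra.
Qed.

Lemma disc_diagonal (r : R) : r != 0 -> disc_re (pt2 (r / 2) (r / 2)) = r /\
  disc_im (pt2 (r / 2) (r / 2)) = 0.
Proof.
move=> r0; rewrite /disc_re /disc_im !pt2E; split; last by rewrite subrr mulr0 mul0r mulr0 mul0r.
by field; rewrite -mulr2n mulrn_eq0 /= expf_eq0 /=.
Qed.

(** The differential in the direction v is the limit of the difference
    quotients, here given by k. *)
Lemma diff_along (f : 'rV[R]_2 -> R) (p v : 'rV[R]_2) (k : R -> R) (l : R) :
  differentiable f p -> k h @[h --> (0 : R)] --> l ->
  (forall h, f (h *: v + p) - f p = h * k h) -> 'd f p v = l.
Proof.
move=> fd kl fE; rewrite -deriveE //; apply: cvg_lim => //.
have kl' : k h @[h --> (0 : R)^'] --> l.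
  by apply: cvg_trans kl; apply: cvg_app; exact: cvg_within.
apply: cvg_trans kl'; apply: near_eq_cvg; rewrite near_withinE.
apply: nearW => h h0 /=; rewrite fE.
by rewrite -[_ *: _]/(h^-1 * (h * k h)) mulKf.
Qed.

Let diagonal_solve (u v A B a1 a2 b1 b2 : R) : A = (u + v) / 2 * a1 + (u - v) / 2 * a2 ->
  B = (u + v) / 2 * b1 + (u - v) / 2 * b2 -> a1 = 2 -> b1 = 0 -> b2 = - 8 ->
  A = 0 -> B = 0 -> u = 0 /\ v = 0.
Proof.
move=> -> -> -> -> -> h1 h2; have uv : u = v by lra.
by move: h1; rewrite uv subrr !mul0r addr0; split; lra.
Qed.

(** The differential is invertible on the diagonal: in the directions of the
    diagonal and across it the Jacobian is triangular, with entries 2 and - 8. *)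
Lemma disc_diff_inj (r : R) w : 0 < r ->
  'd disc_re (pt2 r r) w = 0 -> 'd disc_im (pt2 r r) w = 0 -> w = 0.
Proof.
move=> r0; have rn : r != 0 by rewrite gt_eqF.
have p0 : pt2 r r != 0.
  by apply: contraNneq rn => p0; rewrite -(pt2E0 r r) p0 mxE.
have [dr di] := disc_differentiable p0.
have e1 : 'd disc_re (pt2 r r) (pt2 1 1) = 2.
  apply: (diff_along (k := fun=> 2) dr); first exact: cvg_cst.
  move=> h; have -> : h *: pt2 1 1 + pt2 r r = pt2 (h + r) (h + r).
    by apply/rowP => i; rewrite !mxE; case: ifP => _; ring.
  have D s : disc_re (pt2 s s) = 2 * s.
    have [->|s0] := eqVneq s 0.
      by rewrite /disc_re !pt2E addr0 oppr0 !mul0r mulr0.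
    have E : 2 * s / 2 = s by field.
    have s20 : 2 * s != 0 by rewrite mulf_neq0.
    by have [] := disc_diagonal s20; rewrite E.
  by rewrite !D; ring.
have e2 : 'd disc_im (pt2 r r) (pt2 1 1) = 0.
  apply: (diff_along (k := fun=> 0) di); first exact: cvg_cst.
  move=> h; have -> : h *: pt2 1 1 + pt2 r r = pt2 (h + r) (h + r).
    by apply/rowP => i; rewrite !mxE; case: ifP => _; ring.
  have D s : disc_im (pt2 s s) = 0.
    by rewrite /disc_im !pt2E subrr !(mulr0, mul0r).
  by rewrite !D subrr mulr0.
have e3 : 'd disc_im (pt2 r r) (pt2 1 (-1)) = - 8.
  pose k (h : R) := - (8 * r ^+ 2 * (r ^+ 2 - h ^+ 2)) * ((r ^+ 2 + h ^+ 2) ^+ 2)^-1.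
  have k0 : k 0 = -8.
    by rewrite /k expr0n /= subr0 addr0; field.
  apply: (diff_along (k := k) di).
    have sq : (fun h : R => h ^+ 2) h @[h --> (0 : R)] --> (0 : R) ^+ 2.
      by have := @exprn_continuous R 2 0.
    rewrite -k0; apply: cvgM.
      by apply: cvgN; apply: cvgMr; apply: cvgB => //; exact: cvg_cst.
    apply: cvgV; first by rewrite expr0n /= addr0 !expf_neq0.
    have c : r ^+ 2 + h ^+ 2 @[h --> (0 : R)] --> r ^+ 2 + (0 : R) ^+ 2.
      by apply: cvgD => //; exact: cvg_cst.
    rewrite expr2; under eq_fun do rewrite expr2.
    by apply: cvgM; exact: c.
  move=> h; have -> : h *: pt2 1 (-1) + pt2 r r = pt2 (r + h) (r - h).
    by apply/rowP => i; rewrite !mxE; case: ifP => _; ring.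
  have rh : r ^+ 2 + h ^+ 2 != 0.
    by rewrite gt_eqF // ltr_wpDr ?sqr_ge0 // exprn_gt0.
  have rh2 : (r + h) ^+ 2 + (r - h) ^+ 2 != 0.
    have -> : (r + h) ^+ 2 + (r - h) ^+ 2 = 2 * (r ^+ 2 + h ^+ 2) by ring.
    by rewrite mulf_neq0.
  have -> : disc_im (pt2 r r) = 0 by rewrite /disc_im !pt2E subrr !(mulr0, mul0r).
  by rewrite subr0 /disc_im !pt2E /k; field; apply/andP.
have wE (f : 'rV[R]_2 -> R) : 'd f (pt2 r r) w =
    (w 0 0 + w 0 1) / 2 * 'd f (pt2 r r) (pt2 1 1) +
    (w 0 0 - w 0 1) / 2 * 'd f (pt2 r r) (pt2 1 (-1)).
  have E : w = ((w 0 0 + w 0 1) / 2) *: pt2 1 1 + ((w 0 0 - w 0 1) / 2) *: pt2 1 (-1).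
    by rewrite -{1}[w]pt2_eta; apply/rowP => i; rewrite !mxE; case: ifP => _; field.
  by rewrite {1}E linearD linearZ linearZ.
move=> E1 E2; have [w0 w1] := diagonal_solve (wE disc_re) (wE disc_im) e1 e2 e3 E1 E2.
by rewrite -[w]pt2_eta w0 w1; apply/rowP => i; rewrite !mxE; case: ifP.
Qed.

End DiscChart.

(** * The disc bounded by the ellipse *)

Section SpanningDisc.
Context {R : realType}.
Local Notation z3 := (ord_max : 'I_3).
Local Notation T := (triangle R).

Lemma diff_sqr (V : normedModType R) (f : V -> R) (x u : V) : differentiable f x ->
  'd (fun y => f y ^+ 2) x u = 2 * f x * 'd f x u.
Proof.
move=> df; have -> : (fun y => f y ^+ 2) = f * f.
  by apply/funext => y; rewrite expr2.
have dE := congr1 (fun D : V -> R => D u) (diffM df df).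
apply: (etrans dE); rewrite -[LHS]/(f x * 'd f x u + f x * 'd f x u).
by rewrite -mulrA mulr_natl mulr2n.
Qed.

Variables (a c : R) (h0 : 'rV[R]_3) (M : 'M[R]_3).
Hypotheses (ca : 0 < c < a) (Mu : M \in unitmx).
Local Notation A := (affine_coord h0 M).
Local Notation K := (A @^-1` focal_ellipse a c).
Local Notation L := (A @^-1` focal_branch a c).

Let c0 : 0 < c. Proof. by case/andP: ca. Qed.
Let a0 : 0 < a. Proof. by case/andP: ca => *; lra. Qed.
Let ca2 : c ^+ 2 < a ^+ 2. Proof. by case/andP: ca => *; nra. Qed.
Let b0 : 0 < a ^+ 2 - c ^+ 2. Proof. by rewrite subr_gt0. Qed.

(** A polynomial equation, valid in the half space that contains the branch,
    so that the Jacobian has an explicit continuous formula. *)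
Definition branch_equation (h : 'rV[R]_3) : 'rV[R]_2 :=
  A h 0 1 *: pt2 1 0 +
  (A h 0 z3 ^+ 2 * (c ^+ 2)^-1 - A h 0 0 ^+ 2 * (a ^+ 2 - c ^+ 2)^-1 - 1) *: pt2 0 1.

Definition branch_equation_jacobian (h : 'rV[R]_3) : 'M[R]_(3, 2) :=
  col 1 M *m pt2 1 0 + ((2 * A h 0 z3 * (c ^+ 2)^-1) *: (col z3 M *m pt2 0 1) -
  (2 * A h 0 0 * (a ^+ 2 - c ^+ 2)^-1) *: (col 0 M *m pt2 0 1)).

Let mulmx_col (u : 'rV[R]_3) k (w : 'rV[R]_2) : u *m (col k M *m w) = (u *m M) 0 k *: w.
Proof.
rewrite mulmxA; apply/rowP => i; rewrite [in LHS]mxE big_ord1 [in RHS]mxE; congr (_ * _).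
by rewrite !mxE; apply: eq_bigr => j _; rewrite mxE.
Qed.

Lemma branch_equation_diff h : differentiable branch_equation h /\
  jacobian branch_equation h = branch_equation_jacobian h.
Proof.
have dA k := affine_coord_diff h0 M k h.
have d2 k : differentiable (fun h => A h 0 k ^+ 2) h by apply: differentiable_sqr; exact: (dA k).1.
have dz : differentiable (fun h => A h 0 z3 ^+ 2 * (c ^+ 2)^-1) h.
  by apply: differentiableM => //; exact: differentiable_cst.
have dx : differentiable (fun h => A h 0 0 ^+ 2 * (a ^+ 2 - c ^+ 2)^-1) h.
  by apply: differentiableM => //; exact: differentiable_cst.
have dzx := differentiableB dz dx.
have d1 : differentiable (cst 1 : 'rV[R]_3 -> R) h by exact: differentiable_cst.
have dq := differentiableB dzx d1.
have dv1 := differentiableZl (pt2 1 0) (dA 1).1.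
have dv2 := differentiableZl (pt2 0 1) dq.
have dF : differentiable branch_equation h by exact: (differentiableD dv1 dv2).
split=> //; apply/row_matrixP => i; rewrite !rowE mul_rV_lin1.
move: (delta_mx 0 i) => u.
have e1 := congr1 (fun D : 'rV[R]_3 -> 'rV[R]_2 => D u) (diffD dv1 dv2).
apply: (etrans e1).
have e2 := congr1 (fun D : 'rV[R]_3 -> 'rV[R]_2 => D u) (diffZl (pt2 1 0) (dA 1).1).
have e3 := congr1 (fun D : 'rV[R]_3 -> 'rV[R]_2 => D u) (diffZl (pt2 0 1) dq).
have e4 := congr1 (fun D : 'rV[R]_3 -> R => D u) (diffB dzx d1).
have e5 := congr1 (fun D : 'rV[R]_3 -> R => D u) (diffB dz dx).
have e6 := congr1 (fun D : 'rV[R]_3 -> R => D u) (@diff_cst _ _ _ (1 : R) h).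
have cM (k : 'I_3) (r : R) : 'd (fun h => A h 0 k ^+ 2 * r) h u = (2 * A h 0 k * r) * (u *m M) 0 k.
  have dr : differentiable (cst r : 'rV[R]_3 -> R) h by exact: differentiable_cst.
  have e := congr1 (fun D : 'rV[R]_3 -> R => D u) (diffM (d2 k) dr).
  have er := congr1 (fun D : 'rV[R]_3 -> R => D u) (@diff_cst _ _ _ r h).
  apply: (etrans e).
  transitivity (A h 0 k ^+ 2 * 'd (cst r : 'rV[R]_3 -> R) h u + r * 'd (fun h => A h 0 k ^+ 2) h u) => //.
  rewrite [X in _ * X + _]er mulr0 add0r (diff_sqr u (dA k).1).
  have -> : 'd (fun h => A h 0 k) h u = (u *m M) 0 k.
    exact: (congr1 (fun D : 'rV[R]_3 -> R => D u) (dA k).2).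
  by ring.
rewrite /branch_equation_jacobian mulmxDr mulmxBr -!scalemxAr !mulmx_col.
apply: (etrans (congr2 +%R e2 e3)); congr (_ + _).
  congr (_ *: _); exact: (congr1 (fun D : 'rV[R]_3 -> R => D u) (dA 1).2).
rewrite !scalerA -scalerBl; congr (_ *: _).
apply: (etrans e4); apply: (etrans (congr2 (fun p q => p - q) e5 e6)); rewrite subr0.
by apply: (congr2 (fun p q => p - q)); exact: cM.
Qed.

Lemma branch_equation_C1 h : C1_near branch_equation h.
Proof.
rewrite /C1_near; near=> y; split; first by have [] := branch_equation_diff y.
have -> : jacobian branch_equation = branch_equation_jacobian.
  by apply/funext => x; have [] := branch_equation_diff x.
have cA k : {for y, continuous (fun h => A h 0 k)}.
  by apply: differentiable_continuous; exact: (affine_coord_diff h0 M k y).1.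
have scal k (r : R) : (fun h : 'rV[R]_3 => 2 * A h 0 k * r : R) @ y --> 2 * A y 0 k * r.
  apply: (@cvgM R _ (nbhs y) _ (fun h : 'rV[R]_3 => 2 * A h 0 k : R) (fun=> r)); last exact: cvg_cst.
  by apply: (@cvgM R _ (nbhs y) _ (fun=> 2) (fun h : 'rV[R]_3 => A h 0 k : R)); [exact: cvg_cst|exact: cA].
have term k (r : R) (N : 'M[R]_(3, 2)) : (fun h : 'rV[R]_3 => (2 * A h 0 k * r) *: N) @ y --> (2 * A y 0 k * r) *: N.
  exact: (cvgZr_tmp (scal k r)).
exact: (cvgD (cvg_cst _) (cvgB (term z3 _ _) (term 0 _ _))).
Unshelve. all: by end_near.
Qed.

Lemma branch_equation_zero h : 0 < A h 0 z3 -> L h <-> branch_equation h = 0.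
Proof.
move=> z0.
have E : branch_equation h = pt2 (A h 0 1)
    (A h 0 z3 ^+ 2 / c ^+ 2 - A h 0 0 ^+ 2 / (a ^+ 2 - c ^+ 2) - 1).
  rewrite /branch_equation; move: (A h 0 1) (_ - 1) => u v.
  by apply/rowP => i; rewrite !mxE; case: ifP => _; ring.
split=> [[y0 _ e]|h0'].
  by rewrite E y0 e subrr; apply/rowP => i; rewrite !mxE; case: ifP.
split=> //; first by rewrite -[LHS](pt2E0 _ (A h 0 z3 ^+ 2 / c ^+ 2 - A h 0 0 ^+ 2 / (a ^+ 2 - c ^+ 2) - 1)) -E h0' mxE.
apply/eqP; rewrite -subr_eq0; apply/eqP.
by rewrite -[LHS](pt2E1 (A h 0 1)) -E h0' mxE.
Qed.

Local Notation b := (Num.sqrt (a ^+ 2 - c ^+ 2)).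

Let b_gt0 : 0 < b. Proof. by rewrite sqrtr_gt0. Qed.
Let b_sqr : b ^+ 2 = a ^+ 2 - c ^+ 2. Proof. by rewrite sqr_sqrtr // ltW. Qed.

(** The affine image of the unit disc that is bounded by the ellipse. *)
Definition disc_chart (x : 'rV[R]_2) : 'rV[R]_3 :=
  affine_point h0 M (row3 0 (b * disc_im x) (a * disc_re x)).

Lemma disc_chartK x : A (disc_chart x) = row3 0 (b * disc_im x) (a * disc_re x).
Proof. exact: affine_pointK. Qed.

Lemma disc_chartE : disc_chart = (fun x => disc_im x *: (b *: row 1 (invmx M))) +
   ((fun x => disc_re x *: (a *: row z3 (invmx M))) + cst h0).
Proof.
apply/funext => x; rewrite /disc_chart /affine_point !fctE addrA; congr (_ + _).
by apply/rowP => k; rewrite mulmx_rV3 !row3E !mxE; ring.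
Qed.

Lemma disc_chart_differentiable x : x != 0 -> differentiable disc_chart x.
Proof.
move=> x0; have [dr di] := disc_differentiable x0.
rewrite disc_chartE; apply: differentiableD; first exact: differentiableZl.
by apply: differentiableD; [exact: differentiableZl|exact: differentiable_cst].
Qed.

Lemma disc_chart_continuous : continuous disc_chart.
Proof.
move=> x; rewrite disc_chartE; have [cr ci] := @disc_continuous R.
exact: (cvgD (cvgZr_tmp (ci x)) (cvgD (cvgZr_tmp (cr x)) (cvg_cst _))).
Qed.

Lemma disc_chart_ellipse x : K (disc_chart x) <-> disc_re x ^+ 2 + disc_im x ^+ 2 = 1.
Proof.
rewrite /= disc_chartK /focal_ellipse /= !row3E.
move: b_sqr b_gt0; set B := b => <- B0.
have q (r u : R) : 0 < r -> (r * u) ^+ 2 / r ^+ 2 = u ^+ 2.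
  by move=> r0; field; rewrite gt_eqF.
rewrite !q // addrC.
by split=> [[]|].
Qed.

Lemma disc_chart_inj x y : disc_chart x = disc_chart y ->
  disc_re x = disc_re y /\ disc_im x = disc_im y.
Proof.
move=> /(congr1 (affine_coord h0 M)); rewrite !disc_chartK => e.
have [_ e1 e2] := And3 I (congr1 (fun v : 'rV[R]_3 => v 0 1) e) (congr1 (fun v : 'rV[R]_3 => v 0 z3) e).
rewrite !row3E in e1 e2; split.
  by apply: (mulfI (_ : a != 0)) => //; rewrite gt_eqF.
by apply: (mulfI (_ : b != 0)) => //; rewrite gt_eqF.
Qed.

(** The plane of the disc meets the branch at its vertex, the focus. *)
Lemma disc_chart_crossing x : T x -> L (disc_chart x) <-> x = pt2 (c / a / 2) (c / a / 2).
Proof.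
have r0 : 0 < c / a by rewrite divr_gt0.
have rn : c / a != 0 by rewrite gt_eqF.
move=> Tx; rewrite /= disc_chartK /focal_branch /= !row3E expr0n /= mul0r subr0.
split=> [[/eqP y0 z0 e]|->].
  apply: disc_center => //; last by move: y0; rewrite mulf_eq0 (gt_eqF b_gt0) => /eqP.
  have c2 : c ^+ 2 != 0 by rewrite expf_neq0 // gt_eqF.
  have : (a * disc_re x) ^+ 2 = c ^+ 2 by rewrite -[LHS](divfK c2) e mul1r.
  move/eqP; rewrite eqrXn2 ?(ltW z0) ?(ltW c0) // => /eqP <-.
  by rewrite mulrAC divff ?mul1r // gt_eqF.
have [-> ->] := disc_diagonal rn; rewrite mulr0 mulrCA divff ?gt_eqF // mulr1.
by split=> //; rewrite divff // expf_neq0 // gt_eqF.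
Qed.

(** The disc lies in the plane of the ellipse, which the branch crosses
    orthogonally at its vertex. *)
Lemma disc_chart_transversal : transversal_at disc_chart L (pt2 (c / a / 2) (c / a / 2)).
Proof.
set p := pt2 _ _.
have r0 : 0 < c / a by rewrite divr_gt0.
have rn : c / a != 0 by rewrite gt_eqF.
have r1 : c / a < 1 by rewrite ltr_pdivrMr // mul1r; case/andP: ca.
have r20 : 0 < c / a / 2 by lra.
have p0 : p != 0.
  by apply: contraTneq r20 => e; rewrite -(pt2E0 (c / a / 2) (c / a / 2)) -/p e mxE ltxx.
have [er ei] : disc_re p = c / a /\ disc_im p = 0 by exact: disc_diagonal.
have Ap : A (disc_chart p) = row3 0 0 c.
  by rewrite disc_chartK er ei mulr0 mulrCA divff ?gt_eqF // mulr1.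
have ds := disc_chart_differentiable p0.
split=> //.
  have : nbhs p (ball p (Num.min (c / a / 2) ((1 - c / a) / 2))).
    by apply: nbhsx_ballx; rewrite lt_min r20 /=; lra.
  apply: filterS => x; rewrite -ball_normE /ball_ /= lt_min => /andP[l1 l2].
  have [a1 a2] := (norm_rV2_le (p - x) _).1 (ltW l1).
  have [a3 a4] := (norm_rV2_le (p - x) _).1 (ltW l2).
  move: a1 a2 a3 a4; rewrite !mxE /= !ler_norml.
  move=> /andP[_ u1] /andP[_ u2] /andP[u3 _] /andP[u4 _].
  by split; lra.
exists branch_equation; split.
- exact: branch_equation_C1.
- have zc : {for disc_chart p, continuous (fun h => A h 0 z3)}.
    by apply: differentiable_continuous; exact: (affine_coord_diff h0 M z3 _).1.
  have zp : 0 < A (disc_chart p) 0 z3 by rewrite Ap row3E.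
  have pos : nbhs (A (disc_chart p) 0 z3) [set r | 0 < r].
    by apply: open_nbhs_nbhs; split; [exact: open_gt|exact: zp].
  have : nbhs (disc_chart p) (fun h => 0 < A h 0 z3) by exact: (zc _ pos).
  by apply: filterS => h; exact: branch_equation_zero.
have [dF JF] := branch_equation_diff (disc_chart p).
rewrite unitmxE unitfE; apply/det0P => -[w w0 wJ].
have dE := congr1 (fun D : 'rV[R]_2 -> 'rV[R]_2 => D w) (diff_comp ds dF).
pose u : 'rV[R]_3 := 'd disc_chart p w.
have Fu : u *m branch_equation_jacobian (disc_chart p) = 0.
  rewrite -JF /jacobian mul_rV_lin1 -wJ /jacobian mul_rV_lin1.
  exact: (esym dE).
rewrite /branch_equation_jacobian mulmxDr mulmxBr -!scalemxAr !mulmx_col Ap !row3E in Fu.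
rewrite mulr0 mul0r scale0r subr0 in Fu.
have u1 : (u *m M) 0 1 = 0.
  by have := congr1 (fun v : 'rV[R]_2 => v 0 0) Fu; rewrite !mxE /= mulr1 !mulr0 addr0.
have u2 : (u *m M) 0 z3 = 0.
  have := congr1 (fun v : 'rV[R]_2 => v 0 1) Fu; rewrite !mxE /= mulr0 add0r mulr1.
  by move/eqP; rewrite !mulf_eq0 invr_eq0 expf_eq0 /= (gt_eqF c0) pnatr_eq0 /= => /eqP.
have [dr di] := disc_differentiable p0.
have [_ x1] := diff_affine_comp h0 M 1 w ds.
have [_ x2] := diff_affine_comp h0 M z3 w ds.
have dcoord (f : 'rV[R]_2 -> R) (r : R) : differentiable f p -> r != 0 ->
    'd (fun y => r * f y) p w = 0 -> 'd f p w = 0.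
  move=> df rz0; have e := congr1 (fun D : 'rV[R]_2 -> R => D w) (diffZ r df).
  by move=> /(etrans (esym e)) /eqP; rewrite -[X in X == _]/(r * 'd f p w) mulf_eq0 (negPf rz0) => /eqP.
have E1 : (fun y => A (disc_chart y) 0 1) = (fun y => b * disc_im y).
  by apply/funext => y; rewrite disc_chartK row3E.
have E2 : (fun y => A (disc_chart y) 0 z3) = (fun y => a * disc_re y).
  by apply/funext => y; rewrite disc_chartK row3E.
rewrite E1 in x1; rewrite E2 in x2.
move/eqP: w0; apply; apply: (disc_diff_inj r20).
  by apply: (dcoord _ a) => //; [rewrite gt_eqF|rewrite x2].
by apply: (dcoord _ b) => //; [rewrite gt_eqF|rewrite x1].
Qed.

(** The two sides of the triangle that meet at the origin give the same path
    and cancel modulo 2; the opposite edge is the ellipse, as a single loop. *)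
Lemma disc_spanning_chain : exists n (c' : chain2 R n), spanning_chain c' K L.
Proof.
exists 1%N, (fun=> disc_chart); split.
- by move=> _; apply: continuous_subspaceT; exact: disc_chart_continuous.
- exists 1%N, (fun=> face disc_chart 0).
  have loopE t : face disc_chart 0 t = disc_chart (pt2 (1 - t) t) by [].
  have sides : face disc_chart 1 = face disc_chart ord_max.
    apply/funext => t; rewrite /face /= /disc_chart.
    by have [-> ->] := disc_sides t.
  have unit_loop (t : R) : pt2 (1 - t) t != 0 /\ (1 - t + t) ^+ 2 = 1.
    split; last by rewrite subrK expr1n.
    apply/eqP => e; have := pt2E0 (1 - t) t; have := pt2E1 (1 - t) t.
    by rewrite e !mxE => <-; rewrite subr0 => /esym /eqP; rewrite oner_eq0.
  split; first split.
  + move=> _; apply: continuous_subspaceT => t.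
    by apply: (@continuous_comp _ _ _ (edge 0) disc_chart);
      [exact: edge_continuous|exact: disc_chart_continuous].
  + move=> i j s t s01 t01; rewrite !ord1 !loopE => /disc_chart_inj[e1 e2].
    by have [->|] := disc_loop_inj s01 t01 e1 e2; [left|right].
  + apply/seteqP; split=> [h Kh|h [_ _ [t _ <-]]]; last first.
      have [xn e] := unit_loop t.
      by apply/disc_chart_ellipse; rewrite (disc_norm xn) !pt2E.
    have [x0 e] := Kh.
    have [|t t01 [e1 e2]] := @disc_loop_surj R (A h 0 z3 / a) (A h 0 1 / b).
      by rewrite !exprMn !exprVn b_sqr addrC.
    exists 0 => //; exists t => //; apply: (affine_coord_inj (h0 := h0) Mu).
    rewrite loopE disc_chartK e1 e2 [RHS]row3_eta x0.
    by congr row3; rewrite mulrC divfK // gt_eqF.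
  + move=> tau; rewrite /boundary_coef big_ord1 !big_ord_recr big_ord0 /= add0n.
    have -> : widen_ord (leqnSn 2) (widen_ord (leqnSn 1) ord_max) = 0 by exact/val_inj.
    have -> : widen_ord (leqnSn 2) ord_max = 1 by exact/val_inj.
    rewrite sides -addnA addnn oddD odd_double addbF oddb.
    by split=> [/asboolP|[_]]; [exists 0|move=> ?; apply/asboolP].
- move=> i.
  have cE : crossings disc_chart L = [set pt2 (c / a / 2) (c / a / 2)].
    apply/seteqP; split=> [x [Tx /(disc_chart_crossing Tx) //]|x ->].
    have Tp : T (pt2 (c / a / 2) (c / a / 2)).
      by apply: inside_triangle; apply: interior_triangle; have [] := disc_chart_transversal.
    by split=> //; apply/(disc_chart_crossing Tp).
  rewrite cE; split=> [|p ->]; first exact: finite_set1.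
  exact: disc_chart_transversal.
Qed.

Lemma focal_odd_linking : odd_linking K L.
Proof. by split; [exact: disc_spanning_chain|exact: focal_odd_intersection]. Qed.

End SpanningDisc.

(** * Symmetric 4 x 4 matrices as 3 x 3 matrices *)

Section CharPoly.
Context {R : realType}.
Local Notation z3 := (ord_max : 'I_3).

Lemma det_fun2 (f : nat -> nat -> R) : \det (\matrix_(i < 2, j < 2) f i j) =
  f 0 0 * f 1 1 - f 0 1 * f 1 0.
Proof.
by rewrite (expand_det_row _ ord0) !big_ord_recl big_ord0 /cofactor !det_mx11 !mxE /=; ring.
Qed.

Lemma det_fun3 (f : nat -> nat -> R) : \det (\matrix_(i < 3, j < 3) f i j) =
  f 0 0 * (f 1 1 * f 2 2 - f 1 2 * f 2 1) - f 0 1 * (f 1 0 * f 2 2 - f 1 2 * f 2 0) +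
  f 0 2 * (f 1 0 * f 2 1 - f 1 1 * f 2 0).
Proof.
have minor (j : 'I_3) : row' ord0 (col' j (\matrix_(i < 3, j < 3) f i j)) =
    \matrix_(i < 2, k < 2) f i.+1 (bump j k).
  by apply/matrixP => i k; rewrite !mxE.
rewrite (expand_det_row _ ord0) !big_ord_recl big_ord0 /cofactor !minor.
by rewrite !(det_fun2 (fun i k => f i.+1 (bump _ k))) !mxE /=; ring.
Qed.

Lemma det_fun4 (f : nat -> nat -> R) : \det (\matrix_(i < 4, j < 4) f i j) =
  f 0 0 * (f 1 1 * (f 2 2 * f 3 3 - f 2 3 * f 3 2) - f 1 2 * (f 2 1 * f 3 3 - f 2 3 * f 3 1) +
           f 1 3 * (f 2 1 * f 3 2 - f 2 2 * f 3 1)) -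
  f 0 1 * (f 1 0 * (f 2 2 * f 3 3 - f 2 3 * f 3 2) - f 1 2 * (f 2 0 * f 3 3 - f 2 3 * f 3 0) +
           f 1 3 * (f 2 0 * f 3 2 - f 2 2 * f 3 0)) +
  f 0 2 * (f 1 0 * (f 2 1 * f 3 3 - f 2 3 * f 3 1) - f 1 1 * (f 2 0 * f 3 3 - f 2 3 * f 3 0) +
           f 1 3 * (f 2 0 * f 3 1 - f 2 1 * f 3 0)) -
  f 0 3 * (f 1 0 * (f 2 1 * f 3 2 - f 2 2 * f 3 1) - f 1 1 * (f 2 0 * f 3 2 - f 2 2 * f 3 0) +
           f 1 2 * (f 2 0 * f 3 1 - f 2 1 * f 3 0)).
Proof.
have minor (j : 'I_4) : row' ord0 (col' j (\matrix_(i < 4, j < 4) f i j)) =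
    \matrix_(i < 3, k < 3) f i.+1 (bump j k).
  by apply/matrixP => i k; rewrite !mxE.
rewrite (expand_det_row _ ord0) !big_ord_recl big_ord0 /cofactor !minor.
by rewrite !(det_fun3 (fun i k => f i.+1 (bump _ k))) !mxE /=; ring.
Qed.

(** The symmetric matrix of trace 4 t whose traceless part corresponds to the
    3 x 3 matrix with rows v, p, q, under the isomorphism of the traceless
    symmetric 4 x 4 matrices with the tensor product of the two factors of
    so(4).  The matrices of i su(2) are those with t, p and q zero. *)
Definition quaternion_entry (t : R) (v p q : 'rV[R]_3) (i j : nat) : R :=
  match i, j with
  | 0%N, 0%N => t + v 0 z3 + (p 0 1 - q 0 0) | 0%N, 1%N => v 0 0 + q 0 z3
  | 0%N, 2%N => p 0 0 + q 0 1 | 0%N, _ => v 0 1 - p 0 z3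
  | 1%N, 0%N => v 0 0 + q 0 z3 | 1%N, 1%N => t - v 0 z3 + (p 0 1 + q 0 0)
  | 1%N, 2%N => - v 0 1 - p 0 z3 | 1%N, _ => q 0 1 - p 0 0
  | 2%N, 0%N => p 0 0 + q 0 1 | 2%N, 1%N => - v 0 1 - p 0 z3
  | 2%N, 2%N => t + v 0 z3 - (p 0 1 - q 0 0) | 2%N, _ => v 0 0 - q 0 z3
  | _, 0%N => v 0 1 - p 0 z3 | _, 1%N => q 0 1 - p 0 0
  | _, 2%N => v 0 0 - q 0 z3 | _, _ => t - v 0 z3 - (p 0 1 + q 0 0)
  end.

Definition quaternion_mx t v p q : 'M[R]_4 := \matrix_(i, j) quaternion_entry t v p q i j.

Definition dot (u v : 'rV[R]_3) : R := u 0 0 * v 0 0 + u 0 1 * v 0 1 + u 0 z3 * v 0 z3.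

Definition triple (u v w : 'rV[R]_3) : R :=
  u 0 0 * (v 0 1 * w 0 z3 - v 0 z3 * w 0 1) +
  u 0 1 * (v 0 z3 * w 0 0 - v 0 0 * w 0 z3) +
  u 0 z3 * (v 0 0 * w 0 1 - v 0 1 * w 0 0).

(** The trace and the sum of the principal 2 x 2 minors of the Gram matrix of
    v, p, q, whose determinant is triple v p q ^ 2. *)
Definition gram1 (v p q : 'rV[R]_3) : R := dot v v + dot p p + dot q q.
Definition gram2 (v p q : 'rV[R]_3) : R :=
  (dot v v * dot p p - dot v p ^+ 2) + (dot v v * dot q q - dot v q ^+ 2) +
  (dot p p * dot q q - dot p q ^+ 2).

Lemma horner_char_poly n (S : 'M[R]_n) x : (char_poly S).[x] = \det (x%:M - S).
Proof.
rewrite /char_poly -[_.[x]]/(horner_eval x _) -det_map_mx; congr (\det _).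
apply/matrixP => i j; rewrite !mxE /= /horner_eval hornerD hornerN hornerC.
by rewrite hornerMn hornerX.
Qed.

(** The characteristic polynomial only depends on the Gram matrix and the
    determinant of the 3 x 3 matrix. *)
Lemma quaternion_char_poly t v p q x : (char_poly (quaternion_mx t v p q)).[t + x] =
  x ^+ 4 - 2 * gram1 v p q * x ^+ 2 - 8 * triple v p q * x +
  (gram1 v p q ^+ 2 - 4 * gram2 v p q).
Proof.
rewrite horner_char_poly.
have -> : (t + x)%:M - quaternion_mx t v p q =
    \matrix_(i < 4, j < 4) ((t + x) *+ (i == j :> nat) - quaternion_entry t v p q i j).
  by apply/matrixP => i j; rewrite !mxE.
rewrite (det_fun4 (fun i j => (t + x) *+ (i == j) - quaternion_entry t v p q i j)) /=.
rewrite !mulr1n !mulr0n /gram1 /gram2 /triple /dot.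
move: (v 0 0) (v 0 1) (v 0 z3) (p 0 0) (p 0 1) (p 0 z3) (q 0 0) (q 0 1) (q 0 z3).
by move=> v0 v1 v2 p0 p1 p2 q0 q1 q2; ring.
Qed.

End CharPoly.

(** * Eigenvalues and singular values *)

Section SingularValues.
Context {R : realType}.
Local Notation z3 := (ord_max : 'I_3).
Implicit Types (u v p q : 'rV[R]_3).

Lemma ord2P (i : 'I_2) : i = 0 \/ i = 1.
Proof. by case: i => [[|[|//]] hi]; [left|right]; exact/val_inj. Qed.

Lemma real_mx_pauli (h : 'rV[R]_3) : real_mx (pauli h) = quaternion_mx 0 h 0 0 :> 'M[R]_4.
Proof.
have E (i j : 'I_(2 + 2)) : real_mx (pauli h) i j = quaternion_entry 0 h 0 0 i j.
  case: (split_ordP i) => {}i ->; case: (split_ordP j) => {}j ->;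
    case: (ord2P i) => ->; case: (ord2P j) => ->;
    rewrite /real_mx ?block_mxEul ?block_mxEur ?block_mxEdl ?block_mxEdr !mxE /=;
    rewrite ?mxE /=; ring.
by apply/matrixP => i j; rewrite [RHS]mxE; exact: E.
Qed.

Lemma quaternion_mxD t v p q t' v' p' q' :
  quaternion_mx (t + t') (v + v') (p + p') (q + q') =
  quaternion_mx t v p q + quaternion_mx t' v' p' q'.
Proof.
apply/matrixP => i j; rewrite !mxE.
case: i j => [[|[|[|[|//]]]] hi] [[|[|[|[|//]]]] hj] /=; rewrite !mxE; ring.
Qed.

Definition mean_trace (S : 'M[R]_4) : R := \tr S / 4.

(** The three rows below are the inverse of the linear map [quaternion_mx]. *)
Definition quaternion_row1 (S : 'M[R]_4) : 'rV[R]_3 :=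
  let s i j := S (inord i) (inord j) in
  row3 ((s 0 1 + s 2 3) / 2) ((s 0 3 - s 1 2) / 2) ((s 0 0 - s 1 1 + s 2 2 - s 3 3) / 4).

Definition quaternion_row2 (S : 'M[R]_4) : 'rV[R]_3 :=
  let s i j := S (inord i) (inord j) in
  row3 ((s 0 2 - s 1 3) / 2) ((s 0 0 - s 2 2 + s 1 1 - s 3 3) / 4) (- (s 0 3 + s 1 2) / 2).

Definition quaternion_row3 (S : 'M[R]_4) : 'rV[R]_3 :=
  let s i j := S (inord i) (inord j) in
  row3 ((s 1 1 - s 3 3 - s 0 0 + s 2 2) / 4) ((s 0 2 + s 1 3) / 2) ((s 0 1 - s 2 3) / 2).

Lemma symmetric_quaternion_mx (S : 'M[R]_4) : S \is symmetricmx ->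
  S = quaternion_mx (mean_trace S) (quaternion_row1 S) (quaternion_row2 S) (quaternion_row3 S).
Proof.
move=> /is_hermitianmxP; rewrite expr0 scale1r map_mx_id // => symS.
pose s i j := S (inord i) (inord j).
have SE (i j : 'I_4) : S i j = s i j by rewrite /s !inord_val.
have sC i j : s i j = s j i by rewrite /s {1}symS mxE.
have trE : mean_trace S = (s 0 0 + s 1 1 + s 2 2 + s 3 3) / 4.
  rewrite /mean_trace /mxtrace !big_ord_recl big_ord0 !SE /=.
  by rewrite /bump /= !addn0 !add1n !addrA addr0.
apply/matrixP => i j; rewrite SE mxE trE /quaternion_entry /quaternion_row1
  /quaternion_row2 /quaternion_row3 !row3E -/s.
have := sC 1 0; have := sC 2 0; have := sC 3 0; have := sC 2 1; have := sC 3 1; have := sC 3 2.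
case: i j => [[|[|[|[|//]]]] hi] [[|[|[|[|//]]]] hj] /=; rewrite /s; lra.
Qed.

(** A quartic polynomial is determined by its values; four of them suffice
    here because both sides are monic. *)
Lemma coefs4 (s p d e l1 l2 l3 l4 : R) :
  (forall x, (x - l1) * (x - l2) * (x - l3) * (x - l4) = x ^+ 4 - 2 * s * x ^+ 2 - 8 * d * x + e) ->
  [/\ l1 + l2 + l3 + l4 = 0,
     l1 * l2 + l1 * l3 + l1 * l4 + l2 * l3 + l2 * l4 + l3 * l4 = - 2 * s,
     l1 * l2 * l3 + l1 * l2 * l4 + l1 * l3 * l4 + l2 * l3 * l4 = 8 * d &
     l1 * l2 * l3 * l4 = e].
Proof.
move=> h; have h0 := h 0; have h1 := h 1; have h2 := h (-1); have h3 := h 2.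
by split; lra.
Qed.

(** The eigenvalues of a traceless symmetric 4 x 4 matrix are
    a + b + c, a - b - c, - a + b - c and - a - b + c, where a >= b >= |c| are
    the singular values of the 3 x 3 matrix, the last one with the sign of the
    determinant. *)
Lemma eigenvalues_singular (S : 'M[R]_4) t v p q : S = quaternion_mx t v p q ->
  S \is symmetricmx -> exists a b c : R,
  [/\ b <= a /\ `|c| <= b,
      [/\ a ^+ 2 + b ^+ 2 + c ^+ 2 = gram1 v p q,
          a ^+ 2 * b ^+ 2 + b ^+ 2 * c ^+ 2 + c ^+ 2 * a ^+ 2 = gram2 v p q &
          a * b * c = triple v p q] &
      [/\ lambda 1 S = lambda 2 S <-> b = - c,
          lambda 2 S = lambda 3 S <-> a = b &
          lambda 3 S = lambda 4 S <-> b = c]].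
Proof.
move=> SE symS; have [l0 Sl0] := symmetric_eigenvalue_list symS.
have : eigenvalue_list S (eigvals S) by exact: (xgetPex _ (ex_intro _ l0 Sl0)).
rewrite /lambda; move: (eigvals S) => l [sl cl].
have sz : size l = 4%N.
  apply/eqP; rewrite -eqSS -(size_prod_XsubC l id) -cl size_char_poly //.
case: l sl cl sz => [//|l1 [//|l2 [//|l3 [//|l4 [|//]]]]] /= /and4P[l21 l32 l43 _] cl _.
have coef (x : R) : (x - (l1 - t)) * (x - (l2 - t)) * (x - (l3 - t)) * (x - (l4 - t)) =
    x ^+ 4 - 2 * gram1 v p q * x ^+ 2 - 8 * triple v p q * x + (gram1 v p q ^+ 2 - 4 * gram2 v p q).
  rewrite -(quaternion_char_poly t) -SE cl !big_cons big_nil !hornerE /=; ring.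
have [e1 e2 e3 e4] := coefs4 0 coef.
exists ((l1 + l2) / 2 - t), ((l1 + l3) / 2 - t), ((l1 + l4) / 2 - t).
split.
- by split; [lra|rewrite ler_norml; lra].
- move: e1 e2 e3 e4; move: (gram1 v p q) (gram2 v p q) (triple v p q) => s1 s2 d.
  move=> e1 e2 e3 e4.
  have l1E : l1 = 4 * t - l2 - l3 - l4 by lra.
  have h1 : ((l1 + l2) / 2 - t) ^+ 2 + ((l1 + l3) / 2 - t) ^+ 2 + ((l1 + l4) / 2 - t) ^+ 2 = s1.
    by subst l1; lra.
  split=> //; last by subst l1; lra.
  rewrite -h1 in e4; subst l1; lra.
- by split; split; lra.
Qed.

End SingularValues.

(** * Coinciding eigenvalues under a perturbation of rank one *)

Section Confocal.
Context {R : realType}.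

(** The characteristic polynomial of the diagonal matrix with entries q1, q2,
    0 plus the matrix of rank one w w^T, where x2, y2, z2 are the squares of
    the coordinates of w. *)
Lemma perturbed_char_poly (q1 q2 x2 y2 z2 A B C : R) :
  A + B + C = x2 + y2 + z2 + q1 + q2 ->
  A * B + B * C + C * A = q1 * (y2 + z2) + q2 * (x2 + z2) + q1 * q2 ->
  A * B * C = q1 * q2 * z2 ->
  forall x, (x - A) * (x - B) * (x - C) =
    (x - q1) * (x - q2) * x - x2 * (x - q2) * x - y2 * (x - q1) * x - z2 * (x - q1) * (x - q2).
Proof.
move=> e1 e2 e3 x; have -> : (x - A) * (x - B) * (x - C) =
  x ^+ 3 - (A + B + C) * x ^+ 2 + (A * B + B * C + C * A) * x - A * B * C by ring.
by rewrite e1 e2 e3; ring.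
Qed.

(** Under a rank one perturbation of the diagonal matrix with entries q1, q2
    and 0, the eigenvalues A, B, C interlace with q1, q2, 0, so that A and B
    can only coincide at q1, and B and C only at q2. *)
Lemma top_coincidence (q1 q2 x2 y2 z2 A B C : R) :
  0 < q2 -> q2 < q1 -> 0 <= x2 -> 0 <= y2 -> 0 <= z2 -> B <= A -> C <= B ->
  A + B + C = x2 + y2 + z2 + q1 + q2 ->
  A * B + B * C + C * A = q1 * (y2 + z2) + q2 * (x2 + z2) + q1 * q2 ->
  A * B * C = q1 * q2 * z2 ->
  A = B <-> x2 = 0 /\ q1 * y2 + (q1 - q2) * z2 = q1 * (q1 - q2).
Proof.
move=> q20 q21 x20 y20 z20 AB BC e1 e2 e3.
have q10 : 0 < q1 by exact: lt_trans q20 q21.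
have q12 : 0 < q1 - q2 by rewrite subr_gt0.
have chi := perturbed_char_poly e1 e2 e3.
have chi1 : (q1 - A) * (q1 - B) * (q1 - C) = - (x2 * (q1 - q2) * q1) by rewrite chi; ring.
have chi2 : (q2 - A) * (q2 - B) * (q2 - C) = y2 * (q1 - q2) * q2 by rewrite chi; ring.
split=> [AB'|[x0 e]].
  have c1 : (q1 - A) ^+ 2 * (q1 - C) <= 0.
    by rewrite expr2 {2}AB' chi1 oppr_le0 !mulr_ge0 // ltW.
  have c2 : 0 <= (q2 - A) ^+ 2 * (q2 - C).
    by rewrite expr2 {2}AB' chi2 !mulr_ge0 // ltW.
  have qA : q1 = A.
    apply/eqP; apply/negPn/negP => q1A.
    have s1 : 0 < (q1 - A) ^+ 2 by rewrite exprn_even_gt0 //= subr_eq0.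
    move: c1; rewrite pmulr_rle0 // => q1C.
    have [q2A|q2A] := eqVneq q2 A; first by lra.
    have s2 : 0 < (q2 - A) ^+ 2 by rewrite exprn_even_gt0 //= subr_eq0.
    by move: c2; rewrite pmulr_rge0 // => q2C; lra.
  have x0 : x2 = 0.
    have /eqP := chi1; rewrite -qA subrr !mul0r eq_sym oppr_eq0 !mulf_eq0.
    by rewrite (gt_eqF q12) (gt_eqF q10) !orbF => /eqP.
  split=> //.
  have CE : q1 * C = q2 * z2.
    apply: (mulfI (_ : q1 != 0)); first by rewrite gt_eqF.
    have -> : q1 * (q1 * C) = A * B * C by rewrite -AB' -qA; ring.
    by rewrite e3; ring.
  have C' : C = y2 + z2 + q2 - q1 by lra.
  by move: CE; rewrite C'; lra.
pose D := y2 + z2 + q2 - q1.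
have D2 : D <= q2.
  have : (q1 - q2) * (y2 + z2) <= (q1 - q2) * q1.
    rewrite mulrDr [leRHS]mulrC -e lerD2r ler_wpM2r //; lra.
  by rewrite ler_pM2l // /D; lra.
have root (x : R) : (x - A) * (x - B) * (x - C) = 0 -> x = q1 \/ x = D.
  move=> rx; have : (x - q1) ^+ 2 * (x - D) = 0.
    rewrite -rx chi x0 /D; apply/eqP; rewrite -subr_eq0.
    apply/eqP; transitivity ((x - q1) * (q1 * y2 + (q1 - q2) * z2 - q1 * (q1 - q2))).
      by ring.
    by rewrite e subrr mulr0.
  by move/eqP; rewrite mulf_eq0 sqrf_eq0 !subr_eq0 => /orP[]/eqP; [left|right].
have rA : A = q1 \/ A = D by apply: root; rewrite subrr !mul0r.
have rB : B = q1 \/ B = D by apply: root; rewrite subrr mulr0 mul0r.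
have rC : C = q1 \/ C = D by apply: root; rewrite subrr mulr0.
have S : A + B + C = 2 * q1 + D by rewrite e1 x0 /D; ring.
case: rA => rA; case: rB => rB; case: rC => rC; lra.
Qed.

Lemma bottom_coincidence (q1 q2 x2 y2 z2 A B C : R) :
  0 < q2 -> q2 < q1 -> 0 <= x2 -> 0 <= y2 -> 0 <= z2 -> B <= A -> C <= B ->
  A + B + C = x2 + y2 + z2 + q1 + q2 ->
  A * B + B * C + C * A = q1 * (y2 + z2) + q2 * (x2 + z2) + q1 * q2 ->
  A * B * C = q1 * q2 * z2 ->
  B = C <-> y2 = 0 /\ (q1 - q2) * z2 = q2 * (x2 + q1 - q2).
Proof.
move=> q20 q21 x20 y20 z20 AB BC e1 e2 e3.
have q10 : 0 < q1 by exact: lt_trans q20 q21.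
have q12 : 0 < q1 - q2 by rewrite subr_gt0.
have chi := perturbed_char_poly e1 e2 e3.
have chi1 : (q1 - A) * (q1 - B) * (q1 - C) = - (x2 * (q1 - q2) * q1) by rewrite chi; ring.
have chi2 : (q2 - A) * (q2 - B) * (q2 - C) = y2 * (q1 - q2) * q2 by rewrite chi; ring.
split=> [BC'|[y0 e]].
  have c1 : (q1 - B) ^+ 2 * (q1 - A) <= 0.
    by rewrite expr2 {2}BC' mulrC mulrA chi1 oppr_le0 !mulr_ge0 // ltW.
  have c2 : 0 <= (q2 - B) ^+ 2 * (q2 - A).
    by rewrite expr2 {2}BC' mulrC mulrA chi2 !mulr_ge0 // ltW.
  have qB : q2 = B.
    apply/eqP; apply/negPn/negP => q2B.
    have s2 : 0 < (q2 - B) ^+ 2 by rewrite exprn_even_gt0 //= subr_eq0.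
    move: c2; rewrite pmulr_rge0 // => q2A.
    have [q1B|q1B] := eqVneq q1 B; first by lra.
    have s1 : 0 < (q1 - B) ^+ 2 by rewrite exprn_even_gt0 //= subr_eq0.
    by move: c1; rewrite pmulr_rle0 // => q1A; lra.
  have y0 : y2 = 0.
    have /eqP := chi2; rewrite -qB subrr mulr0 mul0r eq_sym !mulf_eq0.
    by rewrite (gt_eqF q12) (gt_eqF q20) !orbF => /eqP.
  split=> //.
  have AE : q2 * A = q1 * z2.
    apply: (mulfI (_ : q2 != 0)); first by rewrite gt_eqF.
    have -> : q2 * (q2 * A) = A * B * C by rewrite -BC' -qB; ring.
    by rewrite e3; ring.
  have A' : A = x2 + z2 + q1 - q2 by lra.
  by move: AE; rewrite A'; lra.
pose D := x2 + z2 + q1 - q2.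
have z2q : q2 <= z2.
  have : (q1 - q2) * q2 <= (q1 - q2) * z2.
    rewrite e mulrC; apply: ler_wpM2l; [exact: ltW|lra].
  by rewrite ler_pM2l.
have D2 : q2 < D by rewrite /D; lra.
have root (x : R) : (x - A) * (x - B) * (x - C) = 0 -> x = q2 \/ x = D.
  move=> rx; have : (x - q2) ^+ 2 * (x - D) = 0.
    rewrite -rx chi y0 /D; apply/eqP; rewrite -subr_eq0.
    apply/eqP; transitivity ((x - q2) * (q2 * (x2 + q1 - q2) - (q1 - q2) * z2)).
      by ring.
    by rewrite e subrr mulr0.
  by move/eqP; rewrite mulf_eq0 sqrf_eq0 !subr_eq0 => /orP[]/eqP; [left|right].
have rA : A = q2 \/ A = D by apply: root; rewrite subrr !mul0r.
have rB : B = q2 \/ B = D by apply: root; rewrite subrr mulr0 mul0r.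
have rC : C = q2 \/ C = D by apply: root; rewrite subrr mulr0.
have S : A + B + C = 2 * q2 + D by rewrite e1 y0 /D; ring.
case: rA => rA; case: rB => rB; case: rC => rC; lra.
Qed.

End Confocal.

(** * Existence of coincidences *)

Section Coincidences.
Context {R : realType}.
Local Notation z3 := (ord_max : 'I_3).
Implicit Types (u v p q : 'rV[R]_3).

Lemma quaternion_mx_symmetric t v p q : quaternion_mx t v p q \is symmetricmx.
Proof.
apply/is_hermitianmxP; rewrite expr0 scale1r map_mx_id //; apply/matrixP => i j.
by rewrite !mxE; case: i j => [[|[|[|[|//]]]] hi] [[|[|[|[|//]]]] hj].
Qed.

Lemma coincidence_singular (S0 : 'M[R]_4) (h : 'rV[R]_3) : S0 \is symmetricmx ->
  let v := quaternion_row1 S0 + h in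
  let p := quaternion_row2 S0 in let q := quaternion_row3 S0 in
  exists a b c : R,
  [/\ b <= a /\ `|c| <= b,
      [/\ a ^+ 2 + b ^+ 2 + c ^+ 2 = gram1 v p q,
          a ^+ 2 * b ^+ 2 + b ^+ 2 * c ^+ 2 + c ^+ 2 * a ^+ 2 = gram2 v p q &
          a * b * c = triple v p q] &
      [/\ coincidence S0 1 (pauli h) <-> b = - c,
          coincidence S0 2 (pauli h) <-> a = b &
          coincidence S0 3 (pauli h) <-> b = c]].
Proof.
move=> symS v p q.
have SE : S0 + real_mx (pauli h) = quaternion_mx (mean_trace S0) v p q.
  rewrite {1}(symmetric_quaternion_mx symS) real_mx_pauli -quaternion_mxD.
  by rewrite !addr0.
have := quaternion_mx_symmetric (mean_trace S0) v p q; rewrite -SE => symSh.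
have [a [b [c [ab inv [h1 h2 h3]]]]] := eigenvalues_singular SE symSh.
have isu : isu2 (pauli h) by have [+ _ _] := pauli_bij R; apply.
exists a, b, c; split=> //.
by split; (split=> [[_ e]|e]; [apply/h1 || apply/h2 || apply/h3|split=> //; apply/h1 || apply/h2 || apply/h3]).
Qed.

(** The square of a determinant is the determinant of the Gram matrix. *)
Lemma triple_sqr v p q : triple v p q ^+ 2 =
  dot v v * (dot p p * dot q q - dot p q ^+ 2) -
  dot v p * (dot v p * dot q q - dot p q * dot v q) +
  dot v q * (dot v p * dot p q - dot p p * dot v q).
Proof. by rewrite /triple /dot; ring. Qed.

Lemma dot_ge0 v : 0 <= dot v v.
Proof. by rewrite /dot !addr_ge0 // -expr2 sqr_ge0. Qed.

Lemma dot_eq0 v : dot v v = 0 -> v = 0.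
Proof.
move=> /eqP; rewrite /dot !paddr_eq0 ?addr_ge0 // -?expr2 ?sqr_ge0 // !sqrf_eq0.
case/andP=> /andP[/eqP e0 /eqP e1] /eqP e2; rewrite [v]row3_eta e0 e1 e2.
by apply/rowP => i; rewrite !mxE; do 2?case: ifP.
Qed.

(** The rotation diagonalizes the Gram matrix of p and q. *)
Lemma rotate_orthogonal p q : exists c s, let p' := c *: p + s *: q in
  let q' := - s *: p + c *: q in
  [/\ c ^+ 2 + s ^+ 2 = 1, dot p' q' = 0 & dot q' q' <= dot p' p'].
Proof.
pose d := (dot p p - dot q q) / 2; pose e := dot p q.
pose r := Num.sqrt (d ^+ 2 + e ^+ 2).
have r2 : r ^+ 2 = d ^+ 2 + e ^+ 2 by rewrite sqr_sqrtr // addr_ge0 ?sqr_ge0.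
have pqE c s : dot (c *: p + s *: q) (- s *: p + c *: q) =
    (c ^+ 2 - s ^+ 2) * e - 2 * c * s * d.
  by rewrite /d /e /dot !mxE; field.
have normE c s : dot (c *: p + s *: q) (c *: p + s *: q) -
    dot (- s *: p + c *: q) (- s *: p + c *: q) = 2 * ((c ^+ 2 - s ^+ 2) * d + 2 * c * s * e).
  by rewrite /d /e /dot !mxE; field.
have [r0|rn] := eqVneq r 0.
  have [d0 e0] : d = 0 /\ e = 0.
    have /eqP : d ^+ 2 + e ^+ 2 = 0 by rewrite -r2 r0 expr0n.
    by rewrite paddr_eq0 ?sqr_ge0 // !sqrf_eq0 => /andP[/eqP -> /eqP ->].
  exists 1, 0 => /=; split; first by rewrite expr1n expr0n addr0.
    by rewrite pqE d0 e0 !mulr0 subrr.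
  by rewrite -subr_ge0 normE d0 e0 !mulr0 addr0 mulr0.
have [|c [s [_ cs1 cs2 cs3 _]]] := @unit_sqrt R (d / r) (e / r).
  have -> : (d / r) ^+ 2 + (e / r) ^+ 2 = (d ^+ 2 + e ^+ 2) / r ^+ 2 by field.
  by rewrite -r2 divff // expf_neq0.
exists c, s => /=; split=> //; first by rewrite pqE cs2 cs3; field.
rewrite -subr_ge0 normE cs2 cs3.
have -> : 2 * (d / r * d + e / r * e) = 2 * r.
  have -> : d / r * d + e / r * e = (d ^+ 2 + e ^+ 2) / r by field.
  by rewrite -r2 expr2 mulfK.
by rewrite mulr_ge0 // sqrtr_ge0.
Qed.

Lemma gram_rotate v p q c s : c ^+ 2 + s ^+ 2 = 1 ->
  let p' := c *: p + s *: q in let q' := - s *: p + c *: q in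
  [/\ gram1 v p' q' = gram1 v p q, gram2 v p' q' = gram2 v p q &
      triple v p' q' = triple v p q].
Proof.
move=> cs /=; split.
- have -> : gram1 v (c *: p + s *: q) (- s *: p + c *: q) =
      dot v v + (c ^+ 2 + s ^+ 2) * (dot p p + dot q q).
    by rewrite /gram1 /dot !mxE; ring.
  by rewrite cs /gram1; ring.
- have -> : gram2 v (c *: p + s *: q) (- s *: p + c *: q) =
      (c ^+ 2 + s ^+ 2) * (dot v v * (dot p p + dot q q) - dot v p ^+ 2 - dot v q ^+ 2) +
      (c ^+ 2 + s ^+ 2) ^+ 2 * (dot p p * dot q q - dot p q ^+ 2).
    by rewrite /gram2 /dot !mxE; ring.
  by rewrite cs /gram2; ring.
- have -> : triple v (c *: p + s *: q) (- s *: p + c *: q) =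
      (c ^+ 2 + s ^+ 2) * triple v p q.
    by rewrite /triple !mxE; ring.
  by rewrite cs mul1r.
Qed.

Lemma unit_orthogonal p q : exists e, [/\ dot e e = 1, dot e p = 0 & dot e q = 0].
Proof.
pose B : 'M[R]_(3, 2) := \matrix_(i, j) if j == 0 then p 0 i else q 0 i.
have : kermx B != 0.
  rewrite -mxrank_eq0 mxrank_ker subn_eq0 -ltnNge.
  exact: leq_ltn_trans (rank_leq_col B) _.
move=> /rowV0Pn[u /sub_kermxP uB u0].
have BE (w : 'rV[R]_3) j : (forall i, B i j = w 0 i) -> dot u w = 0.
  move=> Bw; have := congr1 (fun w : 'rV[R]_2 => w 0 j) uB; rewrite mxE [RHS]mxE => <-.
  rewrite !big_ord_recr big_ord0 /= add0r !Bw.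
  have -> : widen_ord (leqnSn 2) (widen_ord (leqnSn 1) ord_max) = 0 by exact/val_inj.
  by have -> : widen_ord (leqnSn 2) ord_max = 1 by exact/val_inj.
have up : dot u p = 0 by apply: (BE _ 0) => i; rewrite mxE.
have uq : dot u q = 0 by apply: (BE _ 1) => i; rewrite mxE.
have uu : 0 < dot u u.
  by rewrite lt_neqAle dot_ge0 andbT eq_sym; apply: contra_neq u0; exact: dot_eq0.
have dotZ r x y : dot (r *: x) y = r * dot x y by rewrite /dot !mxE; ring.
have dotC x y : dot x y = dot y x by rewrite /dot; ring.
exists ((Num.sqrt (dot u u))^-1 *: u); rewrite !dotZ up uq !mulr0; split=> //.
rewrite dotC dotZ mulrA -expr2 exprVn sqr_sqrtr ?(ltW uu) // mulVf //.
by rewrite gt_eqF.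
Qed.

(** When v is orthogonal to p and q and of length |p|, the squares of the
    singular values have the symmetric functions of q1, q1, q2. *)
Lemma double_top (q1 q2 A B C : R) : q2 <= q1 -> B <= A -> C <= B ->
  A + B + C = 2 * q1 + q2 -> A * B + B * C + C * A = q1 ^+ 2 + 2 * q1 * q2 ->
  A * B * C = q1 ^+ 2 * q2 -> A = B.
Proof.
move=> q21 AB BC e1 e2 e3.
have root (x : R) : (x - A) * (x - B) * (x - C) = 0 -> x = q1 \/ x = q2.
  have -> : (x - A) * (x - B) * (x - C) =
    x ^+ 3 - (A + B + C) * x ^+ 2 + (A * B + B * C + C * A) * x - A * B * C by ring.
  rewrite e1 e2 e3 => h; have : (x - q1) ^+ 2 * (x - q2) = 0 by rewrite -h; ring.
  by move/eqP; rewrite mulf_eq0 sqrf_eq0 !subr_eq0 => /orP[]/eqP; [left|right].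
have rA : A = q1 \/ A = q2 by apply: root; rewrite subrr !mul0r.
have rB : B = q1 \/ B = q2 by apply: root; rewrite subrr mulr0 mul0r.
have rC : C = q1 \/ C = q2 by apply: root; rewrite subrr mulr0.
clear e2 e3 root; case: rA => rA; case: rB => rB; case: rC => rC; lra.
Qed.

Lemma double_bottom (q1 q2 A B C : R) : q2 <= q1 -> B <= A -> C <= B ->
  A + B + C = q1 + 2 * q2 -> A * B + B * C + C * A = q2 ^+ 2 + 2 * q1 * q2 ->
  A * B * C = q1 * q2 ^+ 2 -> B = C.
Proof.
move=> q21 AB BC e1 e2 e3.
have : - C = - B; last by move/oppr_inj.
apply: (@double_top (- q2) (- q1) (- C) (- B) (- A)); rewrite ?lerN2 //; lra.
Qed.

Lemma abs_sqr_le (b c : R) : `|c| <= b -> c ^+ 2 <= b ^+ 2.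
Proof.
move=> cb; rewrite -(real_normK (num_real c)) ler_pXn2r ?nnegrE //.
exact: le_trans cb.
Qed.

(** The three rows p, q, v are made orthogonal.  For the first and third
    coincidences the sign of v is chosen so that the determinant has the sign
    of the smallest singular value. *)
Lemma coincidence_nonempty (S0 : 'M[R]_4) : S0 \is symmetricmx ->
  [/\ coincidence S0 1 !=set0, coincidence S0 2 !=set0 & coincidence S0 3 !=set0].
Proof.
move=> symS; set p := quaternion_row2 S0; set q := quaternion_row3 S0.
have [c [s /= [cs pq0 q21]]] := rotate_orthogonal p q.
have [e [ee ep eq]] := unit_orthogonal (c *: p + s *: q) (- s *: p + c *: q).
have gr v := gram_rotate v p q cs; move: pq0 q21 ep eq gr => /=.
set p' := c *: p + _; set q' := _ + c *: q => pq0 q21 ep eq gr.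
pose q1 := dot p' p'; pose q2 := dot q' q'.
have q10 : 0 <= q1 by exact: dot_ge0. have q20 : 0 <= q2 by exact: dot_ge0.
have dotZl r x y : dot (r *: x) y = r * dot x y by rewrite /dot !mxE; ring.
have dotZr r x y : dot x (r *: y) = r * dot x y by rewrite /dot !mxE; ring.
have g1 r : gram1 (r *: e) p q = r ^+ 2 + q1 + q2.
  by have [<- _ _] := gr (r *: e); rewrite /gram1 dotZl dotZr ee mulr1 expr2.
have g2 r : gram2 (r *: e) p q = r ^+ 2 * q1 + r ^+ 2 * q2 + q1 * q2.
  have [_ <- _] := gr (r *: e).
  by rewrite /gram2 !dotZl !dotZr ee ep eq pq0 -/q1 -/q2; ring.
have g3 r : triple (r *: e) p q ^+ 2 = r ^+ 2 * q1 * q2.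
  have [_ _ <-] := gr (r *: e).
  by rewrite triple_sqr !dotZl !dotZr ee ep eq pq0 -/q1 -/q2; ring.
have tZ r : triple (r *: e) p q = r * triple e p q by rewrite /triple !mxE; ring.
have sing r := coincidence_singular (r *: e - quaternion_row1 S0) symS.
have nonneg (b d : R) : `|d| <= b -> 0 <= b by exact: le_trans.
have sqr_prod (x y z : R) : x ^+ 2 * y ^+ 2 * z ^+ 2 = (x * y * z) ^+ 2 by rewrite !exprMn.
have top : coincidence S0 2 !=set0.
  have := sing (Num.sqrt q1); rewrite addrC subrK -/p -/q => -[a [b [d]]].
  rewrite g1 g2 => -[[ba db] [f1 f2 f3] [_ h _]].
  have b0 := nonneg _ _ db; have a0 : 0 <= a by exact: le_trans ba.
  eexists; apply/h; apply/eqP; rewrite -(@eqrXn2 _ 2) //; apply/eqP.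
  apply: (@double_top q1 q2 _ _ (d ^+ 2)) => //.
  - by rewrite ler_pXn2r ?nnegrE.
  - exact: abs_sqr_le.
  - by rewrite f1 sqr_sqrtr //; ring.
  - by rewrite f2 sqr_sqrtr //; ring.
  - by rewrite sqr_prod f3 g3 sqr_sqrtr //; ring.
have bottom (k : R) : k ^+ 2 = 1 -> exists a b d : R, [/\ b <= a, `|d| <= b,
    b ^+ 2 = d ^+ 2, a * b * d = k * (Num.sqrt q2 * triple e p q) &
    [/\ (b = - d -> coincidence S0 1 !=set0) & (b = d -> coincidence S0 3 !=set0)]].
  move=> k2; have := sing (k * Num.sqrt q2); rewrite addrC subrK -/p -/q => -[a [b [d]]].
  rewrite g1 g2 => -[[ba db] [f1 f2 f3] [h1 _ h3]]; exists a, b, d.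
  have b0 := nonneg _ _ db; have a0 : 0 <= a by exact: le_trans ba.
  have r2 : (k * Num.sqrt q2) ^+ 2 = q2 by rewrite exprMn k2 mul1r sqr_sqrtr.
  split=> //; last by split=> bd; eexists; [apply/h1|apply/h3].
    apply: (@double_bottom q1 q2 (a ^+ 2)) => //.
    - by rewrite ler_pXn2r ?nnegrE.
    - exact: abs_sqr_le.
    - by rewrite f1 r2; ring.
    - by rewrite f2 r2; ring.
    - by rewrite sqr_prod f3 g3 r2; ring.
  by rewrite f3 tZ; ring.
have sgn (x : R) : exists k, k ^+ 2 = 1 /\ 0 <= k * x.
  have [x0|x0] := leP 0 x; first by exists 1; rewrite expr1n mul1r.
  by exists (-1); rewrite sqrrN expr1n mulN1r oppr_ge0 ltW.
have decide (a b d : R) : b <= a -> `|d| <= b -> b ^+ 2 = d ^+ 2 -> 0 <= a * b * d -> b = d.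
  move=> ba db /eqP; rewrite eqf_sqr => /orP[/eqP //|/eqP bd] abd.
  have b0 := nonneg _ _ db; have a0 : 0 <= a by exact: le_trans ba.
  have : a * b * b <= 0 by move: abd; rewrite -[d]opprK -bd mulrN oppr_ge0.
  have [bp|bn] := ltP 0 b; last by move: b0 bn bd; lra.
  have ap : 0 < a by exact: lt_le_trans ba.
  by rewrite leNgt !mulr_gt0.
split=> //.
- have [k [k2 kx]] := sgn (- (Num.sqrt q2 * triple e p q)).
  have [a [b [d [ba db bd abd [h1 _]]]]] := bottom k k2; apply: h1.
  apply: (@decide a b (- d)) => //; rewrite ?normrN ?sqrrN //.
  by rewrite mulrN abd -mulrN.
- have [k [k2 kx]] := sgn (Num.sqrt q2 * triple e p q).
  have [a [b [d [ba db bd abd [_ h3]]]]] := bottom k k2; apply: h3.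
  by apply: (@decide a b d) => //; rewrite abd.
Qed.

End Coincidences.

(** * The generic coincidence curves *)

Section GenericConics.
Context {R : realType}.
Local Notation z3 := (ord_max : 'I_3).
Implicit Types (u v p q : 'rV[R]_3).

(** The sign of the determinant separates the two cases b = c and b = - c,
    that is, the two branches of the hyperbola. *)
Lemma signed_equal (a b c k z : R) : 0 < k -> b <= a -> `|c| <= b -> a * b * c = k * z ->
  (b = c /\ b != 0 <-> b ^+ 2 = c ^+ 2 /\ 0 < z).
Proof.
move=> k0 ba cb e; have b0 : 0 <= b by exact: le_trans cb.
split=> [[bc bn]|[bc z0]].
  have bp : 0 < b by rewrite lt_neqAle eq_sym bn.
  split; first by rewrite bc.
  rewrite -(pmulr_rgt0 _ k0) -e -bc !mulr_gt0 //; exact: lt_le_trans ba.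
have abc : 0 < a * b * c by rewrite e mulr_gt0.
have bn : b != 0 by apply: contraTneq abc => ->; rewrite mulr0 mul0r ltxx.
have bp : 0 < b by rewrite lt_neqAle eq_sym bn.
have ap : 0 < a by exact: lt_le_trans ba.
split=> //; move/eqP: bc; rewrite eqf_sqr => /orP[/eqP //|/eqP bc].
by move: abc; rewrite -[c]opprK -bc mulrN oppr_gt0 ltNge !mulr_ge0 // ltW.
Qed.

Lemma ellipse_equation (q1 q2 x y z : R) : 0 < q2 -> q2 < q1 ->
  (x ^+ 2 = 0 /\ q1 * y ^+ 2 + (q1 - q2) * z ^+ 2 = q1 * (q1 - q2)) <->
  (x = 0 /\ y ^+ 2 / (q1 - q2) + z ^+ 2 / q1 = 1).
Proof.
move=> q20 q21; have q1n : q1 != 0 by rewrite gt_eqF //; exact: lt_trans q21.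
have qn : q1 - q2 != 0 by rewrite gt_eqF // subr_gt0.
have -> : y ^+ 2 / (q1 - q2) + z ^+ 2 / q1 =
    (q1 * y ^+ 2 + (q1 - q2) * z ^+ 2) / (q1 * (q1 - q2)) by field; apply/andP.
split=> [[/eqP x0 ->]|[-> e]].
  by rewrite divff ?mulf_neq0 //; move: x0; rewrite sqrf_eq0 => /eqP.
by rewrite expr0n; split=> //; rewrite -[LHS](divfK (_ : q1 * (q1 - q2) != 0)) ?mulf_neq0 // e mul1r.
Qed.

Lemma hyperbola_equation (q1 q2 x y z : R) : 0 < q2 -> q2 < q1 ->
  (y ^+ 2 = 0 /\ (q1 - q2) * z ^+ 2 = q2 * (x ^+ 2 + q1 - q2)) <->
  (y = 0 /\ z ^+ 2 / q2 - x ^+ 2 / (q1 - q2) = 1).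
Proof.
move=> q20 q21; have q2n : q2 != 0 by rewrite gt_eqF.
have qn : q1 - q2 != 0 by rewrite gt_eqF // subr_gt0.
have -> : z ^+ 2 / q2 - x ^+ 2 / (q1 - q2) =
    ((q1 - q2) * z ^+ 2 - q2 * x ^+ 2) / (q2 * (q1 - q2)) by field; apply/andP.
split=> [[/eqP y0 ->]|[-> e]].
  have -> : q2 * (x ^+ 2 + q1 - q2) - q2 * x ^+ 2 = q2 * (q1 - q2) by ring.
  by rewrite divff ?mulf_neq0 //; move: y0; rewrite sqrf_eq0 => /eqP.
rewrite expr0n; split=> //; have : (q1 - q2) * z ^+ 2 - q2 * x ^+ 2 = q2 * (q1 - q2).
  by rewrite -[LHS](divfK (_ : q2 * (q1 - q2) != 0)) ?mulf_neq0 // e mul1r.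
by move=> h; apply/eqP; rewrite -subr_eq0; apply/eqP; move: h; lra.
Qed.

(** The matrix whose columns are the normalized p and q and their cross
    product, the latter with sign k. *)
Definition frame (k : R) p q : 'M[R]_3 := \matrix_(i, j)
  if j == 0 then p 0 i / Num.sqrt (dot p p)
  else if j == 1 then q 0 i / Num.sqrt (dot q q)
  else k * triple (row i 1%:M) p q / (Num.sqrt (dot p p) * Num.sqrt (dot q q)).

Lemma frameE k p q v : [/\ (v *m frame k p q) 0 0 = dot v p / Num.sqrt (dot p p),
  (v *m frame k p q) 0 1 = dot v q / Num.sqrt (dot q q) &
  (v *m frame k p q) 0 z3 = k * triple v p q / (Num.sqrt (dot p p) * Num.sqrt (dot q q))].
Proof.
split; rewrite mulmx_rV3 !mxE /=.
- by rewrite /dot; ring.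
- by rewrite /dot; ring.
- by rewrite /triple !mxE /=; ring.
Qed.

(** The sign k selects the branch: the third coordinate is proportional to
    k times the determinant, so that for k = 1 the branch in the positive half
    space is C_3, and for k = - 1 it is C_1. *)
Lemma generic_conics (S0 : 'M[R]_4) (k : R) p q : S0 \is symmetricmx -> k ^+ 2 = 1 ->
  dot p q = 0 -> 0 < dot q q -> dot q q < dot p p ->
  (forall v, [/\ gram1 v p q = gram1 v (quaternion_row2 S0) (quaternion_row3 S0),
     gram2 v p q = gram2 v (quaternion_row2 S0) (quaternion_row3 S0) &
     triple v p q = triple v (quaternion_row2 S0) (quaternion_row3 S0)]) ->
  let a := Num.sqrt (dot p p) in let c := Num.sqrt (dot q q) in
  let A := affine_coord (- quaternion_row1 S0) (frame k p q) in
  [/\ 0 < c < a, frame k p q \in unitmx,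
    (@pauli R) @^-1` coincidence S0 2 = A @^-1` focal_ellipse a c &
    (@pauli R) @^-1` coincidence S0 (if 0 < k then 3 else 1) = A @^-1` focal_branch a c].
Proof.
move=> symS k2 pq0 q20 q21 gr a c A.
have q10 : 0 < dot p p by exact: lt_trans q21.
have a0 : 0 < a by rewrite sqrtr_gt0. have c0 : 0 < c by rewrite sqrtr_gt0.
have a2 : a ^+ 2 = dot p p by rewrite sqr_sqrtr // ltW.
have c2 : c ^+ 2 = dot q q by rewrite sqr_sqrtr // ltW.
have an : a != 0 by rewrite gt_eqF. have cn : c != 0 by rewrite gt_eqF.
have kn : k != 0 by apply: contra_eq_neq k2 => ->; rewrite expr0n eq_sym oner_eq0.
have coordE v : [/\ dot v p = a * (v *m frame k p q) 0 0,
    dot v q = c * (v *m frame k p q) 0 1 &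
    triple v p q = (a * c) * (k * (v *m frame k p q) 0 z3)].
  have [-> -> ->] := frameE k p q v; rewrite -/a -/c; split; try by field.
  have -> : k * (k * triple v p q / (a * c)) = k ^+ 2 * (triple v p q / (a * c)) by ring.
  by rewrite k2 mul1r; field; apply/andP.
have normE v : dot v v = (v *m frame k p q) 0 0 ^+ 2 + (v *m frame k p q) 0 1 ^+ 2 +
    (v *m frame k p q) 0 z3 ^+ 2.
  have [e1 e2 e3] := coordE v; have := triple_sqr v p q.
  rewrite e1 e2 e3 pq0 -a2 -c2 => h.
  apply: (mulfI (_ : a ^+ 2 * c ^+ 2 != 0)); first by rewrite mulf_neq0 // expf_neq0.
  have hk : ((a * c) * (k * (v *m frame k p q) 0 z3)) ^+ 2 =
      a ^+ 2 * c ^+ 2 * (v *m frame k p q) 0 z3 ^+ 2 by rewrite !exprMn k2 mul1r.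
  by rewrite hk in h; lra.
have ca : c < a by rewrite ltr_sqrt.
have AE h : A h = (quaternion_row1 S0 + h) *m frame k p q.
  by rewrite /A /affine_coord opprK addrC.
have nonneg (al be ga : R) : be <= al /\ `|ga| <= be -> 0 <= be /\ 0 <= al.
  by case=> h1 h2; have b0 : 0 <= be := le_trans (normr_ge0 _) h2; split=> //; exact: le_trans h1.
have sqr_le (al be : R) : 0 <= be -> be <= al -> be ^+ 2 <= al ^+ 2.
  by move=> b0 ab; rewrite ler_pXn2r ?nnegrE //; exact: le_trans ab.
have normr_sign : (k == 1) || (k == -1) -> `|k| = 1.
  by case/orP=> /eqP ->; rewrite ?normrN normr1.
(* the invariants of the Gram matrix in the coordinates A h *)
have core h : exists al be ga : R, [/\ be <= al /\ `|ga| <= be,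
    [/\ coincidence S0 1 (pauli h) <-> be = - ga,
      coincidence S0 2 (pauli h) <-> al = be & coincidence S0 3 (pauli h) <-> be = ga]
    /\ al * be * ga = a * c * (k * A h 0 z3) &
    [/\ al ^+ 2 + be ^+ 2 + ga ^+ 2 =
         A h 0 0 ^+ 2 + A h 0 1 ^+ 2 + A h 0 z3 ^+ 2 + dot p p + dot q q,
      al ^+ 2 * be ^+ 2 + be ^+ 2 * ga ^+ 2 + ga ^+ 2 * al ^+ 2 =
        dot p p * (A h 0 1 ^+ 2 + A h 0 z3 ^+ 2) +
        dot q q * (A h 0 0 ^+ 2 + A h 0 z3 ^+ 2) + dot p p * dot q q &
      al ^+ 2 * be ^+ 2 * ga ^+ 2 = dot p p * dot q q * A h 0 z3 ^+ 2]].
  have [al [be [ga [gb [f1 f2 f3] cs]]]] := coincidence_singular h symS.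
  exists al, be, ga; rewrite AE; move: f1 f2 f3; set v := _ + h => f1 f2 f3.
  have [g1 g2 g3] := gr v; have [c1 c2' c3] := coordE v.
  split=> //; first by rewrite f3 -g3 c3.
  split.
  - by rewrite f1 -g1 /gram1 normE.
  - rewrite f2 -g2 /gram2 c1 c2' pq0 normE !exprMn a2 c2; ring.
  - by rewrite -!exprMn f3 -g3 c3 !exprMn k2 mul1r a2 c2.
have core3 h (al be ga : R) :
    [/\ coincidence S0 1 (pauli h) <-> be = - ga,
      coincidence S0 2 (pauli h) <-> al = be & coincidence S0 3 (pauli h) <-> be = ga]
    /\ al * be * ga = a * c * (k * A h 0 z3) ->
    [/\ coincidence S0 (if 0 < k then 3 else 1) (pauli h) = (be = k * ga) :> Prop,
       True & al * be * (k * ga) = a * c * A h 0 z3].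
  move=> [[h1 _ h3] e].
  have kE : (k == 1) || (k == -1) by rewrite -eqf_sqr k2 expr1n.
  split=> //; last by rewrite mulrCA e; transitivity (k ^+ 2 * (a * c * A h 0 z3)); [ring|rewrite k2 mul1r].
  by case/orP: kE => /eqP ->; rewrite ?ltr01 ?ltr0N1 ?mul1r ?mulN1r; apply/propext.
split; first by rewrite c0.
- rewrite unitmxE unitfE; apply/det0P => -[v v0 vM].
  by move/eqP: v0; apply; apply: dot_eq0; rewrite normE vM !mxE expr0n /= !addr0.
- apply/seteqP; split=> h /=; have [al [be [ga [gb [[_ h2 _] _] inv]]]] := core h;
    have [b0 a0'] := nonneg _ _ _ gb; case: inv => [f1 f2 f3];
    have top := top_coincidence q20 q21 (sqr_ge0 _) (sqr_ge0 _) (sqr_ge0 _)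
      (sqr_le _ _ b0 gb.1) (abs_sqr_le gb.2) f1 f2 f3.
    rewrite /focal_ellipse /= a2 c2 => /h2 ab.
    by apply/(ellipse_equation _ _ _ q20 q21)/top; rewrite ab.
  rewrite /focal_ellipse /= a2 c2 => /(ellipse_equation _ _ _ q20 q21)/top/eqP.
  by rewrite eqrXn2 // => /eqP ab; apply/h2.
- have kE : (k == 1) || (k == -1) by rewrite -eqf_sqr k2 expr1n.
  apply/seteqP; split=> h /=; have [al [be [ga [gb cs inv]]]] := core h;
    have [b0 a0'] := nonneg _ _ _ gb; case: inv => [f1 f2 f3];
    have bottom := bottom_coincidence q20 q21 (sqr_ge0 _) (sqr_ge0 _) (sqr_ge0 _)
      (sqr_le _ _ b0 gb.1) (abs_sqr_le gb.2) f1 f2 f3;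
    have [e1 e2 e3] := core3 h _ _ _ cs;
    have kg : `|k * ga| <= be by rewrite normrM (normr_sign kE) mul1r; exact: gb.2.
  - rewrite e1 => bk.
    have sq : be ^+ 2 = ga ^+ 2 by rewrite bk exprMn k2 mul1r.
    have [y0 zE] := (hyperbola_equation _ _ _ q20 q21).1 (bottom.1 sq).
    rewrite /focal_branch /= a2 c2; split=> //.
    have bn : be != 0.
      apply: contraTneq isT => be0; have := bottom.1 sq => -[_].
      have z0 : A h 0 z3 = 0.
        move/eqP: e3; rewrite be0 mulr0 mul0r eq_sym !mulf_eq0 (negPf an) (negPf cn) /=.
        by move/eqP.
      rewrite z0 expr0n /= mulr0 => /esym/eqP; rewrite mulf_eq0 (gt_eqF q20) /= gt_eqF //.
      by rewrite -addrA ltr_wpDl ?sqr_ge0 // subr_gt0.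
    by have [+ _] := signed_equal (mulr_gt0 a0 c0) gb.1 kg e3; case.
  - rewrite /focal_branch /= a2 c2 => -[y0 z0 zE].
    rewrite e1; have sq := bottom.2 ((hyperbola_equation _ _ _ q20 q21).2 (conj y0 zE)).
    have sqk : be ^+ 2 = (k * ga) ^+ 2 by rewrite exprMn k2 mul1r.
    by have [_ +] := signed_equal (mulr_gt0 a0 c0) gb.1 kg e3; case.
Qed.

End GenericConics.

(** * Null sets and Lipschitz images *)

Section NullSets.
Context {R : realType}.

Definition box_volume n (a b : 'M[R]_n) : R :=
  \prod_(p : 'I_n * 'I_n | (p.1 <= p.2)%N) (b p.1 p.2 - a p.1 p.2).

Lemma box_volume_ge0 n (a b : 'M[R]_n) : (forall i j, a i j <= b i j) -> 0 <= box_volume a b.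
Proof. by move=> ab; apply: prodr_ge0 => p _; rewrite subr_ge0. Qed.

Lemma sub_sym_null n (M N : set 'M[R]_n) : M `<=` N -> sym_null N -> sym_null M.
Proof.
move=> MN nN e e0; have [a [b [ab cov vol]]] := nN e e0.
by exists a, b; split=> //; exact: subset_trans cov.
Qed.

(** The k-th set is covered with volume e / 2 ^ k.+1, and the covers are
    enumerated along a bijection of nat with nat * nat. *)
Lemma bigcup_sym_null n (N : nat -> set 'M[R]_n) :
  (forall k, sym_null (N k)) -> sym_null (\bigcup_k N k).
Proof.
move=> nN e e0.
have ek k : 0 < e / (2 ^ k.+1)%:R by rewrite divr_gt0 // ltr0n expn_gt0.
pose P k (ab : (nat -> 'M[R]_n) * (nat -> 'M[R]_n)) :=
  [/\ forall j i i', ab.1 j i i' <= ab.2 j i i',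
      N k `<=` \bigcup_j [set S | forall i i' : 'I_n, (i <= i')%N ->
                             ab.1 j i i' <= S i i' <= ab.2 j i i'] &
      (\sum_(0 <= j <oo) (box_volume (ab.1 j) (ab.2 j))%:E <=
       (e / (2 ^ k.+1)%:R)%:E)%E].
have [ab Pab] : {ab : nat -> (nat -> 'M[R]_n) * (nat -> 'M[R]_n) & forall k, P k (ab k)}.
  apply: (@choice _ _ P) => k.
  by have [a [b [? ? ?]]] := nN k _ (ek k); exists (a, b).
have le k : forall j i i', (ab k).1 j i i' <= (ab k).2 j i i' by case: (Pab k).
have /card_esym/ppcard_eqP[f] := card_nat2.
exists (fun m => (ab (f m).1).1 (f m).2), (fun m => (ab (f m).1).2 (f m).2); split.
- by move=> m i j; exact: le.
- move=> S [k _ NS]; have [_ cov _] := Pab k; have [j _ Sj] := cov _ NS.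
  exists (f^-1%FUN (k, j)) => //=.
  by rewrite invK ?inE.
pose vol2 (x : nat * nat) : \bar R := (box_volume ((ab x.1).1 x.2) ((ab x.1).2 x.2))%:E.
have v0 x : (0 <= vol2 x)%E by rewrite lee_fin box_volume_ge0.
rewrite -[X in (X <= _)%E]/(\sum_(0 <= m <oo) vol2 (f m))%E nneseries_esumT //.
rewrite -(@reindex_esum R nat (nat * nat)%type setT setT f vol2); last exact: 'bij_f.
rewrite (_ : [set: nat * nat] = setT `*`` (fun=> setT)); last first.
  by apply/seteqP; split=> x.
rewrite -(@esum_esum R _ _ setT (fun=> setT) (fun k j => vol2 (k, j))) //.
rewrite -nneseries_esumT; last by move=> k; apply: esum_ge0.
apply: (le_trans _ (epsilon_trick0 xpredT (ltW e0))).
apply: lee_nneseries => [k _ _|k _]; first by apply: esum_ge0.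
by have [_ _] := Pab k; rewrite -nneseries_esumT.
Qed.

(** A finite family of boxes, listed as an initial segment of a sequence of
    boxes that is constant and of volume zero afterwards. *)
Lemma fincover_sym_null n (N : set 'M[R]_n.+1) :
  (forall e, 0 < e -> exists (I : finType) (a b : I -> 'M[R]_n.+1),
    [/\ forall k i j, a k i j <= b k i j,
        N `<=` \bigcup_k [set S | forall i j : 'I_n.+1, (i <= j)%N ->
                                  a k i j <= S i j <= b k i j]
      & \sum_k box_volume (a k) (b k) <= e]) -> sym_null N.
Proof.
move=> cov e e0; have [I [a [b [ab NI vol]]]] := cov e e0.
pose ext (x : I -> 'M[R]_n.+1) (m : nat) : 'M[R]_n.+1 :=
  if (insub m : option 'I_#|I|) is Some k then x (enum_val k) else 0.
have extE x (k : 'I_#|I|) : ext x k = x (enum_val k).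
  by rewrite /ext valK.
have ext0 x m : (#|I| <= m)%N -> ext x m = 0.
  by move=> Im; rewrite /ext insubF // ltnNge Im.
exists (ext a), (ext b); split.
- by move=> m i j; rewrite /ext; case: insub => [k|].
- move=> S /NI[k _ Sk]; exists (enum_rank k) => //= i j ij.
  by rewrite !extE enum_rankK; exact: Sk.
have v0 m : 0 <= box_volume (ext a m) (ext b m).
  by apply: box_volume_ge0 => i j; rewrite /ext; case: insub.
pose v m : \bar R := (box_volume (ext a m) (ext b m))%:E.
rewrite -[X in (X <= _)%E]/(\sum_(0 <= m <oo) v m)%E (@nneseries_split R v 0 #|I|); last first.
  by move=> k _; rewrite lee_fin.
rewrite add0n eseries0 ?adde0; last first.
  move=> m Im _; rewrite /v !ext0 // /box_volume (bigD1 (ord0, ord0)) //=.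
  by rewrite !mxE subrr mul0r.
rewrite big_mkord sumEFin lee_fin; apply: le_trans vol.
rewrite [leRHS](reindex (fun k : 'I_#|I| => enum_val k) (onW_bij _ (enum_val_bij I))).
by apply: ler_sum => k _; rewrite !extE.
Qed.

(** Lipschitz on every cube centred at the origin, for the sup norm. *)
Definition cube_lipschitz m (g : 'rV[R]_m -> R) : Prop :=
  forall k : nat, exists2 C : R, 0 <= C & forall (x y : 'rV[R]_m) (d : R), 0 <= d ->
    (forall i, `|x 0 i| <= k%:R) -> (forall i, `|y 0 i| <= k%:R) ->
    (forall i, `|x 0 i - y 0 i| <= d) -> `|g x - g y| <= C * d.

Lemma grid_point (M : nat) (y : R) : 0 <= y -> y <= M.+1%:R ->
  exists l : 'I_M.+1, `|y - l%:R| <= 1.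
Proof.
elim: M => [|M IH] y0 yM; first by exists ord0; rewrite subr0 ger0_norm.
have [yM'|yM'] := leP y M.+1%:R.
  by have [l yl] := IH y0 yM'; exists (widen_ord (leqnSn _) l).
exists ord_max => /=; rewrite ger0_norm; last by rewrite subr_ge0 ltW.
by move: yM; rewrite -[M.+2%:R]natr1; lra.
Qed.

Lemma grid_volume (D e y : R) (m N : nat) : 0 < e -> 0 <= D -> 1 <= y ->
  D ^+ N / e <= y -> (m < N)%N -> (D / y) ^+ N * y ^+ m <= e.
Proof.
move=> e0 D0 y1 De mN; have y0 : 0 < y by exact: lt_le_trans y1.
rewrite expr_div_n mulrAC ler_pdivrMr ?exprn_gt0 //.
apply: (@le_trans _ _ (e * y ^+ m.+1)).
  by rewrite exprS mulrA ler_wpM2r ?exprn_ge0 ?(ltW y0) // mulrC -ler_pdivrMr.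
by rewrite ler_wpM2l ?(ltW e0) // ler_weXn2l.
Qed.

(** An image of a space of smaller dimension: a cube of side 2 k is the union
    of (M + 1)^m small cubes of side 2 k / (M + 1), whose images have volume
    O((M + 1)^(- m - 1)). *)
Lemma lipschitz_image_null n m (f : 'rV[R]_m -> 'M[R]_n.+1) :
  (m < #|[pred p : 'I_n.+1 * 'I_n.+1 | (p.1 <= p.2)%N]|)%N ->
  (forall i j, cube_lipschitz (fun x => f x i j)) -> sym_null (range f).
Proof.
set N := #|_| => mN lf.
pose cube k := [set x : 'rV[R]_m | forall i, `|x 0 i| <= k%:R].
have rangeE : range f `<=` \bigcup_k (f @` cube k.+1).
  move=> _ [x _ <-]; exists (Num.trunc (\sum_i `|x 0 i|)) => //; exists x => // i /=.
  have s0 : 0 <= \sum_i `|x 0 i| by exact: sumr_ge0.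
  have /andP[_ /ltW] := truncn_itv s0; apply: le_trans.
  by rewrite (bigD1 i) //= lerDl sumr_ge0.
apply: (sub_sym_null rangeE); apply: bigcup_sym_null => k.
have [C C0 CP] : exists2 C, 0 <= C & forall i j x y d, 0 <= d ->
    cube k.+1 x -> cube k.+1 y -> (forall l, `|x 0 l - y 0 l| <= d) ->
    `|f x i j - f y i j| <= C * d.
  pose P (p : 'I_n.+1 * 'I_n.+1) C := 0 <= C /\ forall x y d, 0 <= d ->
    cube k.+1 x -> cube k.+1 y -> (forall l, `|x 0 l - y 0 l| <= d) ->
    `|f x p.1 p.2 - f y p.1 p.2| <= C * d.
  have [C CP] : {C & forall p, P p (C p)}.
    by apply: (@choice _ _ P) => -[i j]; have [C ? ?] := lf i j k.+1; exists C.
  have C0 p : 0 <= C p by case: (CP p).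
  exists (\sum_p C p) => [|i j x y d d0 xk yk xy]; first exact: sumr_ge0.
  have [_ h] := CP (i, j); apply: (le_trans (h x y d d0 xk yk xy)).
  by rewrite ler_wpM2r // (bigD1 (i, j)) //= lerDl sumr_ge0.
apply: fincover_sym_null => e e0.
pose D : R := 4 * C * k.+1%:R.
have D0 : 0 <= D by rewrite !mulr_ge0.
(* by the choice of M the total volume D ^ N / (M + 1) ^ (N - m) is below e *)
pose M := Num.trunc (D ^+ N / e); pose d : R := 2 * k.+1%:R / M.+1%:R.
have d0 : 0 < d by rewrite !mulr_gt0 // invr_gt0.
have Md : M.+1%:R * d = 2 * k.+1%:R by rewrite mulrC divfK // pnatr_eq0.
pose corner (phi : {ffun 'I_m -> 'I_M.+1}) : 'rV[R]_m := \row_i ((phi i)%:R * d - k.+1%:R).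
have cornerP phi : cube k.+1 (corner phi).
  move=> i; rewrite mxE ler_norml.
  have p0 : 0 <= (phi i)%:R * d by rewrite mulr_ge0 // ltW.
  have : (phi i)%:R * d <= M.+1%:R * d by rewrite ler_wpM2r ?(ltW d0) // ler_nat ltnW // ltn_ord.
  by rewrite Md; lra.
have Cd : C * d + C * d = D / M.+1%:R.
  have : M.+1%:R != 0 :> R by rewrite pnatr_eq0.
  by rewrite /d /D; move: (M.+1%:R) (k.+1%:R) => y z y0; field.
exists {ffun 'I_m -> 'I_M.+1}, (fun phi => f (corner phi) - const_mx (C * d)),
  (fun phi => f (corner phi) + const_mx (C * d)); split.
- move=> phi i j; rewrite !mxE lerD2l; have : 0 <= C * d by rewrite mulr_ge0 // ltW.
  lra.
- move=> _ [x xk <-].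
  have near i : exists l : 'I_M.+1, `|x 0 i - (l%:R * d - k.+1%:R)| <= d.
    have /andP[x1 x2] : - k.+1%:R <= x 0 i <= k.+1%:R by rewrite -ler_norml; exact: xk.
    have [||l lx] := @grid_point M ((x 0 i + k.+1%:R) / d).
    + by rewrite divr_ge0 // ?(ltW d0) //; lra.
    + by rewrite ler_pdivrMr // Md; lra.
    exists l; have -> : x 0 i - (l%:R * d - k.+1%:R) = ((x 0 i + k.+1%:R) / d - l%:R) * d.
      by field; rewrite gt_eqF.
    by rewrite normrM (gtr0_norm d0) -[leRHS]mul1r ler_wpM2r // ltW.
  have [phi phiP] : {phi : 'I_m -> 'I_M.+1 & forall i, `|x 0 i - ((phi i)%:R * d - k.+1%:R)| <= d}.
    exact: (@choice _ _ (fun i (l : 'I_M.+1) => `|x 0 i - (l%:R * d - k.+1%:R)| <= d)).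
  exists (finfun phi) => //= i j _; rewrite !mxE -ler_distl.
  by apply: CP => //; [exact: ltW|move=> l; rewrite mxE ffunE].
- have volE phi : box_volume (f (corner phi) - const_mx (C * d)) (f (corner phi) + const_mx (C * d)) =
      (D / M.+1%:R) ^+ N.
    rewrite -prodr_const; apply: eq_bigr => p _; rewrite !mxE -Cd; ring.
  under eq_bigr do rewrite volE.
  rewrite sumr_const card_ffun !card_ord -[leLHS]mulr_natr natrX.
  have De : 0 <= D ^+ N / e by rewrite divr_ge0 ?exprn_ge0 // ltW.
  have /andP[_ /ltW DM] := truncn_itv De.
  by apply: grid_volume => //; rewrite ler1n.
Qed.

End NullSets.

(** * Degenerate matrices *)

Section Degenerate.
Context {R : realType}.
Local Notation z3 := (ord_max : 'I_3).

Section Closure.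
Variable m : nat.
Implicit Types g h : 'rV[R]_m -> R.

Lemma cube_lipschitz_cst (a : R) : cube_lipschitz (fun _ : 'rV[R]_m => a).
Proof. by move=> k; exists 0 => // x y d d0 _ _ _; rewrite subrr normr0 mul0r. Qed.

Lemma cube_lipschitz_coord i : cube_lipschitz (fun x : 'rV[R]_m => x 0 i).
Proof. by move=> k; exists 1 => // x y d d0 _ _ xy; rewrite mul1r. Qed.

Lemma cube_lipschitzD g h : cube_lipschitz g -> cube_lipschitz h ->
  cube_lipschitz (fun x => g x + h x).
Proof.
move=> lg lh k; have [C C0 CP] := lg k; have [D D0 DP] := lh k.
exists (C + D) => [|x y d d0 xk yk xy]; first exact: addr_ge0.
rewrite opprD addrACA mulrDl; apply: le_trans (ler_normD _ _) _.
by apply: lerD; [exact: CP|exact: DP].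
Qed.

Lemma cube_lipschitzN g : cube_lipschitz g -> cube_lipschitz (fun x => - g x).
Proof.
move=> lg k; have [C C0 CP] := lg k; exists C => // x y d d0 xk yk xy.
by rewrite -opprD normrN; exact: CP.
Qed.

Lemma cube_lipschitzM g h : cube_lipschitz g -> cube_lipschitz h ->
  cube_lipschitz (fun x => g x * h x).
Proof.
move=> lg lh k; have [C C0 CP] := lg k; have [D D0 DP] := lh k.
have bound g' C' : (forall (x y : 'rV[R]_m) (d : R), 0 <= d ->
    (forall i, `|x 0 i| <= k%:R) -> (forall i, `|y 0 i| <= k%:R) ->
    (forall i, `|x 0 i - y 0 i| <= d) -> `|g' x - g' y| <= C' * d) -> forall x : 'rV[R]_m,
    (forall i, `|x 0 i| <= k%:R) -> `|g' x| <= `|g' 0| + C' * k%:R.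
  move=> gP x xk; rewrite -lerBlDl; apply: le_trans (lerB_dist _ _) _.
  by apply: gP => // i; rewrite mxE ?normr0 // subr0; exact: xk.
exists ((`|g 0| + C * k%:R) * D + (`|h 0| + D * k%:R) * C) => [|x y d d0 xk yk xy].
  by rewrite addr_ge0 // mulr_ge0 // addr_ge0 // mulr_ge0.
have -> : g x * h x - g y * h y = g x * (h x - h y) + h y * (g x - g y) by ring.
apply: le_trans (ler_normD _ _) _; rewrite !normrM mulrDl -!mulrA.
by apply: lerD; apply: ler_pM => //; [exact: bound|exact: DP|exact: bound|exact: CP].
Qed.

Lemma cube_lipschitz_row3 (a b c : 'rV[R]_m -> R) : cube_lipschitz a -> cube_lipschitz b ->
  cube_lipschitz c -> forall i, cube_lipschitz (fun x => row3 (a x) (b x) (c x) 0 i).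
Proof.
move=> la lb lc i; rewrite (_ : (fun _ => _) = if i == 0 then a else if i == 1 then b else c).
  by do 2?case: ifP.
by apply/funext => x; rewrite mxE; do 2?case: ifP.
Qed.

Lemma quaternion_mx_null (t : 'rV[R]_m -> R) (v p q : 'rV[R]_m -> 'rV[R]_3) : (m < 10)%N ->
  cube_lipschitz t -> (forall i, cube_lipschitz (fun x => v x 0 i)) ->
  (forall i, cube_lipschitz (fun x => p x 0 i)) ->
  (forall i, cube_lipschitz (fun x => q x 0 i)) ->
  sym_null (range (fun x => quaternion_mx (t x) (v x) (p x) (q x))).
Proof.
move=> m10 lt lv lp lq; apply: lipschitz_image_null => [|i j].
  apply: leq_trans m10 _; rewrite -sum1_card.
  rewrite -(pair_big_dep xpredT (fun i j : 'I_4 => (i <= j)%N) (fun _ _ => 1%N)) /=.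
  by under eq_bigr do rewrite big_mkcond !big_ord_recl big_ord0; rewrite !big_ord_recl big_ord0.
under eq_fun do rewrite mxE.
case: i j => [[|[|[|[|//]]]] hi] [[|[|[|[|//]]]] hj] /=;
  repeat (apply: cube_lipschitzD || apply: cube_lipschitzN || exact: lt || exact: lv
    || exact: lp || exact: lq).
Qed.

End Closure.

(** Outside of this set the rotated rows p and q satisfy 0 < |q| < |p|: an
    orthogonal pair of equal lengths is orthogonal before the rotation, and a
    pair with q = 0 is proportional before it. *)
Definition degenerate (p q : 'rV[R]_3) : Prop :=
  (exists t, p = t *: q) \/ dot p q = 0.

(** Three polynomial maps from R^9 cover the degenerate matrices: p = r q, and
    p orthogonal to q with the first coordinate of q zero, or nonzero and
    factored out. *)
Lemma degenerate_null :
  sym_null [set S : 'M[R]_4 | S \is symmetricmx /\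
                              degenerate (quaternion_row2 S) (quaternion_row3 S)].
Proof.
pose x_ k (x : 'rV[R]_9) := x 0 (inord k).
have lx k : cube_lipschitz (x_ k) by exact: cube_lipschitz_coord.
have xE (s : seq R) k : (k < 9)%N -> x_ k (\row_i s`_i) = s`_k.
  by move=> k9; rewrite /x_ mxE inordK.
pose v x := row3 (x_ 1 x) (x_ 2 x) (x_ 3 x).
have lv : forall i, cube_lipschitz (fun x => v x 0 i) by exact: cube_lipschitz_row3.
pose F1 x := quaternion_mx (x_ 0 x) (v x) (row3 (x_ 4 x) (x_ 5 x) (x_ 6 x))
  (row3 0 (x_ 7 x) (x_ 8 x)).
pose F2 x := quaternion_mx (x_ 0 x) (v x)
  (row3 (x_ 7 x * x_ 4 x) (x_ 7 x * x_ 5 x) (x_ 7 x * x_ 6 x))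
  (row3 (x_ 4 x) (x_ 5 x) (x_ 6 x)).
pose F3 x := quaternion_mx (x_ 0 x) (v x)
  (row3 (- (x_ 7 x * x_ 5 x + x_ 8 x * x_ 6 x)) (x_ 7 x) (x_ 8 x))
  (row3 (x_ 4 x) (x_ 4 x * x_ 5 x) (x_ 4 x * x_ 6 x)).
pose F k := if k is 0%N then F1 else if k is 1%N then F2 else F3.
apply: (@sub_sym_null R _ _ (\bigcup_k range (F k))); last first.
  apply: bigcup_sym_null => -[|[|k]]; apply: quaternion_mx_null => // i;
    apply: cube_lipschitz_row3 => //;
    repeat (apply: cube_lipschitzN || apply: cube_lipschitzD || apply: cube_lipschitzM
      || exact: cube_lipschitz_cst || exact: lx).
move=> S [symS]; have SE := symmetric_quaternion_mx symS; move: SE.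
move: (mean_trace S) (quaternion_row1 S) (quaternion_row2 S) (quaternion_row3 S) => t w p q SE.
have inF (f : 'rV[R]_9 -> 'M[R]_4) k s : F k = f -> f (\row_i s`_i) = S -> (\bigcup_k range (F k)) S.
  by move=> <- <-; exists k => //; exists (\row_i s`_i).
case=> [[r pE]|pq].
- apply: (inF F2 1%N [:: t; w 0 0; w 0 1; w 0 z3; q 0 0; q 0 1; q 0 z3; r; 0]) => //.
  rewrite /F2 /v !xE //= -!row3_eta SE; congr quaternion_mx.
  by rewrite [RHS]row3_eta pE !mxE.
- have [q0|q0] := eqVneq (q 0 0) 0.
    apply: (inF F1 0%N [:: t; w 0 0; w 0 1; w 0 z3; p 0 0; p 0 1; p 0 z3; q 0 1; q 0 z3]) => //.
    by rewrite /F1 /v !xE //= -!row3_eta SE [in RHS](row3_eta q) q0.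
  apply: (inF F3 2%N [:: t; w 0 0; w 0 1; w 0 z3; q 0 0; q 0 1 / q 0 0; q 0 z3 / q 0 0;
    p 0 1; p 0 z3]) => //.
  rewrite /F3 /v !xE //= -!row3_eta SE; congr quaternion_mx.
    rewrite [RHS]row3_eta; congr row3; apply: (mulIf q0); move: pq; rewrite /dot => pq.
    have -> : - (p 0 1 * (q 0 1 / q 0 0) + p 0 z3 * (q 0 z3 / q 0 0)) * q 0 0 =
      - (p 0 1 * q 0 1 + p 0 z3 * q 0 z3) by field.
    lra.
  by rewrite [RHS]row3_eta ![q 0 0 * _]mulrC !divfK.
Qed.

Lemma rotateK (p q : 'rV[R]_3) c s : c ^+ 2 + s ^+ 2 = 1 ->
  let p' := c *: p + s *: q in let q' := - s *: p + c *: q in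
  p = c *: p' - s *: q' /\ q = s *: p' + c *: q'.
Proof.
move=> cs /=; split; apply/rowP => i; rewrite !mxE.
  by transitivity ((c ^+ 2 + s ^+ 2) * p 0 i); [rewrite cs mul1r|ring].
by transitivity ((c ^+ 2 + s ^+ 2) * q 0 i); [rewrite cs mul1r|ring].
Qed.

Lemma dot_rotate (p q : 'rV[R]_3) c s : dot (c *: p - s *: q) (s *: p + c *: q) =
  c * s * (dot p p - dot q q) + (c ^+ 2 - s ^+ 2) * dot p q.
Proof. by rewrite /dot !mxE; ring. Qed.

(** The rotation of p and q brings the matrix into the normal form of the
    conics. *)
Lemma generic_linking (S0 : 'M[R]_4) : S0 \is symmetricmx ->
  ~ degenerate (quaternion_row2 S0) (quaternion_row3 S0) ->
  odd_linking_isu2 (coincidence S0 2) (coincidence S0 1) /\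
  odd_linking_isu2 (coincidence S0 2) (coincidence S0 3).
Proof.
move=> symS; set p := quaternion_row2 S0; set q := quaternion_row3 S0 => ndeg.
have [c [s /= [cs pq0 q21]]] := rotate_orthogonal p q.
have gr v := gram_rotate v p q cs; move: pq0 q21 gr => /=.
set p' := c *: p + _; set q' := _ + c *: q => pq0 q21 gr.
have [pE qE] := rotateK p q cs; rewrite -/p' -/q' in pE qE.
have dpq : dot p q = c * s * (dot p' p' - dot q' q') + (c ^+ 2 - s ^+ 2) * dot p' q'.
  by rewrite [in LHS]pE [in LHS]qE dot_rotate.
have q20 : 0 < dot q' q'.
  rewrite lt_neqAle dot_ge0 andbT eq_sym; apply/eqP => /dot_eq0 q0; apply: ndeg.
  move: pE qE; rewrite q0 !scaler0 subr0 addr0 => pE qE.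
  have [s0|sn] := eqVneq s 0.
    by right; rewrite dpq pq0 s0 mulr0 mul0r mulr0 addr0.
  by left; exists (c / s); rewrite {1}pE qE scalerA divfK.
have q2 : dot q' q' < dot p' p'.
  rewrite lt_neqAle q21 andbT; apply/eqP => e; apply: ndeg; right.
  by rewrite dpq pq0 e subrr !mulr0 addr0.
have linking (k : R) : k ^+ 2 = 1 ->
    odd_linking_isu2 (coincidence S0 2) (coincidence S0 (if 0 < k then 3 else 1)).
  move=> k2; have [ca fu C2 Cj] := generic_conics symS k2 pq0 q20 q2 gr.
  by rewrite /odd_linking_isu2 C2 Cj; apply: focal_odd_linking.
split; last by have := linking 1 (expr1n _ _); rewrite ltr01.
by have := linking (-1); rewrite sqrrN expr1n ltr0N1; apply.
Qed.

End Degenerate.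

Theorem mainTheorem1 (R : realType) :
  (forall S0 : 'M[R]_4, S0 \is symmetricmx ->
     [/\ coincidence S0 1 !=set0, coincidence S0 2 !=set0
       & coincidence S0 3 !=set0]) /\
  generic_sym (fun S0 : 'M[R]_4 =>
    odd_linking_isu2 (coincidence S0 2) (coincidence S0 1) /\
    odd_linking_isu2 (coincidence S0 2) (coincidence S0 3)).
Proof.
split=> [S0|]; first exact: coincidence_nonempty.
apply: sub_sym_null (@degenerate_null R) => S0 [symS notlinked]; split=> //.
by apply: contrapT => ndeg; apply: notlinked; exact: generic_linking.
Qed.
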